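(* Fix $k\in\mathbb{N}_0$ and let $\ell=\ell(m)$ be a sequence of non-negative integers such that $\ell=O(\sqrt{m})$. For integers $m\geq (k+1)^2$ consider the random vector $$V^{(m)}= \left( R^{(m+1)}, \dots , R^{(m+\ell)}, \lambda^{(m+\ell)} \right)$$ associated with the Plancherel growth process $\lambda^{(0)}\nearrow\lambda^{(1)}\nearrow\cdots$, with values in $\mathcal{N}^{\ell}\times\mathbb{Y}$, and the random vector $$\overline{V}^{(m)}= \left( \overline{R}^{(m+1)}, \dots , \overline{R}^{(m+\ell)}, \overline{\lambda}^{(m+\ell)} \right)$$ with values in $\mathcal{N}^{\ell}\times\mathbb{Y}$ whose coordinates are independent random variables such that $$\mathbb{P}\left\{ \overline{R}^{(m+i)}= r \right\} = \frac{1}{\sqrt{m}} \quad\text{for } r\in\{0,\dots,k\},\qquad \mathbb{P}\left\{ \overline{R}^{(m+i)}= \infty \right\} = 1- \frac{k+1}{\sqrt{m}}$$ for $1\leq i\leq\ell$, and $\overline{\lambda}^{(m+\ell)}$ is distributed according to the Plancherel measure $\operatorname{Plan}_{m+\ell}$. Then the total variation distance between $V^{(m)}$ and $\overline{V}^{(m)}$ converges to zero as $m\to\infty$; more specifically $$\delta\left(V^{(m)}, \overline{V}^{(m)}\right) = o\left(\frac{\ell}{\sqrt{m}}\right).$$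
   Context: $\mathbb{N}_0=\{0,1,2,\dots\}$; $\mathbb{Y}$ is the set of Young diagrams, $\mathbb{Y}_n$ the set of those with $n$ boxes. Rows of Young diagrams are indexed by $\mathbb{N}_0$; row $0$ is the bottom (longest) row (French convention). $\mu\nearrow\lambda$ means that $\lambda$ is obtained from $\mu$ by adding one box. Schensted row insertion $\mathcal{T}\leftarrow a$: put $a$ into row $0$, in the leftmost box containing an entry strictly bigger than $a$; if there is no such entry, put $a$ in the leftmost empty box of the row and stop; otherwise the previous content of the box is bumped and inserted by the same rule into the next row, and so on. For a finite sequence $w=(w_1,\dots,w_n)$, $\operatorname{RSK}(w)\in\mathbb{Y}_n$ is the shape of the insertion tableau $P(w)=((\emptyset\leftarrow w_1)\leftarrow w_2)\cdots\leftarrow w_n$. The Plancherel measure $\operatorname{Plan}_n$ on $\mathbb{Y}_n$ is the distribution of $\operatorname{RSK}(w)$ for a uniformly random permutation $w$ of $\{1,\dots,n\}$. The Plancherel growth process is any random sequence $\emptyset=\lambda^{(0)}\nearrow\lambda^{(1)}\nearrow\cdots$ with the same joint distribution as $\left(\operatorname{RSK}(\xi_1,\dots,\xi_n)\right)_{n\geq0}$, where $\xi_1,\xi_2,\dots$ are i.i.d. uniform on $[0,1]$. $\mathcal{N}=\{0,1,\dots,k,\infty\}$. For $n\geq1$ and $r\in\mathbb{N}_0$, $E^{(n)}_r$ is the event that the unique box of $\lambda^{(n)}/\lambda^{(n-1)}$ lies in row $r$. The $\mathcal{N}$-valued random variable $R^{(n)}$ equals $r$ if $E^{(n)}_r$ occurs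 for some $0\leq r\leq k$, and equals $\infty$ if $E^{(n)}_r$ occurs for some $r>k$. For random variables $X,Y$ with values in the same discrete set $S$, $\delta(X,Y)=\max_{A\subseteq S}|\mathbb{P}(X\in A)-\mathbb{P}(Y\in A)|$ is the total variation distance between their distributions. *)

(* Defs.v *)
From HB Require Import structures.
From mathcomp Require Import all_boot all_order all_algebra all_fingroup.
From mathcomp Require Import finmap.
From mathcomp Require Import all_classical all_reals all_analysis.

Set Implicit Arguments.
Unset Strict Implicit.
Unset Printing Implicit Defensive.

Import Order.TTheory GRing.Theory Num.Theory.
Import numFieldNormedType.Exports.

Local Open Scope classical_set_scope.
Local Open Scope ring_scope.

(* A Young diagram is the sequence of its row lengths, from row 0 (the bottom
   row in the French convention, the longest one) upwards. *)
Definition is_young (s : seq nat) : bool := sorted geq s && (0%N \notin s).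

Record young := Young { row_lengths : seq nat; _ : is_young row_lengths }.

HB.instance Definition _ := [isSub for row_lengths].
HB.instance Definition _ := [Countable of young by <:].

Definition young0 : young := @Young [::] isT.

HB.instance Definition _ := isPointed.Build young young0.
HB.instance Definition _ := @isMeasurable.Build default_measure_display
  young discrete_measurable discrete_measurable0
  discrete_measurableC discrete_measurableU.

Definition row_length (la : young) (i : nat) : nat := nth 0%N (row_lengths la) i.

(* mu ↗ la, the added box lying in row r *)
Definition adds_box_in_row (mu la : young) (r : nat) : Prop :=
  forall i, row_length la i = (row_length mu i + (i == r))%N.

Definition grows (mu la : young) : Prop := exists r, adds_box_in_row mu la r.

Section RowInsertion.
Context {disp : Order.disp_t} {T : orderType disp}.
Implicit Types (r s : seq T) (t : seq (seq T)) (a b : T).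

(* The new row, together with the bumped entry if there is one. *)
Fixpoint row_insert r a : seq T * option T :=
  if r is c :: r' then
    if (a < c)%O then (a :: r', Some c)
    else let: (r'', o) := row_insert r' a in (c :: r'', o)
  else ([:: a], None).

Fixpoint schensted_insert t a : seq (seq T) :=
  if t is r :: t' then
    match row_insert r a with
    | (r', None) => r' :: t'
    | (r', Some b) => r' :: schensted_insert t' b
    end
  else [:: [:: a]].

Definition insertion_tableau (w : seq T) : seq (seq T) :=
  foldl schensted_insert [::] w.

(* [r] can lie directly below [s]: column-strictness. *)
Fixpoint below r s : bool :=
  match r, s with
  | _, [::] => true
  | a :: r', b :: s' => (a < b)%O && below r' s'
  | [::], _ => false
  end.

Fixpoint column_strict t : bool :=
  if t is r :: t' then
    [&& r != [::], below r (head [::] t') & column_strict t']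
  else true.

Lemma belows0 r : below r [::]. Proof. by case: r. Qed.

Lemma below_size r s : below r s -> (size s <= size r)%N.
Proof.
elim: r s => [|a r IHr] [|b s] //= /andP[_ rs].
by rewrite ltnS; exact: IHr.
Qed.

Lemma row_insert_bump r a r' b : row_insert r a = (r', Some b) -> (a < b)%O.
Proof.
elim: r r' => [|c r IHr] r' //=; case: ifPn => [ac [_ <-] //|_].
by case E: (row_insert r a) => [r1 o] [_ oE]; apply: (IHr r1); rewrite E oE.
Qed.

Lemma row_insert_neq0 r a : (row_insert r a).1 != [::].
Proof. by case: r => [//|c r] /=; case: ifP => // _; case: (row_insert r a). Qed.

Lemma below_insertl r s a : below r s -> below (row_insert r a).1 s.
Proof.
elim: r s => [|c r IHr] [|b s] //=; first by rewrite belows0.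
case/andP=> cb rs; case: ifPn => [ac /=|_]; first by rewrite (lt_trans ac cb).
by move: (IHr s rs); case: (row_insert r a) => r1 o /= ->; rewrite cb.
Qed.

Lemma below_insert r s a r' b :
  below r s -> row_insert r a = (r', Some b) -> below r' (row_insert s b).1.
Proof.
elim: r s r' => [|c r IHr] s r' //=.
case: ifPn => [ac rs [<- <-]|].
  case: s rs => [|e s] /=; first by rewrite ac belows0.
  by case/andP=> ce rs; rewrite ce /= ac.
rewrite -leNgt => ca rs; case E: (row_insert r a) => [r1 o] [<- oE].
rewrite oE in E; have cb : (c < b)%O := le_lt_trans ca (row_insert_bump E).
case: s rs => [|e s] /=; first by rewrite cb belows0.
case/andP=> ce rs; case: ifPn => [be /=|_].
  by rewrite cb; move: (below_insertl a rs); rewrite E.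
by have := IHr _ _ rs E; case: (row_insert s b) => s1 o' /= ->; rewrite ce.
Qed.

Lemma head_schensted_insert t a : column_strict t ->
  head [::] (schensted_insert t a) = (row_insert (head [::] t) a).1.
Proof. by case: t => [//|r t] _ /=; case: (row_insert r a) => r' []. Qed.

Lemma column_strict_insert t a :
  column_strict t -> column_strict (schensted_insert t a).
Proof.
elim: t a => [//|r t IHt] a /= /and3P[r0 rt tt].
have := row_insert_neq0 r a; have := below_insertl a rt.
case E: (row_insert r a) => [r' [b|]] /= r't ->; last by rewrite r't tt.
by rewrite head_schensted_insert// (below_insert rt E) IHt.
Qed.

Lemma column_strict_insertion_tableau w : column_strict (insertion_tableau w).
Proof.
rewrite /insertion_tableau; have : column_strict [::] by [].
by elim: w [::] => [//|a w IHw] t tt /=; exact/IHw/column_strict_insert.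
Qed.

Lemma shape_young t : column_strict t -> is_young (shape t).
Proof.
rewrite /is_young; elim: t => [//|r [|s t] IHt] /= /and3P[r0 rs /IHt].
  by move=> _; rewrite inE eq_sym size_eq0.
case/andP=> /= st nz; rewrite st andbT below_size//=.
by rewrite inE negb_or eq_sym size_eq0 r0.
Qed.

Definition RSK (w : seq T) : young :=
  Young (shape_young (column_strict_insertion_tableau w)).

End RowInsertion.

(* Plan_n, given by its mass function; a permutation of {1, ..., n} is encoded
   by the word (s 0).+1, ..., (s n.-1).+1 with s : 'S_n. *)
Definition plancherel (R : realType) (n : nat) (mu : young) : R :=
  #|[pred s : 'S_n | RSK [seq (s i).+1 | i <- enum 'I_n] == mu]|%:R / n`!%:R.

(* N = {0, ..., k, oo}, with None standing for oo *)
Definition truncated_row (k : nat) : Type := option 'I_k.+1.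

HB.instance Definition _ k := Choice.on (truncated_row k).
HB.instance Definition _ k := isPointed.Build (truncated_row k) None.
HB.instance Definition _ k := @isMeasurable.Build default_measure_display
  (truncated_row k) discrete_measurable discrete_measurable0
  discrete_measurableC discrete_measurableU.

Section Probability.
Context {R : realType}.

Definition mutually_independent d (T : measurableType d) (P : probability T R)
    (I : choiceType) (C : I -> set (set T)) : Prop :=
  forall (J : {fset I}) (E : I -> set T), (forall i, i \in J -> C i (E i)) ->
  P (\bigcap_(i in [set` J]) E i) = (\prod_(i <- J) P (E i))%E.

Definition generated_by d (T : measurableType d) d' (S : measurableType d')
    (X : T -> S) : set (set T) :=
  preimage_set_system [set: T] X (@measurable d' S).

Definition iid_uniform01 d (T : measurableType d) (P : probability T R)
    (xi : nat -> {RV P >-> R}) : Prop :=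
  mutually_independent P (fun i => generated_by (xi i)) /\
  (forall i (A : set R), measurable A ->
     distribution P (xi i) A = uniform_prob (@ltr01 R) A).

(* The variable xi_i of the i.i.d. sequence xi_1, xi_2, ... is [xi i.-1].  The
   law of a process with countable state space is determined by its
   finite-dimensional distributions. *)
Definition plancherel_growth_process d (T : measurableType d)
    (P : probability T R) (la : nat -> {RV P >-> young}) : Prop :=
  (forall w, la 0%N w = young0) /\
  (forall n w, grows (la n w) (la n.+1 w)) /\
  exists d0 (T0 : measurableType d0) (P0 : probability T0 R)
         (xi : nat -> {RV P0 >-> R}),
    iid_uniform01 xi /\
    forall n (A : set (n.+1.-tuple young)),
      P [set w | A [tuple la i w | i < n.+1]] =
      P0 [set w | A [tuple RSK [seq xi j w | j <- iota 0 i] | i < n.+1]].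

(* The event E^(n)_r, for n >= 1. *)
Definition row_event d (T : measurableType d) (la : nat -> T -> young)
    (n r : nat) : set T :=
  [set w | adds_box_in_row (la n.-1 w) (la n w) r].

(* The random variable R^(n), for n >= 1. *)
Definition new_row d (T : measurableType d) (k : nat) (la : nat -> T -> young)
    (n : nat) (w : T) : truncated_row k :=
  [pick r : 'I_k.+1 | `[< row_event la n r w >]].

(* The random variables may live on different probability spaces. *)
Definition tv_dist d (T : measurableType d) (P : probability T R)
    d' (T' : measurableType d') (P' : probability T' R)
    (S : Type) (X : T -> S) (Y : T' -> S) : R :=
  sup [set `|fine (P (X @^-1` A)) - fine (P' (Y @^-1` A))| | A in [set: set S]].

End Probability.

(* Main.v *)
Require Import Defs.
From HB Require Import structures.
From mathcomp Require Import all_boot all_order all_algebra all_fingroup.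
From mathcomp Require Import finmap.
From mathcomp Require Import all_classical all_reals all_analysis.
From mathcomp Require Import zify ring lra.

Set Implicit Arguments.
Unset Strict Implicit.
Unset Printing Implicit Defensive.

Import Order.TTheory GRing.Theory Num.Theory.
Import numFieldNormedType.Exports.

Local Open Scope classical_set_scope.
Local Open Scope ring_scope.

(* Let f(mu) be the number of standard tableaux of shape mu.  RSK identifies the
   growth process with the Markov chain on Young's lattice for which every path
   from the empty diagram to nu has probability f(nu) / n!.  Hence the rows of the
   last l boxes and the final diagram are compared with the product law one step
   at a time: each step costs the expectation of |f(nu - e_r) / f(nu) - 1/sqrt n|
   over r <= k, where nu - e_r is nu without the last box of row r.

   The backward ratio f(nu - e_r) / f(nu) has second moment at most 1/n, so it is
   L1-close to 1/sqrt n, with error o(1/sqrt n), as soon as its mean, which is the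
   probability that a box falls in row r, is asymptotically 1/sqrt n.  Exchanging
   two consecutive additions shows that the probability of falling in one of the
   rows 0, ..., r decreases in time, so it suffices that
   E(lambda_0 + ... + lambda_r) ~ 2 (r + 1) sqrt n; the upper bound comes from the
   second moment bound.

   For the lower bound, DU - UD = 1 gives a recursion for the moments of the
   content of the new box, which, rescaled, asymptotically dominate the Catalan
   numbers.  Thus this content exceeds b sqrt n with positive probability for
   every b < 2, and such a box outside the rows 0, ..., k forces each of these
   rows to be longer than b sqrt n.  The spectral gap of the down-up chain bounds the variance of
   lambda_0 + ... + lambda_k by O(sqrt n), so that this sum concentrates. *)

(** * Adding and removing boxes *)

(** Looking backwards from the final diagram is what makes the ratio f(nu - e_r) / f(nu) appear: it
    is a function of nu alone, so the diagram stays a coordinate of the comparison. Since l errors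
    are added and the target is o(l / sqrt m), each must be o(1 / sqrt m); for X = sqrt n f(nu -
    e_r) / f(nu) this comes from E(X - 1)^2 <= 2 - 2 E X. The edge value 2 is reached without any
    limit shape. The moments give large contents only with a probability bounded away from 0. This
    suffices: if the mean of lambda_0 + ... + lambda_k were too small, such a content would require
    either a new box in the rows 0, ..., k or a deviation of order sqrt n, and both have probability
    O(1 / sqrt n). The mean row lengths are sums of probabilities over time, and the asymptotics of
    a sum say nothing about its terms; monotonicity in time supplies this. The exchange of two
    additions compares a lower row with a higher one, hence controls initial segments of rows, and
    single rows are recovered by subtraction. *)

Lemma row_length_anti (la : young) i j :
  (i <= j)%N -> (row_length la j <= row_length la i)%N.
Proof.
rewrite /row_length; case: la => s /= /andP[sS _] ij.
have [js|sj] := ltnP j (size s); last by rewrite nth_default.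
have geq_tr : transitive geq by move=> ? ? ? /= H1 H2; apply: leq_trans H2 H1.
have := sorted_leq_nth geq_tr (fun x => leqnn x) 0%N sS.
by move=> /(_ i j); apply => //; rewrite inE ?(leq_ltn_trans ij).
Qed.

Lemma nth_row_lengths_gt0 (la : young) i :
  (i < size (row_lengths la))%N = (0 < row_length la i)%N.
Proof.
rewrite /row_length; case: la => s /= /andP[sS s0].
have [js|sj] := ltnP i (size s); last by rewrite nth_default.
by rewrite lt0n; apply/esym/negP => /eqP e; move: s0; rewrite -e mem_nth.
Qed.

Lemma young_ext (la mu : young) : row_length la =1 row_length mu -> la = mu.
Proof.
move=> e; apply: val_inj; have sz : size (row_lengths la) = size (row_lengths mu).
  apply/eqP; rewrite eqn_leq; apply/andP; split; rewrite leqNgt.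
    by rewrite nth_row_lengths_gt0 e -nth_row_lengths_gt0 ltnn.
  by rewrite nth_row_lengths_gt0 -e -nth_row_lengths_gt0 ltnn.
by apply: (eq_from_nth (x0 := 0%N)) => // i _; exact: e.
Qed.

(* Junk value [young0] if [g] is not nonincreasing before its first zero. *)
Definition young_of (g : nat -> nat) (n : nat) : young :=
  insubd young0 (take (find (fun i => g i == 0%N) (iota 0 n)) (mkseq g n)).

Lemma row_length_young_of g n : (forall i, (g i.+1 <= g i)%N) -> g n = 0%N ->
  row_length (young_of g n) =1 g.
Proof.
move=> gm gn i; have ganti a b : (a <= b)%N -> (g b <= g a)%N.
  elim: b => [|b IH]; first by rewrite leqn0 => /eqP ->.
  by rewrite leq_eqVlt ltnS => /predU1P[->//|/IH]; apply: leq_trans (gm b).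
set a := fun i => g i == 0%N; set k := find a (iota 0 n).
have kn : (k <= n)%N by have := find_size a (iota 0 n); rewrite size_iota.
have gk : g k = 0%N.
  have [kn'|] := ltnP k n; last by move=> nk; have /eqP -> : k == n; rewrite ?eqn_leq ?kn.
  have : has a (iota 0 n) by rewrite has_find size_iota.
  by move/(nth_find 0%N); rewrite nth_iota// add0n => /eqP.
have gpos : forall j, (j < k)%N -> (0 < g j)%N.
  move=> j jk; have := before_find 0%N jk.
  by rewrite nth_iota ?add0n /a ?(leq_trans jk)// lt0n => ->.
have ek : (if (k < n)%N then k else n) = k.
  by case: (ltnP k n) => // nk; apply/eqP; rewrite eqn_leq nk kn.
have yP : is_young (take k (mkseq g n)).
  apply/andP; split; last first.
    apply/(nthP 0%N) => -[j]; rewrite size_take size_mkseq ek => jk e.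
    by move: e (gpos j jk); rewrite nth_take// nth_mkseq; lia.
  apply/(sortedP 0%N) => j; rewrite size_take size_mkseq ek => jk /=.
  by rewrite !nth_take ?nth_mkseq; try lia; apply: gm.
rewrite /row_length /young_of insubdK//.
have [ik|ki] := ltnP i k; first by rewrite nth_take// nth_mkseq//; lia.
rewrite nth_default; last by rewrite size_take size_mkseq ek.
by have := ganti _ _ ki; lia.
Qed.

Lemma row_length_size (la : young) i :
  (size (row_lengths la) <= i)%N -> row_length la i = 0%N.
Proof. by move=> ?; rewrite /row_length nth_default. Qed.

Definition addable (mu : young) (r : nat) : bool :=
  (r == 0%N) || (row_length mu r < row_length mu r.-1)%N.

Definition removable (la : young) (r : nat) : bool :=
  (row_length la r.+1 < row_length la r)%N.

Definition add_box (mu : young) (r : nat) : young :=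
  young_of (fun i => (row_length mu i + (i == r))%N)
    (maxn (size (row_lengths mu)) r.+1).

Definition rem_box (la : young) (r : nat) : young :=
  young_of (fun i => (row_length la i - (i == r))%N) (size (row_lengths la)).

Lemma row_length_add mu r : addable mu r ->
  row_length (add_box mu r) =1 (fun i => row_length mu i + (i == r))%N.
Proof.
move=> ar; apply: row_length_young_of => [i|].
  have := row_length_anti mu (leqnSn i).
  have [->|ni] := eqVneq i r; first by lia.
  have [e|] := eqVneq i.+1 r; last by lia.
  by move: ar; rewrite /addable -e /=; lia.
by rewrite row_length_size; lia.
Qed.

Lemma row_length_rem la r : removable la r ->
  row_length (rem_box la r) =1 (fun i => row_length la i - (i == r))%N.
Proof.
move=> ar; apply: row_length_young_of => [i|].
  have := row_length_anti la (leqnSn i).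
  by move: ar; rewrite /removable; have [->|] := eqVneq i r; lia.
by rewrite row_length_size; lia.
Qed.

Lemma adds_box_addable mu la r : adds_box_in_row mu la r -> addable mu r.
Proof.
rewrite /addable; case: r => // r h.
by have := row_length_anti la (leqnSn r); rewrite !h /= eqxx; lia.
Qed.

Lemma adds_boxE mu la r : adds_box_in_row mu la r -> la = add_box mu r.
Proof.
by move=> h; apply: young_ext => i; rewrite row_length_add ?h// (adds_box_addable h).
Qed.

Lemma adds_box_add mu r : addable mu r -> adds_box_in_row mu (add_box mu r) r.
Proof. by move=> a i; rewrite row_length_add. Qed.

Lemma adds_box_inj mu la r s :
  adds_box_in_row mu la r -> adds_box_in_row mu la s -> r = s.
Proof. by move=> h1 h2; have := h1 r; rewrite h2 eqxx; lia. Qed.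

Lemma removable_add mu r : addable mu r -> removable (add_box mu r) r.
Proof.
move=> a; rewrite /removable !row_length_add// eqxx.
by have := row_length_anti mu (leqnSn r); lia.
Qed.

Lemma addable_rem la r : removable la r -> addable (rem_box la r) r.
Proof.
rewrite /addable; case: r => // r a /=; rewrite !row_length_rem// eqxx.
by move: a; have := row_length_anti la (leqnSn r); rewrite /removable; lia.
Qed.

Lemma add_boxK mu r : addable mu r -> rem_box (add_box mu r) r = mu.
Proof.
move=> a; apply: young_ext => i.
by rewrite row_length_rem ?removable_add// row_length_add//; lia.
Qed.

Lemma rem_boxK la r : removable la r -> add_box (rem_box la r) r = la.
Proof.
move=> a; apply: young_ext => i; rewrite row_length_add ?addable_rem//.
by rewrite row_length_rem//; move: a; rewrite /removable; case: eqP => [->|]; lia.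
Qed.

(** Off-diagonal part of DU - UD = 1: the two moves can interfere only when the rows are adjacent,
    and then both orders impose the same inequality between the two row lengths. *)
Lemma add_rem_comm mu (r s : nat) : r != s ->
  addable mu r && removable (add_box mu r) s =
  removable mu s && addable (rem_box mu s) r.
Proof.
move=> rs; apply/andP/andP => -[h1 h2].
  have h3 : removable mu s.
    move: h2; rewrite /removable !row_length_add//; lia.
  split=> //; move: (h1) (h2); rewrite /addable.
  case: r rs h1 h2 => //= r rs h1 h2 _; rewrite /removable !row_length_add// !row_length_rem//.
  rewrite eqSS (negPf rs) [s == r.+1]eq_sym (negPf rs) [s == r]eq_sym.
  by have := h1; rewrite /addable /=; have [->|] := eqVneq r s; lia.
have h3 : addable mu r.
  by move: h2; rewrite /addable; case: r rs => //= r rs; rewrite !row_length_rem//; lia.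
split=> //; move: (h1) (h2); rewrite /removable !row_length_add// /addable.
case: r rs h1 h2 h3 => //= [|r] rs h1 h2 h3; first by lia.
rewrite !row_length_rem//; have [->|sr] := eqVneq s r; first by lia.
by move: (negPf sr); lia.
Qed.

Lemma add_rem_box_comm mu (r s : nat) : r != s ->
  addable mu r -> removable (add_box mu r) s ->
  rem_box (add_box mu r) s = add_box (rem_box mu s) r.
Proof.
move=> rs h1 h2; have /andP[h3 h4] : removable mu s && addable (rem_box mu s) r.
  by rewrite -add_rem_comm// h1.
apply: young_ext => i; rewrite row_length_rem// !row_length_add// row_length_rem//.
by move: rs; lia.
Qed.

Definition weight (la : young) : nat := sumn (row_lengths la).

Lemma weightE la M : (size (row_lengths la) <= M)%N ->
  weight la = (\sum_(i < M) row_length la i)%N.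
Proof.
move=> h; rewrite /weight sumnE (big_nth 0%N) big_mkord.
rewrite -(big_mkord xpredT (fun i => row_length la i)).
rewrite (big_cat_nat (n := size (row_lengths la)))//= big_mkord.
rewrite [X in (_ + X)%N]big_nat_cond [X in (_ + X)%N]big1 ?addn0//.
by move=> i /andP[/andP[h1 _] _]; exact: row_length_size.
Qed.

Lemma weight_size la : (size (row_lengths la) <= weight la)%N.
Proof.
rewrite (weightE (leqnn _)) -[X in (X <= _)%N]card_ord -sum1_card; apply: leq_sum => i _.
by rewrite -nth_row_lengths_gt0.
Qed.

Lemma weight_adds mu la r : adds_box_in_row mu la r -> weight la = (weight mu).+1.
Proof.
move=> h; pose M := maxn r.+1 (maxn (size (row_lengths mu)) (size (row_lengths la))).
rewrite (@weightE mu M) ?(@weightE la M); try (rewrite /M; lia).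
under eq_bigr do rewrite h.
rewrite big_split /= -addn1; congr (_ + _)%N.
have rM : (r < M)%N by rewrite /M; lia.
rewrite (bigD1 (Ordinal rM))//= eqxx big1 // => i /eqP ir.
by case: eqP => // e; case: ir; apply: val_inj.
Qed.

Lemma weight_add mu r : addable mu r -> weight (add_box mu r) = (weight mu).+1.
Proof. by move/adds_box_add/weight_adds. Qed.

Lemma weight_rem la r : removable la r -> weight la = (weight (rem_box la r)).+1.
Proof. by move=> h; rewrite -[in LHS](rem_boxK h) weight_add ?addable_rem. Qed.

Lemma addable_lt mu r : addable mu r -> (r <= weight mu)%N.
Proof.
case: r => // r a; apply: leq_trans (weight_size mu).
by rewrite nth_row_lengths_gt0; move: a; rewrite /addable /=; lia.
Qed.

Lemma removable_lt la r : removable la r -> (r < weight la)%N.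
Proof.
move=> a; apply: leq_trans (weight_size la).
by rewrite nth_row_lengths_gt0; move: a; rewrite /removable /=; lia.
Qed.

Lemma weight_eq0 la : (weight la == 0%N) = (la == young0).
Proof.
apply/eqP/eqP => [h|->//]; apply: young_ext => i.
have := weight_size la; rewrite h => h2; rewrite !row_length_size//; lia.
Qed.

Lemma removable_ex la : (0 < weight la)%N -> exists r, removable la r.
Proof.
move=> h; set s := size (row_lengths la); have s0 : (0 < s)%N.
  rewrite lt0n; apply/negP => /eqP s0.
  by move: h; rewrite (@weightE la 0) ?big_ord0// -/s s0.
exists s.-1; rewrite /removable prednK// row_length_size//.
by rewrite -nth_row_lengths_gt0 -/s; lia.
Qed.

(** * The up and down operators of Young's lattice *)

Section BoxSums.
Variable V : nmodType.
Implicit Types (F : nat -> V).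

(** The value does not depend on [M] once [M] exceeds the weight (for [down_sum], once it reaches
    it). Leaving [M] free lets sums attached to neighbouring diagrams share one index set, so that
    they can be exchanged. *)
Definition up_sum (M : nat) (mu : young) F : V := \sum_(r < M | addable mu r) F r.

Definition down_sum (M : nat) (la : young) F : V := \sum_(r < M | removable la r) F r.

Lemma up_sum_widen M N mu F : (weight mu < M)%N -> (M <= N)%N ->
  up_sum M mu F = up_sum N mu F.
Proof.
move=> h MN; rewrite /up_sum (big_ord_widen_cond N (addable mu) F MN).
apply: eq_bigl => r; case a: addable => //=.
by have := addable_lt a; lia.
Qed.

Lemma down_sum_widen M N la F : (weight la <= M)%N -> (M <= N)%N ->
  down_sum M la F = down_sum N la F.
Proof.
move=> h MN; rewrite /down_sum (big_ord_widen_cond N (removable la) F MN).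
apply: eq_bigl => r; case a: removable => //=.
by have := removable_lt a; lia.
Qed.

Lemma eq_up_sum M mu F F' : (forall r, addable mu r -> F r = F' r) ->
  up_sum M mu F = up_sum M mu F'.
Proof. by move=> h; apply: eq_bigr => r; apply: h. Qed.

Lemma eq_down_sum M la F F' : (forall r, removable la r -> F r = F' r) ->
  down_sum M la F = down_sum M la F'.
Proof. by move=> h; apply: eq_bigr => r; apply: h. Qed.

End BoxSums.

Section Commutation.
Variable R : comPzRingType.
Implicit Types (w : nat -> nat -> R) (G : young -> R) (h : R -> R).

(* The relation DU - UD = 1 of Young's lattice, with weights on the added box. *)
Lemma up_down_comm M mu w G :
  up_sum M mu (fun r => w r (row_length mu r) *
    down_sum M (add_box mu r) (fun s => G (rem_box (add_box mu r) s))) =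
  down_sum M mu (fun s => up_sum M (rem_box mu s) (fun r =>
    w r (row_length (rem_box mu s) r) * G (add_box (rem_box mu s) r))) +
  (up_sum M mu (fun r => w r (row_length mu r)) -
   down_sum M mu (fun s => w s (row_length mu s).-1)) * G mu.
Proof.
(* In both compositions the diagonal terms s = r return to [mu]. In the removal-first order the
   weight then sees row s after it has lost a box, hence the predecessor. The remaining terms are
   matched by [add_rem_comm]. *)
pose X (r s : 'I_M) := w r (row_length mu r) * G (rem_box (add_box mu r) s).
have E1 : up_sum M mu (fun r => w r (row_length mu r) *
    down_sum M (add_box mu r) (fun s => G (rem_box (add_box mu r) s))) =
  \sum_(r < M | addable mu r)
     \sum_(s < M | removable (add_box mu r) s && (s != r)) X r s +
  up_sum M mu (fun r => w r (row_length mu r)) * G mu.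
  rewrite /up_sum mulr_suml -big_split /=; apply: eq_bigr => r ar.
  rewrite /down_sum (bigD1 r) ?removable_add//= mulrDr addrC mulr_sumr.
  by rewrite /X add_boxK.
have E2 : down_sum M mu (fun s => up_sum M (rem_box mu s) (fun r =>
    w r (row_length (rem_box mu s) r) * G (add_box (rem_box mu s) r))) =
  \sum_(s < M | removable mu s)
     \sum_(r < M | addable (rem_box mu s) r && (r != s))
       w r (row_length (rem_box mu s) r) * G (add_box (rem_box mu s) r) +
  down_sum M mu (fun s => w s (row_length mu s).-1) * G mu.
  rewrite /down_sum mulr_suml -big_split /=; apply: eq_bigr => r ar.
  rewrite /up_sum (bigD1 r) ?addable_rem//= addrC; congr (_ + _).
  by rewrite rem_boxK// row_length_rem// eqxx subn1.
have E3 : \sum_(r < M | addable mu r)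
     \sum_(s < M | removable (add_box mu r) s && (s != r)) X r s =
  \sum_(s < M | removable mu s)
     \sum_(r < M | addable (rem_box mu s) r && (r != s))
       w r (row_length (rem_box mu s) r) * G (add_box (rem_box mu s) r).
  rewrite (exchange_big_dep (fun s : 'I_M => removable mu s)) /=; last first.
    move=> r s ar /andP[h1 h2].
    have : addable mu r && removable (add_box mu r) s by rewrite ar.
    by rewrite add_rem_comm 1?eq_sym// => /andP[].
  apply: eq_bigr => s rs; apply: eq_big => r.
    have [->|nrs] := eqVneq r s; first by rewrite !andbF.
    rewrite /= !andbT.
    by have := @add_rem_comm mu r s nrs; rewrite rs.
  case/andP=> ar /andP[h1 h2]; rewrite /X row_length_rem//.
  rewrite eq_sym in h2; rewrite (negPf (h2 : (r != s :> nat))) subn0.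
  by rewrite add_rem_box_comm.
rewrite E1 E2 E3; ring.
Qed.

(** Sum of [h] over the contents of the addable boxes minus its sum over the contents of the
    removable ones. The addable box of row r + 1 is paired with the removable box of row r: if these
    rows have equal length neither box exists, and the two terms cancel. *)
Definition corner_sum M h (la : young) : R :=
  h (row_length la 0)%:R +
  \sum_(r < M) (h ((row_length la r.+1)%:R - r.+1%:R) -
                h ((row_length la r)%:R - r.+1%:R)).

Lemma corner_sumE M h la : (weight la <= M)%N ->
  up_sum M.+1 la (fun r => h ((row_length la r)%:R - r%:R)) -
  down_sum M.+1 la (fun s => h ((row_length la s).-1%:R - s%:R)) =
  corner_sum M h la.
Proof.
move=> lM; rewrite /up_sum big_mkcond big_ord_recl /= subr0 -addrA; congr (_ + _).
rewrite /down_sum [X in _ - X]big_mkcond big_ord_recr /=.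
rewrite ifF; last by apply/negP => /removable_lt; lia.
rewrite addr0 -sumrB; apply: eq_bigr => r _.
rewrite /bump /= add1n /removable /addable /=; case: ltnP => [lt|ge].
  congr (_ - h _); case: (row_length la r) lt => // x _ /=.
  by rewrite -!natr1 opprD addrACA [1 - 1]subrr addr0.
have /eqP -> : row_length la r.+1 == row_length la r.
  by rewrite eqn_leq ge row_length_anti.
by rewrite !subrr.
Qed.

Lemma corner_sum1 M la : corner_sum M (fun=> 1) la = 1.
Proof. by rewrite /corner_sum big1 ?addr0// => r _; rewrite subrr. Qed.

Lemma corner_sum0 M h : corner_sum M h young0 = h 0.
Proof.
rewrite /corner_sum big1 ?addr0// => r _.
by rewrite /row_length !nth_nil subrr.
Qed.

(** A box added at content c turns an addable corner into a removable one, which costs 2 h(c); at c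
    + 1 and c - 1 it either creates an addable corner or destroys a removable one. *)
Lemma corner_sum_add M h mu t : (t < M)%N -> addable mu t ->
  let c := (row_length mu t)%:R - t%:R in
  corner_sum M h (add_box mu t) = corner_sum M h mu + (h (c + 1) + h (c - 1) - h c *+ 2).
Proof.
move=> tM at_ c.
have E la : corner_sum M h la = \sum_(r < M.+1) h ((row_length la r)%:R - r%:R) -
    \sum_(r < M) h ((row_length la r)%:R - r.+1%:R).
  by rewrite /corner_sum big_ord_recl /= subr0 sumrB addrA.
have tM1 : (t < M.+1)%N by lia.
rewrite !E (bigD1 (Ordinal tM1))//= (bigD1 (Ordinal tM))//=.
rewrite [in RHS](bigD1 (Ordinal tM1))//= [X in _ = _ - X + _](bigD1 (Ordinal tM))//=.
rewrite row_length_add// eqxx addn1.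
rewrite (eq_bigr (fun r : 'I_M.+1 => h ((row_length mu r)%:R - r%:R))); last first.
  by move=> r; rewrite -val_eqE /= => /negPf rt; rewrite row_length_add// rt addn0.
rewrite [X in _ - (_ + X)](eq_bigr (fun r : 'I_M => h ((row_length mu r)%:R - r.+1%:R))); last first.
  by move=> r; rewrite -val_eqE /= => /negPf rt; rewrite row_length_add// rt addn0.
have -> : (row_length mu t).+1%:R - t%:R = c + 1 by rewrite /c -natr1; ring.
have -> : (row_length mu t).+1%:R - t.+1%:R = c by rewrite /c -!natr1; ring.
have -> : (row_length mu t)%:R - t.+1%:R = c - 1 by rewrite /c -!natr1; ring.
rewrite -/c; ring.
Qed.

End Commutation.

(** * Numbers of standard tableaux and the levels of Young's lattice *)

Fixpoint dim_rec (n : nat) (la : young) : nat :=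
  if n is n'.+1 then (\sum_(r < n | removable la r) dim_rec n' (rem_box la r))%N
  else 1%N.

Definition dim (la : young) : nat := dim_rec (weight la) la.

Lemma dimE M la : (0 < weight la <= M)%N ->
  dim la = down_sum M la (fun r => dim (rem_box la r)).
Proof.
case/andP=> l0 lM; rewrite -(down_sum_widen _ (leqnn _) lM) /dim.
case E: (weight la) l0 => [//|n] _ /=; apply: eq_bigr => r /weight_rem.
by rewrite E => -[<-].
Qed.

Lemma dim0 : dim young0 = 1%N. Proof. by []. Qed.

Lemma dim_gt0 la : (0 < dim la)%N.
Proof.
elim/ltn_ind: {la}(weight la) {-2}la (erefl (weight la)) => n IH la e.
have [e0|l0] := posnP (weight la).
  by move/eqP: e0; rewrite weight_eq0 => /eqP ->.
rewrite (@dimE (weight la)) ?l0 ?leqnn//; have [r rr] := removable_ex l0.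
rewrite /down_sum (bigD1 (Ordinal (removable_lt rr)))//= ltn_addr//.
by apply: (IH (weight (rem_box la r))) => //; rewrite -e (weight_rem rr).
Qed.

(** Since D fixes [dim], DU - UD = 1 gives the value at [mu] as [dim mu] plus the sum of the values
    at the diagrams below [mu]; induction on the weight turns the latter into the weight times
    [dim mu]. *)
Lemma up_sum_dim (R : comPzRingType) M mu : (weight mu < M)%N ->
  up_sum M mu (fun r => (dim (add_box mu r))%:R) = (weight mu).+1%:R * (dim mu)%:R :> R.
Proof.
case: M => // M; rewrite ltnS.
have [n wn] := ubnP (weight mu); elim: n mu wn => // n IH mu wn wM.
transitivity (up_sum M.+1 mu (fun r => 1 *
   down_sum M.+1 (add_box mu r) (fun s => (dim (rem_box (add_box mu r) s))%:R)) : R).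
  apply: eq_up_sum => r ar; rewrite mul1r (@dimE M.+1) ?weight_add//.
  by rewrite /down_sum natr_sum.
rewrite (up_down_comm M.+1 mu (fun _ _ => 1) (fun la => (dim la)%:R)).
rewrite (corner_sumE (fun=> 1) wM) corner_sum1 mul1r -natr1 mulrDl mul1r.
congr (_ + _).
transitivity (down_sum M.+1 mu (fun s => (weight mu)%:R * (dim (rem_box mu s))%:R) : R).
  apply: eq_down_sum => s rs.
  have wr := weight_rem rs; rewrite wr -IH; [|lia..].
  by apply: eq_up_sum => r _; rewrite mul1r.
rewrite /down_sum -mulr_sumr; have [e|l0] := posnP (weight mu); first by rewrite e !mul0r.
by rewrite (@dimE M.+1 mu) ?l0 1?leqW// /down_sum natr_sum.
Qed.

Fixpoint youngs (n : nat) : seq young :=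
  if n is n'.+1 then
    undup [seq add_box mu r | mu <- youngs n', r <- [seq r <- iota 0 n | addable mu r]]
  else [:: young0].

Arguments youngs : simpl never.

Lemma youngs_uniq n : uniq (youngs n).
Proof. by case: n => // n; apply: undup_uniq. Qed.

Lemma mem_youngs n la : (la \in youngs n) = (weight la == n).
Proof.
elim: n la => [|n IH] la; first by rewrite inE weight_eq0.
rewrite mem_undup; apply/idP/idP.
  case/flatten_mapP => mu muP /mapP[r]; rewrite mem_filter => /andP[ar _] ->.
  by rewrite weight_add// eqSS -IH.
move=> /eqP w; have [|r rr] := @removable_ex la; first by rewrite w.
have wr := weight_rem rr; apply/flatten_mapP; exists (rem_box la r).
  by rewrite IH -eqSS -wr w.
apply/mapP; exists r; last by rewrite rem_boxK.
by rewrite mem_filter addable_rem// mem_iota add0n -w removable_lt.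
Qed.

Lemma weight_youngs n la : la \in youngs n -> weight la = n.
Proof. by rewrite mem_youngs => /eqP. Qed.

(** Double counting of the edges between two consecutive levels. As the summand may depend on the
    row and on both ends, this covers every use of the adjointness of U and D, weighted or not. *)
Lemma up_down_adjoint (V : nmodType) M n (F : nat -> young -> young -> V) :
  \sum_(nu <- youngs n.+1) down_sum M nu (fun r => F r (rem_box nu r) nu) =
  \sum_(mu <- youngs n) up_sum M mu (fun r => F r mu (add_box mu r)).
Proof.
rewrite /down_sum /up_sum (exchange_big_dep xpredT)//= [RHS](exchange_big_dep xpredT)//=.
apply: eq_bigr => r _; rewrite -[RHS]big_filter.
have P : perm_eq [seq mu <- youngs n | addable mu r]
                 [seq rem_box nu r | nu <- [seq nu <- youngs n.+1 | removable nu r]].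
  apply: uniq_perm.
  - by rewrite filter_uniq// youngs_uniq.
  - rewrite map_inj_in_uniq ?filter_uniq ?youngs_uniq// => x y.
    rewrite !mem_filter => /andP[rx _] /andP[ry _] e.
    by rewrite -(rem_boxK rx) e rem_boxK.
  - move=> mu; rewrite mem_filter; apply/andP/mapP.
      move=> [ar]; rewrite mem_youngs => /eqP wm; exists (add_box mu r).
        by rewrite mem_filter removable_add//= mem_youngs weight_add// wm.
      by rewrite add_boxK.
    move=> [nu]; rewrite mem_filter mem_youngs => /andP[rn /eqP wn] ->.
    by rewrite addable_rem// mem_youngs -eqSS -weight_rem ?wn.
rewrite (perm_big _ P) big_map big_filter.
by apply: eq_bigr => nu rn; rewrite rem_boxK.
Qed.

(** Follows from the up and down operators alone. The surjectivity of the Robinson-Schensted map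
    will be deduced from this count, so only its injectivity has to be proved. *)
Lemma sum_dim2 n : (\sum_(nu <- youngs n) dim nu ^ 2 = n`!)%N.
Proof.
elim: n => [|n IH]; first by rewrite big_seq1.
transitivity (\sum_(nu <- youngs n.+1) down_sum n.+1 nu (fun r => dim (rem_box nu r) * dim nu))%N.
  apply: eq_big_seq => nu /weight_youngs w.
  by rewrite expnS expn1 {1}(@dimE n.+1) ?w ?leqnn// /down_sum big_distrl.
rewrite (up_down_adjoint n.+1 n (fun r mu nu => (dim mu * dim nu)%N)).
rewrite factS -IH big_distrr /=; apply: eq_big_seq => mu /weight_youngs w.
apply/eqP; rewrite -(eqr_nat int) /up_sum natr_sum.
under eq_bigr do rewrite natrM.
have := @up_sum_dim int n.+1 mu; rewrite w ltnSn /up_sum => /(_ isT) e.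
by rewrite -mulr_sumr e natrM natrX expr2 mulrCA.
Qed.

(** * The Robinson-Schensted correspondence *)

Section Simulation.
Context (I : Type) (d d' : Order.disp_t) (T : orderType d) (T' : orderType d').
Variables (x : I -> T) (x' : I -> T') (Q : I -> bool).
Hypothesis xx' : forall i j, Q i -> Q j -> (x i < x j)%O = (x' i < x' j)%O.

(** Insertion only compares letters, so it can be run on indices and read through [x] and [x'] at
    once. This is the passage from real letters to permutations. *)
Lemma row_insert_sim (r : seq I) a : Q a -> all Q r ->
  exists r1 o, [/\ row_insert (map x r) (x a) = (map x r1, omap x o),
    row_insert (map x' r) (x' a) = (map x' r1, omap x' o),
    all Q r1 & oapp Q true o].
Proof.
move=> Qa; elim: r => [_|c r IH /= /andP[Qc Qr]].
  by exists [:: a], None; split => //=; rewrite Qa.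
rewrite -xx'//; case: ifPn => ac.
  by exists (a :: r), (Some c); split => //=; rewrite Qa.
have [r1 [ob [-> -> Q1 Qo]]] := IH Qr.
by exists (c :: r1), ob; split => //=; rewrite Qc.
Qed.

Lemma schensted_insert_sim (t : seq (seq I)) a : Q a -> all (all Q) t ->
  exists u, [/\ schensted_insert (map (map x) t) (x a) = map (map x) u,
    schensted_insert (map (map x') t) (x' a) = map (map x') u & all (all Q) u].
Proof.
elim: t a => [|r t IH] a Qa /=; first by exists [:: [:: a]]; rewrite /= Qa.
case/andP=> Qr Qt; have [r1 [[b|] /= [-> -> Q1 Qo]]] := row_insert_sim Qa Qr.
  by have [u [-> -> Qu]] := IH b Qo Qt; exists (r1 :: u); rewrite /= Q1.
by exists (r1 :: t); rewrite /= Q1.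
Qed.

Lemma shape_sim (s : seq I) : all Q s ->
  shape (insertion_tableau (map x s)) = shape (insertion_tableau (map x' s)).
Proof.
move=> Qs; suff [u [-> -> _]] : exists u,
    [/\ insertion_tableau (map x s) = map (map x) u,
    insertion_tableau (map x' s) = map (map x') u & all (all Q) u].
  by rewrite /shape -!map_comp; apply: eq_map => r /=; rewrite !size_map.
elim/last_ind: s Qs => [_|s a IH]; first by exists [::].
rewrite all_rcons => /andP[Qa /IH[u [e e' Qu]]].
rewrite /insertion_tableau !map_rcons !foldl_rcons.
rewrite -/(insertion_tableau (map x s)) -/(insertion_tableau (map x' s)) e e'.
exact: schensted_insert_sim.
Qed.

Lemma RSK_sim (s : seq I) : all Q s -> RSK (map x s) = RSK (map x' s).
Proof. by move=> Qs; apply: val_inj; exact: shape_sim. Qed.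

End Simulation.

Section Insertion.
Context (d : Order.disp_t) (T : orderType d).
Implicit Types (r : seq T) (t : seq (seq T)) (a b : T).

Lemma row_insert_None r a r' : row_insert r a = (r', None) -> size r' = (size r).+1.
Proof.
elim: r r' => [|c r IH] r' /=; first by case=> <-.
case: ifP => // _; case E: (row_insert r a) => [r1 [b|]] // [<-] /=.
by rewrite (IH r1).
Qed.

Lemma row_insert_Some r a r' b : row_insert r a = (r', Some b) -> size r' = size r.
Proof.
elim: r r' => [|c r IH] r' //=; case: ifP => [_ [<- _] //|_].
by case E: (row_insert r a) => [r1 [b1|]] // [<- e] /=; rewrite (IH r1)// E e.
Qed.

Lemma row_insert_mem r a : a \in (row_insert r a).1.
Proof.
elim: r => [|c r IH] /=; first by rewrite inE.
case: ifP => _; first by rewrite inE eqxx.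
by case E: (row_insert r a) IH => [r1 o] /= h; rewrite inE h orbT.
Qed.

Lemma row_insert_path r a c : (c <= a)%O -> path <=%O c r ->
  path <=%O c (row_insert r a).1.
Proof.
elim: r c => [|e r IH] c /= ca; first by rewrite ca.
case/andP=> ce er; case: ifPn => [ae /=|].
  rewrite ca /=; case: r er {IH} => //= f r /andP[ef ->].
  by rewrite (le_trans (ltW ae) ef).
rewrite -leNgt => ea; have := IH e ea er.
by case: (row_insert r a) => r1 o /= ->; rewrite ce.
Qed.

Lemma row_insert_sorted r a : sorted <=%O r -> sorted <=%O (row_insert r a).1.
Proof.
case: r => //= c r cr; case: ifPn => [ac /=|].
  by case: r cr => //= f r /andP[ef ->]; rewrite (le_trans (ltW ac) ef).
rewrite -leNgt => ca; have := row_insert_path ca cr.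
by case: (row_insert r a).
Qed.

Lemma schensted_insert_sorted t a :
  all (sorted <=%O) t -> all (sorted <=%O) (schensted_insert t a).
Proof.
elim: t a => //= r t IH a /andP[sr st].
have := row_insert_sorted a sr; case: (row_insert r a) => r' [b|] /= ->//.
exact: IH.
Qed.

Lemma insertion_tableau_rcons w a :
  insertion_tableau (rcons w a) = schensted_insert (insertion_tableau w) a :> seq (seq T).
Proof. by rewrite /insertion_tableau foldl_rcons. Qed.

Lemma insertion_tableau_sorted (w : seq T) : all (sorted <=%O) (insertion_tableau w).
Proof.
elim/last_ind: w => // w a IH; rewrite insertion_tableau_rcons.
exact: schensted_insert_sorted.
Qed.

Lemma shape_insert t a :
  exists k : nat, shape (schensted_insert t a) = incr_nth (shape t) k.
Proof.
elim: t a => [|r t IH] a /=; first by exists 0%N.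
case E: (row_insert r a) => [r' [b|]] /=.
  by have [k e] := IH b; exists k.+1; rewrite /= -e (row_insert_Some E).
by exists 0%N; rewrite (row_insert_None E).
Qed.

Lemma RSK_rcons (w : seq T) a : grows (RSK w) (RSK (rcons w a)).
Proof.
have [r e] := shape_insert (insertion_tableau w) a; exists r => i.
by rewrite /row_length /= insertion_tableau_rcons e nth_incr_nth addnC eq_sym.
Qed.

Lemma row_insert_inj r1 r2 a1 a2 : sorted <=%O r1 -> sorted <=%O r2 ->
  size r1 = size r2 -> row_insert r1 a1 = row_insert r2 a2 -> r1 = r2 /\ a1 = a2.
Proof.
(* One insertion bumps the first entry [c1] and the other passes beyond its first entry. Then [b2]
   ends up in [q1], hence is at least [c1], although it bumps [c1]. *)
have aux c1 c2 q1 q2 b1 b2 : path <=%O c1 q1 ->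
    (b1 :: q1, Some c1) = (let: (r'', o) := row_insert q2 b2 in (c2 :: r'', o)) -> False.
  move=> p1; case E: (row_insert q2 b2) => [q o] [_ eq eo].
  have := row_insert_mem q2 b2; rewrite E /= -eq => bq.
  rewrite -eo in E; have := row_insert_bump E.
  by move: p1; rewrite (path_sortedE le_trans) => /andP[/allP/(_ _ bq) h _]; rewrite ltNge h.
elim: r1 r2 => [|c1 r1 IH] [|c2 r2] //=; first by move=> _ _ _ [->].
move=> p1 p2 [sz]; case: ifPn => h1; case: ifPn => h2.
- by case=> -> -> ->.
- by move/(aux _ _ _ _ _ _ p1).
- by move/esym/(aux _ _ _ _ _ _ p2).
case E1: (row_insert r1 a1) => [q1 o1]; case E2: (row_insert r2 a2) => [q2 o2].
case=> -> eq eo; have [|||-> ->] := IH r2 _ _ sz _ => //.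
- exact: path_sorted p1.
- exact: path_sorted p2.
- by rewrite E1 E2 eq eo.
Qed.

Lemma schensted_insert_inj t1 t2 a1 a2 :
  all (sorted <=%O) t1 -> all (sorted <=%O) t2 -> shape t1 = shape t2 ->
  schensted_insert t1 a1 = schensted_insert t2 a2 -> t1 = t2 /\ a1 = a2.
Proof.
elim: t1 t2 a1 a2 => [|r1 t1 IH] [|r2 t2] //= a1 a2; first by move=> _ _ _ [->].
case/andP=> s1 st1 /andP[s2 st2] [sz szt].
case E1: (row_insert r1 a1) => [q1 [b1|]]; case E2: (row_insert r2 a2) => [q2 [b2|]].
- case=> eq /(IH _ _ _ st1 st2 szt)[-> eb].
  by have [|-> ->] := row_insert_inj s1 s2 sz (a1 := a1) (a2 := a2); rewrite ?E1 ?E2 ?eq ?eb.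
- by case=> eq; have := row_insert_Some E1; rewrite eq (row_insert_None E2) sz; lia.
- by case=> eq; have := row_insert_Some E2; rewrite -eq (row_insert_None E1) sz; lia.
case=> eq ->.
by have [|-> ->] := row_insert_inj s1 s2 sz (a1 := a1) (a2 := a2); rewrite ?E1 ?E2 ?eq.
Qed.

(** The recording tableau, kept as the sequence of shapes because this is what the growth process
    observes. *)
Definition rsk_path (w : seq T) : seq young :=
  [seq RSK (take i w) | i <- iota 0 (size w).+1].

Lemma size_rsk_path w : size (rsk_path w) = (size w).+1.
Proof. by rewrite size_map size_iota. Qed.

Lemma rsk_path_rcons w a : rsk_path (rcons w a) = rcons (rsk_path w) (RSK (rcons w a)).
Proof.
rewrite /rsk_path size_rcons -addn1 iotaD map_cat [iota (_ + _) 1]/= [map _ [:: _]]/= cats1.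
rewrite add0n take_oversize ?size_rcons//; congr rcons; apply/eq_in_map => i.
by rewrite mem_iota add0n ltnS /= => iw; rewrite -cats1 takel_cat.
Qed.

Lemma last_rsk_path w : last young0 (rsk_path w) = RSK w.
Proof.
elim/last_ind: w => [|w a _]; first by apply: val_inj.
by rewrite rsk_path_rcons last_rcons.
Qed.

Lemma rsk_inj (w1 w2 : seq T) : rsk_path w1 = rsk_path w2 ->
  insertion_tableau w1 = insertion_tableau w2 -> w1 = w2.
Proof.
elim/last_ind: w1 w2 => [|w1 a1 IH] w2; case/lastP: w2 => [|w2 a2] //.
- by move/(congr1 size); rewrite !size_rsk_path size_rcons.
- by move/(congr1 size); rewrite !size_rsk_path size_rcons.
rewrite !rsk_path_rcons !insertion_tableau_rcons => /rcons_inj/(congr1 fst) /= ep.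
have sh : shape (insertion_tableau w1) = shape (insertion_tableau w2).
  by have := congr1 (fun p => row_lengths (last young0 p)) ep; rewrite !last_rsk_path.
case/(schensted_insert_inj (insertion_tableau_sorted _) (insertion_tableau_sorted _) sh).
by move=> et ->; rewrite (IH w2).
Qed.

Lemma perm_row_insert r a : perm_eq (a :: r)
  (oapp (cons^~ (row_insert r a).1) (row_insert r a).1 (row_insert r a).2).
Proof.
elim: r => //= c r IH; case: ifPn => _ /=.
  by apply/seq.permP => p /=; rewrite addnCA.
case E: (row_insert r a) IH => [q [b|]] /= h.
  by apply/seq.permP => p /=; move/seq.permP: h => /(_ p) /=; lia.
by apply/seq.permP => p /=; move/seq.permP: h => /(_ p) /=; lia.
Qed.

Lemma perm_schensted_insert t a :
  perm_eq (flatten (schensted_insert t a)) (a :: flatten t).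
Proof.
elim: t a => //= r t IH a; have := perm_row_insert r a.
case E: (row_insert r a) => [q [b|]] /= /seq.permP h; apply/seq.permP => p /=.
  move: (h p) (seq.permP (IH b) p) => /=; rewrite !count_cat; lia.
by move: (h p) => /=; rewrite !count_cat; lia.
Qed.

Lemma perm_insertion_tableau (w : seq T) : perm_eq (flatten (insertion_tableau w)) w.
Proof.
elim/last_ind: w => // w a IH; rewrite insertion_tableau_rcons.
apply: perm_trans (perm_schensted_insert _ _) _.
by rewrite perm_sym perm_rcons perm_cons perm_sym.
Qed.

End Insertion.

(** * Standard tableaux are counted by [dim] *)

Section StandardTableaux.
Implicit Types (t u : seq (seq nat)) (r s q : seq nat).

Definition put (n k : nat) u : seq (seq nat) :=
  set_nth [::] u k (rcons (nth [::] u k) n).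

Lemma below_rconsr r s n : below r (rcons s n) -> below r s.
Proof. by elim: r s => [|a r IH] [|b s] //= /andP[-> /IH]. Qed.

Lemma below_rconsl r s n : below (rcons r n) s -> (forall b, b \in s -> (b <= n)%N) ->
  below r s.
Proof.
elim: r s => [|a r IH] [|b s] //=.
  by rewrite ltEnat /= => /andP[nb _] /(_ b); rewrite inE eqxx => /(_ isT); lia.
by case/andP=> -> rs h; apply: IH rs _ => c cs; apply: h; rewrite inE cs orbT.
Qed.

Lemma sorted_rcons_max r n : sorted <=%O r -> n \in r ->
  (forall b, b \in r -> (b <= n)%N) -> exists q, r = rcons q n.
Proof.
case/lastP: r => // q m; rewrite (sorted_pairwise le_trans) pairwise_rcons.
case/andP=> /allP qm _; rewrite mem_rcons inE => nq h.
exists q; congr rcons; apply/eqP; rewrite eqn_leq h ?mem_rcons ?inE ?eqxx//=.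
by case/orP: nq => [/eqP -> //|/qm].
Qed.

Lemma remove_max t n : all (sorted <=%O) t -> column_strict t ->
  n \in flatten t -> (forall b, b \in flatten t -> (b <= n)%N) ->
  exists k u, [/\ all (sorted <=%O) u, column_strict u,
    perm_eq (flatten t) (n :: flatten u), t = put n k u &
    forall i, nth 0%N (shape t) i = (nth 0%N (shape u) i + (i == k))%N] /\
    forall s, below s (head [::] t) -> below s (head [::] u).
Proof.
elim: t => //= r t IH /andP[sr st] /and3P[r0 rt ct] nrt h.
have [nr|nr] := boolP (n \in r).
  have [|q rq] := sorted_rcons_max sr nr.
    by move=> b br; apply: h; rewrite mem_cat br.
  have qt : below q (head [::] t).
    rewrite rq in rt; apply: below_rconsl rt _ => b bt; apply: h; rewrite mem_cat.
    by case: (t) bt => //= ? ? bt; rewrite mem_cat bt orbT.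
  (* If [n] is alone in its row, the row above would need an entry larger than [n]; so there is none
     and the row disappears. [put] recreates it from the default empty row. *)
  have [q0|q0] := eqVneq q [::].
    have t0 : t = [::].
      case: (t) qt ct => // s t' /=; rewrite q0 => qs /and3P[s0 _ _].
      by case: (s) s0 qs.
    exists 0%N, [::]; rewrite rq q0 t0; split; last by move=> s _; exact: belows0.
    by split => // -[|[]].
  exists 0%N, (q :: t); split; last by move=> s; rewrite rq; apply: below_rconsr.
  split.
  - by rewrite /= st andbT; move: sr; rewrite rq -cats1 => /cat_sorted2[].
  - by rewrite /= q0 qt ct.
  - by rewrite rq /= cat_rcons perm_catC /= perm_cons perm_catC.
  - by rewrite rq.
  - by case=> [|i] /=; rewrite ?addn0// rq size_rcons addn1.
have nt : n \in flatten t by move: nrt; rewrite mem_cat (negPf nr).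
have [k [u [[su cu pu tu hu] bu]]] := IH st ct nt
  (fun b bt => h b (eq_ind_r is_true (eq_ind_r (fun x => is_true (_ || x)) (orbT _) bt) (mem_cat _ _ _))).
exists k.+1, (r :: u); split; last by [].
split; rewrite /= ?sr ?r0 ?bu//.
- by rewrite perm_sym -cat1s perm_catCA perm_cat2l perm_sym.
- by rewrite {1}tu.
- by case=> [|i] /=; rewrite ?addn0 ?hu ?eqSS.
Qed.

Fixpoint tableaux (n : nat) (la : young) : seq (seq (seq nat)) :=
  if n is n'.+1 then
    flatten [seq [seq put n k u | u <- tableaux n' (rem_box la k)]
            | k <- [seq k <- iota 0 n | removable la k]]
  else [:: [::]].

Lemma size_tableaux n la : size (tableaux n la) = dim_rec n la.
Proof.
elim: n la => // n IH la; rewrite [tableaux _ _]/tableaux -/tableaux size_flatten sumnE.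
rewrite /shape !big_map big_filter.
rewrite [dim_rec _ _]/= -(big_mkord (removable la) (fun k => dim_rec n (rem_box la k))).
by apply: eq_bigr => r _; rewrite size_map IH.
Qed.

(** Inclusion in the list gives an upper bound [dim_rec n la] for the number of insertion tableaux
    of a given shape; equality will come from the global count n!. *)
Lemma standard_tableaux n (la : young) t : all (sorted <=%O) t -> column_strict t ->
  perm_eq (flatten t) (iota 1 n) -> shape t = row_lengths la -> t \in tableaux n la.
Proof.
elim: n la t => [|n IH] la t st ct pt sh.
  rewrite /= inE; case: t ct pt {st sh} => //= r t /and3P[r0 _ _] /perm_size /=.
  by rewrite size_cat; case: r r0.
have [||k [u [[su cu pu tu hu] _]]] := @remove_max t n.+1 st ct.
- by rewrite (perm_mem pt) mem_iota; lia.
- by move=> b; rewrite (perm_mem pt) mem_iota; lia.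
have pu' : perm_eq (flatten u) (iota 1 n).
  rewrite -(perm_cons n.+1) -(permPl pu) (permPl pt) -[in X in perm_eq X _](addn1 n) iotaD /= cats1 add1n.
  by rewrite perm_rcons.
pose mu := Young (shape_young cu).
have ab : adds_box_in_row mu la k by move=> i; rewrite /row_length -sh /= hu.
have ak := adds_box_addable ab; have la_mu := adds_boxE ab.
have wu : weight mu = n.
  by rewrite /weight /= -size_flatten -(size_iota 1 n) -(perm_size pu').
apply/flatten_mapP; exists k.
  rewrite mem_filter la_mu removable_add// mem_iota /= ltnS.
  by rewrite -wu addable_lt.
apply/mapP; exists u => //; rewrite la_mu add_boxK//.
exact: IH.
Qed.

End StandardTableaux.

(** * Paths from the empty diagram and uniform permutations *)

Fixpoint paths (n : nat) : seq (seq young) :=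
  if n is n'.+1 then
    flatten [seq [seq rcons p (add_box (last young0 p) r)
                 | r <- [seq r <- iota 0 n | addable (last young0 p) r]] | p <- paths n']
  else [:: [:: young0]].

Arguments paths : simpl never.

Lemma paths_size n p : p \in paths n -> size p = n.+1.
Proof.
elim: n p => [|n IH] p; first by rewrite inE => /eqP ->.
by case/flatten_mapP => q /IH sq /mapP[r _ ->]; rewrite size_rcons sq.
Qed.

Lemma paths_weight n p : p \in paths n -> weight (last young0 p) = n.
Proof.
elim: n p => [|n IH] p; first by rewrite inE => /eqP ->.
case/flatten_mapP => q /IH sq /mapP[r]; rewrite mem_filter => /andP[ar _] ->.
by rewrite last_rcons weight_add// sq.
Qed.

Lemma add_box_inj mu r s : addable mu r -> addable mu s ->
  add_box mu r = add_box mu s -> r = s.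
Proof.
move=> ar as_ e; apply: (@adds_box_inj mu (add_box mu r)); first exact: adds_box_add.
by rewrite e; apply: adds_box_add.
Qed.

Lemma paths_uniq n : uniq (paths n).
Proof.
elim: n => // n IH; apply: allpairs_uniq_dep => //.
- by move=> p _; rewrite filter_uniq// iota_uniq.
- move=> ? ? /allpairsPdep[p [r [pP rP ->]]] /allpairsPdep[q [s [qP sP ->]]] /= /rcons_inj e.
  have /= pq := congr1 fst e; have /= := congr1 snd e; rewrite -pq in sP *.
  move: rP sP; rewrite !mem_filter => /andP[ar _] /andP[as_ _] /add_box_inj -> //.
Qed.

Lemma paths_rcons n p nu mu : p \in paths n -> last young0 p = mu -> grows mu nu ->
  rcons p nu \in paths n.+1.
Proof.
move=> pn pm [r /[dup] /adds_boxE -> /adds_box_addable ar].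
apply/flatten_mapP; exists p => //; apply/mapP; exists r; last by rewrite pm.
rewrite mem_filter pm ar mem_iota /= ltnS -(paths_weight pn) pm.
exact: addable_lt.
Qed.

Lemma rsk_path_paths d (T : orderType d) (w : seq T) : rsk_path w \in paths (size w).
Proof.
elim/last_ind: w => [|w a IH].
  by rewrite /rsk_path /= inE; apply/eqP; congr [:: _]; apply: val_inj.
rewrite rsk_path_rcons size_rcons; apply: paths_rcons IH (last_rsk_path _) _.
exact: RSK_rcons.
Qed.

Lemma sum_pathsS (V : nmodType) n (F : seq young -> V) :
  \sum_(p <- paths n.+1) F p =
  \sum_(p <- paths n) up_sum n.+1 (last young0 p)
     (fun r => F (rcons p (add_box (last young0 p) r))).
Proof.
rewrite [paths _.+1]/paths -/paths big_flatten big_map; apply: eq_bigr => p _.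
rewrite big_map big_filter /up_sum -(big_mkord (addable (last young0 p))
  (fun r => F (rcons p (add_box (last young0 p) r)))).
by [].
Qed.

Lemma sum_paths_last (V : nmodType) n (F : young -> V) :
  \sum_(p <- paths n) F (last young0 p) = \sum_(nu <- youngs n) F nu *+ dim nu.
Proof.
elim: n F => [|n IH] F; first by rewrite !big_seq1.
rewrite sum_pathsS.
under eq_bigr do under [up_sum _ _ _]eq_bigr do rewrite last_rcons.
rewrite (IH (fun mu => up_sum n.+1 mu (fun r => F (add_box mu r)))).
transitivity (\sum_(mu <- youngs n) up_sum n.+1 mu (fun r => F (add_box mu r) *+ dim mu)).
  by apply: eq_bigr => mu _; rewrite /up_sum sumrMnl.
rewrite -(up_down_adjoint n.+1 n (fun r mu nu => F nu *+ dim mu)).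
apply: eq_big_seq => nu /weight_youngs w.
by rewrite (@dimE n.+1) ?w ?leqnn// /down_sum sumrMnr.
Qed.

Definition perm_word n (s : 'S_n) : seq nat := [seq (s i).+1 | i <- enum 'I_n].

Lemma size_perm_word n (s : 'S_n) : size (perm_word s) = n.
Proof. by rewrite size_map size_enum_ord. Qed.

Lemma perm_word_iota n (s : 'S_n) : perm_eq (perm_word s) (iota 1 n).
Proof.
apply: uniq_perm; rewrite ?iota_uniq//.
  by rewrite map_inj_uniq ?enum_uniq// => i j [] /val_inj/perm_inj.
move=> b; rewrite mem_iota; apply/mapP/idP => [[i _ ->]|/andP[b0 bn]].
  by have := ltn_ord (s i); lia.
have bn' : (b.-1 < n)%N by lia.
by exists ((s^-1)%g (Ordinal bn')); rewrite ?mem_enum// permKV /=; lia.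
Qed.

Lemma perm_word_inj n : injective (@perm_word n).
Proof.
move=> s s' e; apply/permP => i; apply/val_inj/succn_inj.
by move/eq_in_map: e => /(_ i); apply; rewrite mem_enum.
Qed.

(** For a fixed recording path a permutation is determined by its insertion tableau, which is
    standard of the final shape. *)
Lemma card_perm_path_le n (p : seq young) :
  (#|[pred s : 'S_n | rsk_path (perm_word s) == p]| <= dim (last young0 p))%N.
Proof.
set Q := [pred s | _]; have [s0 s0Q|Q0] := pickP Q; last by rewrite eq_card0.
have wn : weight (last young0 p) = n.
  rewrite -(eqP s0Q) -[RHS](size_perm_word s0); apply: paths_weight.
  exact: rsk_path_paths.
rewrite /dim wn -size_tableaux cardE -(size_map (fun s => insertion_tableau (perm_word s))).
apply: uniq_leq_size.
  rewrite map_inj_in_uniq ?enum_uniq// => s s'; rewrite !mem_enum => /eqP e /eqP e' h.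
  by apply: perm_word_inj; apply: rsk_inj h; rewrite e e'.
move=> t /mapP[s]; rewrite mem_enum => /eqP sp ->; apply: standard_tableaux.
- exact: insertion_tableau_sorted.
- exact: column_strict_insertion_tableau.
- exact: perm_trans (perm_insertion_tableau _) (perm_word_iota s).
- by rewrite -sp last_rsk_path.
Qed.

Lemma sum_perm_path (n : nat) (V : nmodType) (F : seq young -> V) :
  \sum_(s : 'S_n) F (rsk_path (perm_word s)) =
  \sum_(p <- paths n) F p *+ dim (last young0 p).
Proof.
pose N p := #|[pred s : 'S_n | rsk_path (perm_word s) == p]|.
have inP (s : 'S_n) : rsk_path (perm_word s) \in paths n.
  by rewrite -{2}(size_perm_word s) rsk_path_paths.
have E (W : nmodType) (G : seq young -> W) : \sum_(s : 'S_n) G (rsk_path (perm_word s)) =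
    \sum_(p <- paths n) G p *+ N p.
  rewrite (eq_bigr (fun s => \sum_(p <- paths n | rsk_path (perm_word s) == p) G p)).
    rewrite (exchange_big_dep xpredT)//=; apply: eq_bigr => p _.
    by rewrite sumr_const.
  by move=> s _; rewrite (big_rem _ (inP s))/= eqxx big_seq_cond big1 ?addr0// => p /andP[];
   rewrite mem_rem_uniq ?paths_uniq// inE => /andP[/negPf +] _; rewrite eq_sym => ->.
(* If one of the upper bounds were strict, summation over all paths would leave fewer permutations
   than the sum of the squared dimensions, which is n!. *)
have eN p : p \in paths n -> N p = dim (last young0 p).
  move=> pP; apply/eqP; rewrite eqn_leq card_perm_path_le leqNgt; apply/negP => lt.
  suff: (n`! < n`!)%N by rewrite ltnn.
  rewrite -{1}card_Sn -sum1_card (E _ (fun=> 1%N)) -sum_dim2.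
  have -> : (\sum_(nu <- youngs n) dim nu ^ 2 = \sum_(p <- paths n) dim (last young0 p))%N.
    rewrite (sum_paths_last n dim); apply: eq_bigr => nu _.
    by rewrite -mulr_natr natn.
  rewrite !(big_rem _ pP)/= -mulr_natl mulr1 natn -addSn leq_add//.
  apply: leq_sum => q _; rewrite -mulr_natl mulr1 natn; exact: card_perm_path_le.
by rewrite E; apply: eq_big_seq => p /eN ->.
Qed.

Lemma plancherelE (R : realType) (n : nat) (mu : young) : weight mu = n ->
  plancherel R n mu = (dim mu)%:R ^+ 2 / n`!%:R.
Proof.
move=> w; rewrite /plancherel; congr (_ / _).
transitivity (\sum_(s : 'S_n) (last young0 (rsk_path (perm_word s)) == mu)%:R : R).
  rewrite -sum1_card natr_sum big_mkcond; apply: eq_bigr => s _.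
  rewrite last_rsk_path inE (_ : RSK _ = RSK (perm_word s))//; first by case: eqP.
rewrite (sum_perm_path n (fun p => (last young0 p == mu)%:R)).
rewrite (sum_paths_last n (fun nu => (nu == mu)%:R *+ dim nu)).
have muP : mu \in youngs n by rewrite mem_youngs w.
rewrite (big_rem _ muP)/= eqxx expr2 mulr_natr big_seq_cond big1 ?addr0//.
by move=> nu; rewrite mem_rem_uniq ?youngs_uniq// inE andbT => /andP[/negPf -> _]; rewrite !mul0rn.
Qed.

(** * Moments of the content of the new box *)

Section Plancherel.
Variable R : realType.
Implicit Types (F G H : young -> R) (h : R -> R) (K : nat -> young -> R).

Definition dimR (la : young) : R := (dim la)%:R.
Local Notation f := dimR.

Lemma dimR_gt0 la : 0 < f la. Proof. by rewrite ltr0n dim_gt0. Qed.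

Lemma dimR_neq0 la : f la != 0. Proof. by rewrite gt_eqF ?dimR_gt0. Qed.

Lemma fact_gt0R n : 0 < n`!%:R :> R. Proof. by rewrite ltr0n fact_gt0. Qed.

Lemma up_dimR M mu : (weight mu < M)%N ->
  up_sum M mu (fun r => f (add_box mu r)) = (weight mu).+1%:R * f mu.
Proof. exact: up_sum_dim. Qed.

Lemma down_dimR M la : (0 < weight la <= M)%N ->
  down_sum M la (fun r => f (rem_box la r)) = f la.
Proof. by move=> h; rewrite /dimR (dimE h) /down_sum natr_sum. Qed.

Definition mean n F : R := (\sum_(nu <- youngs n) f nu ^+ 2 * F nu) / n`!%:R.

(* [step_mean n K] is the expectation of [K r mu] where [mu] is the diagram at time [n]
   and [r] is the row of the box added at time [n + 1]. *)
Definition step_mean n K : R :=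
  (\sum_(mu <- youngs n) up_sum n.+1 mu (fun r => f mu * f (add_box mu r) * K r mu))
  / n.+1`!%:R.

Lemma mean_cst n c : mean n (fun=> c) = c.
Proof.
rewrite /mean -mulr_suml; have -> : \sum_(nu <- youngs n) f nu ^+ 2 = n`!%:R.
  by rewrite -sum_dim2 natr_sum; apply: eq_bigr => nu _; rewrite natrX.
by rewrite mulrAC mulfV ?mul1r// gt_eqF ?fact_gt0R.
Qed.

Lemma eq_mean n F G : (forall nu, weight nu = n -> F nu = G nu) -> mean n F = mean n G.
Proof.
by move=> h; congr (_ / _); apply: eq_big_seq => nu /weight_youngs w; rewrite h.
Qed.

Lemma le_mean n F G : (forall nu, weight nu = n -> F nu <= G nu) -> mean n F <= mean n G.
Proof.
move=> h; rewrite ler_pM2r ?invr_gt0 ?fact_gt0R// big_seq [leRHS]big_seq.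
by apply: ler_sum => nu /weight_youngs w; rewrite ler_wpM2l ?sqr_ge0 ?h.
Qed.

Lemma meanD n F G : mean n (fun nu => F nu + G nu) = mean n F + mean n G.
Proof.
by rewrite /mean -mulrDl -big_split; congr (_ / _); apply: eq_bigr => nu _; rewrite mulrDr.
Qed.

Lemma meanZ n c F : mean n (fun nu => c * F nu) = c * mean n F.
Proof.
by rewrite /mean mulrA mulr_sumr; congr (_ / _); apply: eq_bigr => nu _; rewrite mulrCA.
Qed.

Lemma mean_sqr n F : mean n F ^+ 2 <= mean n (fun nu => F nu ^+ 2).
Proof.
set a := mean n F; rewrite -subr_ge0.
have -> : mean n (fun nu => F nu ^+ 2) - a ^+ 2 = mean n (fun nu => (F nu - a) ^+ 2).
  transitivity (mean n (fun nu => F nu ^+ 2 + (- (2 * a) * F nu + a ^+ 2))).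
    by rewrite !meanD meanZ mean_cst -/a; ring.
  by apply: eq_mean => nu _; ring.
by rewrite -(mean_cst n 0); apply: le_mean => nu _; rewrite sqr_ge0.
Qed.

Lemma step_meanE n K M : (n < M)%N -> step_mean n K =
  (\sum_(mu <- youngs n) up_sum M mu (fun r => f mu * f (add_box mu r) * K r mu)) / n.+1`!%:R.
Proof.
move=> nM; congr (_ / _); apply: eq_big_seq => mu /weight_youngs w.
by apply: up_sum_widen; rewrite ?w.
Qed.

Lemma eq_step_mean n K K' : (forall r mu, weight mu = n -> addable mu r -> K r mu = K' r mu) ->
  step_mean n K = step_mean n K'.
Proof.
move=> h; congr (_ / _); apply: eq_big_seq => mu /weight_youngs w.
by apply: eq_up_sum => r ar; rewrite h.
Qed.

Lemma le_step_mean n K K' : (forall r mu, weight mu = n -> addable mu r -> K r mu <= K' r mu) ->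
  step_mean n K <= step_mean n K'.
Proof.
move=> h; rewrite ler_pM2r ?invr_gt0 ?fact_gt0R// big_seq [leRHS]big_seq.
apply: ler_sum => mu /weight_youngs w; apply: ler_sum => r ar.
by rewrite ler_wpM2l ?h// mulr_ge0// ler0n.
Qed.

Lemma step_mean_mu n F : step_mean n (fun _ mu => F mu) = mean n F.
Proof.
rewrite /step_mean /mean factS natrM invfM mulrA; congr (_ / _).
rewrite mulr_suml; apply: eq_big_seq => mu /weight_youngs w.
transitivity (f mu * F mu * up_sum n.+1 mu (fun r => f (add_box mu r)) / n.+1%:R).
  by rewrite /up_sum mulr_sumr; congr (_ / _); apply: eq_bigr => r _; rewrite mulrAC.
rewrite up_dimR ?w//; have : (n.+1%:R : R) != 0 by rewrite pnatr_eq0.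
by move=> ?; field.
Qed.

Lemma step_mean_cst n c : step_mean n (fun _ _ => c) = c.
Proof. by rewrite (step_mean_mu n (fun=> c)) mean_cst. Qed.

Lemma step_meanD n K K' : step_mean n (fun r mu => K r mu + K' r mu) = step_mean n K + step_mean n K'.
Proof.
rewrite /step_mean -mulrDl -big_split; congr (_ / _); apply: eq_bigr => mu _.
by rewrite /up_sum -big_split; apply: eq_bigr => r _; rewrite mulrDr.
Qed.

Lemma step_meanZ n c K : step_mean n (fun r mu => c * K r mu) = c * step_mean n K.
Proof.
rewrite /step_mean mulrA mulr_sumr; congr (_ / _); apply: eq_bigr => mu _.
by rewrite /up_sum mulr_sumr; apply: eq_bigr => r _; rewrite mulrCA.
Qed.

Lemma step_mean_add n F : step_mean n (fun r mu => F (add_box mu r)) = mean n.+1 F.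
Proof.
rewrite /step_mean /mean; congr (_ / _).
rewrite -(up_down_adjoint n.+1 n (fun r mu nu => f mu * f nu * F nu)).
apply: eq_big_seq => nu /weight_youngs w.
transitivity (down_sum n.+1 nu (fun r => f (rem_box nu r)) * (f nu * F nu)).
  by rewrite /down_sum mulr_suml; apply: eq_bigr => r _; rewrite mulrA.
by rewrite down_dimR ?w ?leqnn// mulrA expr2.
Qed.

Lemma sum_step_mean n K :
  \sum_(mu <- youngs n) up_sum n.+1 mu (fun r => f mu * f (add_box mu r) * K r mu) =
  n.+1`!%:R * step_mean n K.
Proof. by rewrite mulrC /step_mean divfK// gt_eqF ?fact_gt0R. Qed.

Lemma sum_mean n F : \sum_(nu <- youngs n) f nu ^+ 2 * F nu = n`!%:R * mean n F.
Proof. by rewrite mulrC /mean divfK// gt_eqF ?fact_gt0R. Qed.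

Definition content r mu : R := (row_length mu r)%:R - r%:R.

Definition moment n h : R := step_mean n (fun r mu => h (content r mu)).

Definition corner_mean n h : R := mean n (corner_sum n h).

Definition diff2 h (c : R) : R := h (c + 1) + h (c - 1) - h c *+ 2.

Lemma corner_sum_widen M N h la : (weight la <= M)%N -> (M <= N)%N ->
  corner_sum M h la = corner_sum N h la :> R.
Proof.
move=> lM MN; rewrite -!corner_sumE//; last exact: leq_trans MN.
congr (_ - _); first by apply: up_sum_widen; rewrite ltnS.
by apply: down_sum_widen; lia.
Qed.

Lemma mom0 h : moment 0 h = h 0.
Proof.
have -> : moment 0 h = step_mean 0 (fun _ _ => h 0).
  apply: eq_step_mean => r mu /eqP; rewrite weight_eq0 => /eqP -> a0; congr h.
  have := addable_lt a0; rewrite leqn0 => /eqP ->; rewrite /content subr0.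
  by rewrite /row_length nth_nil.
exact: step_mean_cst.
Qed.

Lemma cor0 h : corner_mean 0 h = h 0.
Proof.
rewrite /corner_mean -[RHS](mean_cst 0); apply: eq_mean => mu /eqP; rewrite weight_eq0 => /eqP ->.
exact: corner_sum0.
Qed.

(** The commutation relation, weighted by [h] of the content, is applied to f, which D fixes. Its
    off-diagonal part is the same average one step earlier, because U multiplies f by the weight
    plus one; its diagonal part is the corner sum. *)
Lemma momentS n h : n.+2%:R * moment n.+1 h = n.+1%:R * moment n h + corner_mean n.+1 h.
Proof.
pose X ka := up_sum n.+1 ka (fun r => h (content r ka) * f (add_box ka r)).
have E : \sum_(mu <- youngs n.+1) up_sum n.+2 mu
    (fun r => f mu * f (add_box mu r) * h (content r mu)) =
  \sum_(mu <- youngs n.+1) down_sum n.+2 mu (fun s => f mu * X (rem_box mu s)) +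
  \sum_(mu <- youngs n.+1) f mu ^+ 2 * corner_sum n.+1 h mu.
  rewrite -big_split; apply: eq_big_seq => mu /weight_youngs w /=.
  transitivity (f mu * up_sum n.+2 mu (fun r => h ((row_length mu r)%:R - r%:R) *
     down_sum n.+2 (add_box mu r) (fun s => f (rem_box (add_box mu r) s)))).
    rewrite /up_sum mulr_sumr; apply: eq_bigr => r ar.
    by rewrite down_dimR ?weight_add ?w ?leqnn//; ring.
  rewrite (up_down_comm _ _ (fun r x => h (x%:R - r%:R))) corner_sumE ?w//.
  rewrite mulrDr; congr (_ + _); last by ring.
  rewrite /down_sum mulr_sumr; apply: eq_bigr => s rs; congr (_ * _).
  have wr := weight_rem rs; rewrite w in wr; case: wr => wr.
  by rewrite /X (@up_sum_widen _ n.+1 n.+2) -?wr.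
have E2 : \sum_(mu <- youngs n.+1) down_sum n.+2 mu (fun s => f mu * X (rem_box mu s)) =
    n.+1%:R * (n.+1`!%:R * moment n h).
  rewrite (up_down_adjoint n.+2 n (fun r ka mu => f mu * X ka)).
  rewrite -sum_step_mean mulr_sumr; apply: eq_big_seq => ka /weight_youngs w.
  transitivity (up_sum n.+2 ka (fun r => f (add_box ka r)) * X ka).
    by rewrite /up_sum mulr_suml.
  rewrite up_dimR ?w 1?ltnW// -mulrA; congr (_ * _).
  by rewrite /X /up_sum mulr_sumr; apply: eq_bigr => r _; ring.
have nz : n.+1`!%:R != 0 :> R by rewrite gt_eqF ?fact_gt0R.
apply: (mulfI nz); rewrite mulrDr -sum_mean.
move: E; rewrite sum_step_mean E2 (factS n.+1) natrM => E.
by rewrite mulrA [n.+1`!%:R * n.+2%:R]mulrC E; ring.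
Qed.

(** Together with [momentS] this closes the system: moments of [h] are determined by those of its
    second difference at earlier times, and on polynomials the degree drops by two. *)
Lemma corner_meanS n h : corner_mean n.+1 h = corner_mean n h + moment n (diff2 h).
Proof.
rewrite /corner_mean -step_mean_add -step_mean_mu -step_meanD; apply: eq_step_mean => r mu w ar.
rewrite (@corner_sum_widen n n.+1) ?w// corner_sum_add//.
by have := addable_lt ar; rewrite w ltnS.
Qed.

Lemma corner_meanE n h : corner_mean n h = h 0 + \sum_(i < n) moment i (diff2 h).
Proof.
elim: n => [|n IH]; first by rewrite cor0 big_ord0 addr0.
by rewrite corner_meanS IH big_ord_recr addrA.
Qed.

Lemma momentE n h : n.+1%:R * moment n h = \sum_(i < n.+1) corner_mean i h.
Proof.
elim: n => [|n IH]; first by rewrite big_ord1 cor0 mom0 mul1r.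
by rewrite momentS IH [RHS]big_ord_recr.
Qed.

Lemma eq_moment n h h' : h =1 h' -> moment n h = moment n h'.
Proof. by move=> e; apply: eq_step_mean => r mu _ _; rewrite e. Qed.

Lemma le_moment n h h' : (forall x, h x <= h' x) -> moment n h <= moment n h'.
Proof. by move=> e; apply: le_step_mean => r mu _ _; rewrite e. Qed.

Lemma momentD n h h' : moment n (fun x => h x + h' x) = moment n h + moment n h'.
Proof. exact: step_meanD. Qed.

Lemma momentZ n c h : moment n (fun x => c * h x) = c * moment n h.
Proof. exact: step_meanZ. Qed.

(** This reflects the symmetry under transposition of diagrams, but the recursion is enough: an odd
    function vanishes at 0 and its second difference is odd again. *)
Lemma moment_odd n h : (forall x, h (- x) = - h x) -> moment n h = 0.
Proof.
elim/ltn_ind: n h => n IH h hodd.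
have h0 : h 0 = 0.
  have := hodd 0; rewrite oppr0 => /eqP; rewrite -addr_eq0 -mulr2n mulrn_eq0.
  by move/eqP.
have n0 : n.+1%:R != 0 :> R by rewrite pnatr_eq0.
apply: (mulfI n0); rewrite momentE mulr0 big1// => i _.
rewrite corner_meanE h0 add0r big1// => j _; apply: IH.
  by apply: leq_trans (ltn_ord j) _; rewrite -ltnS.
move=> x; rewrite /diff2 hodd.
have -> : - x + 1 = - (x - 1) by ring.
have -> : - x - 1 = - (x + 1) by ring.
by rewrite !hodd; ring.
Qed.

(** * Spectral gap and variance bound *)

Definition upop H mu : R := up_sum (weight mu).+1 mu (fun r => H (add_box mu r)).

Definition downop H nu : R := down_sum (weight nu) nu (fun r => H (rem_box nu r)).

Lemma upopE M H mu : (weight mu < M)%N ->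
  upop H mu = up_sum M mu (fun r => H (add_box mu r)).
Proof. by move=> h; apply: up_sum_widen. Qed.

Lemma downopE M H nu : (weight nu <= M)%N ->
  downop H nu = down_sum M nu (fun r => H (rem_box nu r)).
Proof. by move=> h; apply: down_sum_widen. Qed.

Lemma downop_dimR n nu : weight nu = n.+1 -> downop f nu = f nu.
Proof. by move=> w; rewrite /downop w down_dimR ?w ?leqnn. Qed.

Lemma up_downop H mu : upop (downop H) mu = downop (upop H) mu + H mu.
Proof.
set w := weight mu.
have -> : upop (downop H) mu = up_sum w.+1 mu (fun r => 1 *
    down_sum w.+1 (add_box mu r) (fun s => H (rem_box (add_box mu r) s))).
  by apply: eq_up_sum => r ar; rewrite mul1r (@downopE w.+1)// weight_add.
rewrite (up_down_comm _ _ (fun _ _ => 1)) (corner_sumE (fun=> 1))// corner_sum1 mul1r.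
congr (_ + _); rewrite (@downopE w.+1)//.
apply: eq_down_sum => s rs; have wr := weight_rem rs.
rewrite (@upopE w.+1) 1?[X in (_ < X)%N]wr; last by rewrite /w wr; lia.
by apply: eq_up_sum => r _; rewrite mul1r.
Qed.

Lemma adjoint_op n G H :
  \sum_(nu <- youngs n.+1) G nu * downop H nu = \sum_(mu <- youngs n) upop G mu * H mu.
Proof.
transitivity (\sum_(nu <- youngs n.+1)
   down_sum n.+1 nu (fun r => G nu * H (rem_box nu r))).
  by apply: eq_big_seq => nu /weight_youngs w; rewrite /downop w /down_sum mulr_sumr.
rewrite (up_down_adjoint n.+1 n (fun r mu nu => G nu * H mu)).
by apply: eq_big_seq => mu /weight_youngs w; rewrite /upop w /up_sum mulr_suml.
Qed.

Definition normsq n H : R := \sum_(nu <- youngs n) H nu ^+ 2.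

Lemma normsq_ge0 n H : 0 <= normsq n H.
Proof. by apply: sumr_ge0 => nu _; rewrite sqr_ge0. Qed.

Lemma CS_sum n G H : (\sum_(nu <- youngs n) G nu * H nu) ^+ 2 <= normsq n G * normsq n H.
Proof.
set a := normsq n H; set b := \sum_(nu <- youngs n) G nu * H nu.
have h t : 0 <= normsq n G - 2 * t * b + t ^+ 2 * a.
  have -> : normsq n G - 2 * t * b + t ^+ 2 * a = normsq n (fun nu => G nu - t * H nu).
    rewrite /normsq /a /b mulr_sumr mulr_sumr -sumrB -big_split.
    by apply: eq_bigr => nu _ /=; ring.
  exact: normsq_ge0.
have [a0|a0] := eqVneq a 0.
  have [->|b0] := eqVneq b 0; first by rewrite expr0n a0 mulr0.
  have := h ((normsq n G + 1) / (2 * b)); rewrite a0 mulr0 addr0.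
  have -> : 2 * ((normsq n G + 1) / (2 * b)) * b = normsq n G + 1 by field.
  by rewrite opprD addrA subrr add0r oppr_ge0 ler10.
have ap : 0 < a by rewrite lt_def a0 normsq_ge0.
have := h (b / a).
have -> : normsq n G - 2 * (b / a) * b + (b / a) ^+ 2 * a = (normsq n G * a - b ^+ 2) / a.
  by field.
by rewrite pmulr_lge0 ?invr_gt0// subr_ge0.
Qed.

(* Spectral gap of the down-up chain, in the form ||UH||^2 <= n ||H||^2. *)
Lemma normsq_up n H : \sum_(nu <- youngs n.+1) f nu * H nu = 0 ->
  normsq n (upop H) <= n%:R * normsq n.+1 H.
Proof.
elim: n H => [|n IH] H h0.
  rewrite mul0r /normsq big_seq1 /upop.
  have := h0; rewrite (_ : \sum_(nu <- _) _ = \sum_(nu <- youngs 1) H nu * downop f nu).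
    rewrite adjoint_op big_seq1 /dimR dim0 mulr1 /upop => ->.
    by rewrite expr0n.
  apply: eq_big_seq => nu /weight_youngs w.
  by rewrite (downop_dimR w) mulrC.
have h1 : \sum_(nu <- youngs n.+1) f nu * upop H nu = 0.
  apply: etrans h0; under eq_bigr do rewrite mulrC.
  rewrite -adjoint_op; apply: eq_big_seq => nu /weight_youngs w.
  by rewrite (downop_dimR w) mulrC.
(* X = ||UH||^2 is the pairing of H with DUH, and ||DUH||^2 = ||UUH||^2 + X, which is at most (n +
   1) X by induction. Cauchy-Schwarz then gives X^2 <= ||H||^2 (n + 1) X. *)
set X := normsq n.+1 (upop H).
have X0 : 0 <= X by exact: normsq_ge0.
have E : X = \sum_(nu <- youngs n.+2) H nu * downop (upop H) nu.
  by rewrite adjoint_op; apply: eq_bigr => nu _; rewrite expr2.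
have D2 : normsq n.+2 (downop (upop H)) = normsq n (upop (upop H)) + X.
  rewrite /normsq; under eq_bigr do rewrite expr2.
  rewrite adjoint_op; under eq_bigr do rewrite up_downop mulrDl.
  rewrite big_split /=; congr (_ + _); under eq_bigr do rewrite mulrC.
  by rewrite adjoint_op; apply: eq_bigr => nu _; rewrite expr2.
have := CS_sum n.+2 H (downop (upop H)); rewrite -E D2 => cs.
have := IH (upop H) h1; rewrite -/X => ih.
have [->|Xn] := eqVneq X 0; first by rewrite mulr_ge0 ?normsq_ge0.
have Xp : 0 < X by rewrite lt_def Xn.
rewrite -(ler_pM2r Xp) -expr2 (le_trans cs)// [leRHS]mulrAC mulrC ler_wpM2r ?normsq_ge0//.
by rewrite -natr1 mulrDl mul1r lerD2r.
Qed.

(** Poincaré inequality for the chain that removes a box and adds one, whose gap is at least 1 / (n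
    + 1): the variance is controlled by the error of predicting F from the previous diagram, with
    any predictor [G]. *)
Lemma Var_le n F G : mean n.+1 F = 0 ->
  mean n.+1 (fun nu => F nu ^+ 2) <=
  n.+1%:R * step_mean n (fun r mu => (F (add_box mu r) - G mu) ^+ 2).
Proof.
move=> F0; pose H nu := f nu * F nu; set N : R := n.+1%:R.
have N0 : 0 < N by rewrite ltr0n.
have h0 : \sum_(nu <- youngs n.+1) f nu * H nu = 0.
  transitivity (n.+1`!%:R * mean n.+1 F); last by rewrite F0 mulr0.
  by rewrite -sum_mean; apply: eq_bigr => nu _; rewrite mulrA expr2.
have gap := normsq_up h0.
have fp := fact_gt0R n.+1.
have e1 : n.+1`!%:R * mean n.+1 (fun nu => F nu ^+ 2) = normsq n.+1 H.
  by rewrite -sum_mean; apply: eq_bigr => nu _; rewrite exprMn.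
rewrite -(ler_pM2l fp) e1 [leRHS]mulrCA.
have -> : step_mean n (fun r mu => (F (add_box mu r) - G mu) ^+ 2) =
    mean n.+1 (fun nu => F nu ^+ 2) +
    step_mean n (fun r mu => - 2 * G mu * F (add_box mu r) + G mu ^+ 2).
  by rewrite -step_mean_add -step_meanD; apply: eq_step_mean => r mu _ _; ring.
rewrite [in leRHS]mulrDr e1 -sum_step_mean.
set Z := \sum_(mu <- _) _.
have Z1 : Z = \sum_(mu <- youngs n) (N * (f mu * G mu) ^+ 2 - 2 * (f mu * G mu) * upop H mu).
  apply: eq_big_seq => mu /weight_youngs w.
  transitivity (f mu * G mu ^+ 2 * up_sum n.+1 mu (fun r => f (add_box mu r)) -
     2 * (f mu * G mu) * upop H mu).
    rewrite /upop w /up_sum !mulr_sumr -sumrB; apply: eq_bigr => r _.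
    by rewrite /H; ring.
  by rewrite up_dimR ?w// /N; ring.
(* Completing the square: the right-hand side is smallest when [G] is the conditional mean of F
   given the previous diagram. *)
have Z2 : - (normsq n (upop H) / N) <= Z.
  rewrite Z1 /normsq mulr_suml -sumrN; apply: ler_sum => mu _.
  rewrite -subr_ge0 (_ : _ - _ = (N * (f mu * G mu) - upop H mu) ^+ 2 / N).
    by rewrite mulr_ge0 ?sqr_ge0// invr_ge0 ltW.
  by field; rewrite gt_eqF.
rewrite mulrDr; have : N * - (normsq n (upop H) / N) <= N * Z by rewrite ler_pM2l.
rewrite mulrN mulrCA mulfV ?gt_eqF// mulr1.
have : N * normsq n.+1 H = normsq n.+1 H + n%:R * normsq n.+1 H by rewrite /N -natr1; ring.
by move: gap; set A := normsq _ H; set B := normsq _ _; set C := N * Z => ? -> ?; lra.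
Qed.

End Plancherel.

(** * Rows of the new box *)

Section Rows.
Variable R : realType.
Local Notation f := (@dimR R).
Local Notation mean := (@mean R).
Local Notation step_mean := (@step_mean R).
Local Notation moment := (@moment R).
Local Notation sq n := (Num.sqrt (n.+1%:R : R)).

Lemma sq_gt0 n : 0 < sq n. Proof. by rewrite sqrtr_gt0 ltr0n. Qed.

Lemma sq_sqr n : sq n ^+ 2 = n.+1%:R.
Proof. by rewrite sqr_sqrtr ?ler0n. Qed.

Definition row_prob n k : R := step_mean n (fun r _ => (r == k)%:R).

Definition rows_prob n k : R := step_mean n (fun r _ => (r <= k)%N%:R).

Lemma rows_probS n k : rows_prob n k.+1 = rows_prob n k + row_prob n k.+1.
Proof.
rewrite -step_meanD; apply: eq_step_mean => r mu _ _.
by rewrite leq_eqVlt ltnS; case: eqP => [->|_] /=; rewrite ?ltnn ?add0r ?addr0.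
Qed.

Lemma pc0 n : rows_prob n 0 = row_prob n 0.
Proof. by apply: eq_step_mean => r mu _ _; rewrite leqn0. Qed.

Lemma up_sum_pred1 M mu k (X : nat -> R) : (k < M)%N ->
  up_sum M mu (fun r => X r * (r == k)%:R) = if addable mu k then X k else 0.
Proof.
move=> kM; rewrite /up_sum; case: ifPn => ak.
  rewrite (bigD1 (Ordinal kM))//= eqxx mulr1 big1 ?addr0// => i /andP[_ ik].
  by rewrite (negPf (ik : (i != k :> nat))) mulr0.
rewrite big1// => i ai; case: eqP => [e|_]; last by rewrite mulr0.
by rewrite -e ai in ak.
Qed.

Lemma down_sum_pred1 M mu k (X : nat -> R) : (k < M)%N ->
  down_sum M mu (fun r => X r * (r == k)%:R) = if removable mu k then X k else 0.
Proof.
move=> kM; rewrite /down_sum; case: ifPn => ak.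
  rewrite (bigD1 (Ordinal kM))//= eqxx mulr1 big1 ?addr0// => i /andP[_ ik].
  by rewrite (negPf (ik : (i != k :> nat))) mulr0.
rewrite big1// => i ai; case: eqP => [e|_]; last by rewrite mulr0.
by rewrite -e ai in ak.
Qed.

Definition down_row k (F : young -> R) (nu : young) : R :=
  if removable nu k then F (rem_box nu k) else 0.

Lemma sum_down_row n k F G : \sum_(nu <- youngs n.+1) down_row k F nu * G nu =
  \sum_(mu <- youngs n) if addable mu k then F mu * G (add_box mu k) else 0.
Proof.
transitivity (\sum_(nu <- youngs n.+1) down_sum k.+1 nu
    (fun r => F (rem_box nu r) * G nu * (r == k)%:R)).
  apply: eq_bigr => nu _; rewrite (down_sum_pred1 _ (fun r => F (rem_box nu r) * G nu))//.
  by rewrite /down_row; case: ifP; rewrite ?mul0r.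
rewrite (up_down_adjoint k.+1 n (fun r mu nu => F mu * G nu * (r == k)%:R)).
apply: eq_bigr => mu _.
by rewrite (up_sum_pred1 _ (fun r => F mu * G (add_box mu r))).
Qed.

(* Zero when row [k] of [nu] has no removable box. *)
Definition back_ratio n k (nu : young) : R := sq n * down_row k f nu / f nu.

Lemma sum_up_row_prob n k : \sum_(nu <- youngs n.+1) down_row k f nu * f nu = n.+1`!%:R * row_prob n k.
Proof.
rewrite sum_down_row /row_prob (@step_meanE _ _ _ (maxn n k).+1) ?ltnS ?leq_maxl// mulrC divfK; last first.
  by rewrite gt_eqF ?fact_gt0R.
apply: eq_bigr => mu _.
by rewrite (up_sum_pred1 _ (fun r => f mu * f (add_box mu r))) ?ltnS ?leq_maxr.
Qed.

Lemma mean_back_ratio n k : mean n.+1 (back_ratio n k) = sq n * row_prob n k.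
Proof.
apply: (mulfI (lt0r_neq0 (fact_gt0R R n.+1))).
rewrite -sum_mean mulrCA -sum_up_row_prob mulr_sumr; apply: eq_bigr => nu _.
by rewrite /back_ratio; field; rewrite dimR_neq0.
Qed.

(** The factor f(nu)^2 of the Plancherel measure cancels the denominator. What is left is n + 1
    times the sum of f(mu)^2 over those mu of level n that accept a box in row k, at most (n + 1)
    n!. *)
Lemma mean_back_ratio_sqr n k : mean n.+1 (fun nu => back_ratio n k nu ^+ 2) <= 1.
Proof.
rewrite -(ler_pM2l (fact_gt0R R n.+1)) -sum_mean mulr1.
have -> : \sum_(nu <- youngs n.+1) f nu ^+ 2 * back_ratio n k nu ^+ 2 =
    n.+1%:R * \sum_(nu <- youngs n.+1) down_row k (fun mu => f mu ^+ 2) nu * 1.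
  rewrite mulr_sumr -sq_sqr; apply: eq_bigr => nu _.
  rewrite /back_ratio /down_row; case: ifP => _; last by rewrite mulr0 mul0r expr0n !(mulr0, mul0r).
  by field; rewrite dimR_neq0.
rewrite sum_down_row factS natrM ler_wpM2l ?ler0n//.
have -> : n`!%:R = \sum_(mu <- youngs n) f mu ^+ 2 :> R.
  by rewrite -sum_dim2 natr_sum; apply: eq_bigr => nu _; rewrite natrX.
by apply: ler_sum => mu _; rewrite mulr1; case: ifP; rewrite ?sqr_ge0.
Qed.

Lemma mean_back_ratio_err n k :
  mean n.+1 (fun nu => (back_ratio n k nu - 1) ^+ 2) <= 2 - 2 * (sq n * row_prob n k).
Proof.
have -> : mean n.+1 (fun nu => (back_ratio n k nu - 1) ^+ 2) =
    mean n.+1 (fun nu => back_ratio n k nu ^+ 2) + (- 2 * (sq n * row_prob n k) + 1).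
  rewrite -mean_back_ratio -(meanZ n.+1 (- 2)) -[X in _ + (_ + X)](mean_cst n.+1) -!meanD.
  by apply: eq_mean => nu _; ring.
by have := mean_back_ratio_sqr n k; lra.
Qed.

Lemma row_prob_le n k : sq n * row_prob n k <= 1.
Proof.
have := mean_back_ratio_err n k; have : 0 <= mean n.+1 (fun nu => (back_ratio n k nu - 1) ^+ 2).
  by rewrite -(mean_cst n.+1 (0 : R)); apply: le_mean => nu _; rewrite sqr_ge0.
lra.
Qed.

Lemma rows_prob_le n k : sq n * rows_prob n k <= k.+1%:R.
Proof.
elim: k => [|k IH]; first by rewrite pc0 row_prob_le.
by rewrite rows_probS mulrDr -[leRHS]natr1 lerD// row_prob_le.
Qed.

Lemma mean_abs_back_ratio n k :
  mean n.+1 (fun nu => `|back_ratio n k nu - 1|) <= Num.sqrt (2 - 2 * (sq n * row_prob n k)).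
Proof.
rewrite -[leLHS]ger0_norm; last first.
  by rewrite -(mean_cst n.+1 (0 : R)); apply: le_mean => nu _.
rewrite -sqrtr_sqr ler_sqrt; last by have := row_prob_le n k; lra.
apply: le_trans (mean_sqr _ _) _; apply: le_trans (mean_back_ratio_err n k).
by apply: le_mean => nu _; rewrite real_normK ?num_real.
Qed.

(** Weight of adding a box in row [s] and then one in row [t]; zero when this order is
    impossible. *)
Let A mu s t : R := (addable mu s && addable (add_box mu s) t)%:R *
  f (add_box (add_box mu s) t).

Let A_le mu (s t : nat) : (t < s)%N -> A mu s t <= A mu t s.
Proof.
move=> ts; rewrite /A; case: andP => [[as_ at_]|_]; last first.
  by rewrite mul0r mulr_ge0 ?ler0n.
have am : addable mu t.
  move: at_; rewrite /addable; case: t ts => //= t ts.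
  by rewrite !row_length_add//; lia.
have asm : addable (add_box mu t) s.
  move: as_; rewrite /addable; case: s ts {at_} => //= s ts.
  by rewrite !row_length_add//; lia.
rewrite am asm /= !mul1r; have -> // : add_box (add_box mu s) t = add_box (add_box mu t) s.
by apply: young_ext => i; rewrite !row_length_add// addnAC.
Qed.

(* Compares the two orders of two consecutive additions: whenever a box can be
   added to a row [s] and then one to a lower row [t], the opposite order is
   also possible. *)
Lemma rows_prob_decr n k : rows_prob n.+1 k <= rows_prob n k.
Proof.
pose N := n.+2; pose c (r : nat) : R := (r <= k)%N%:R.
have e1 : N`!%:R * rows_prob n.+1 k =
    \sum_(mu <- youngs n) f mu * \sum_(s < N) \sum_(t < N) c t * A mu s t.
  rewrite -sum_step_mean.
  transitivity (\sum_(nu <- youngs n.+1) down_sum n.+1 nu (fun s =>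
     f (rem_box nu s) * up_sum N nu (fun t => f (add_box nu t) * c t))).
    apply: eq_big_seq => nu /weight_youngs w.
    transitivity (down_sum n.+1 nu (fun s => f (rem_box nu s)) *
      up_sum N nu (fun t => f (add_box nu t) * c t)).
      rewrite down_dimR ?w ?leqnn// /up_sum mulr_sumr.
      by apply: eq_bigr => t _; rewrite mulrA.
    by rewrite /down_sum mulr_suml.
  rewrite (up_down_adjoint n.+1 n (fun s mu nu =>
     f mu * up_sum N nu (fun t => f (add_box nu t) * c t))).
  apply: eq_big_seq => mu /weight_youngs w.
  rewrite (@up_sum_widen _ n.+1 N) ?w// /up_sum -mulr_sumr; congr (_ * _).
  rewrite big_mkcond; apply: eq_bigr => s _; rewrite /A.
  case: ifPn => as_; last by rewrite big1// => t _; rewrite mul0r mulr0.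
  rewrite big_mkcond; apply: eq_bigr => t _.
  by case: ifP => _ /=; rewrite ?mul1r ?mul0r ?mulr0// mulrC.
(* The factor n + 2 of [N]! is spent on summing f over a second, unconstrained addition. Both
   probabilities become sums over pairs of rows, with the indicator on the second row in [e1] and on
   the first row here. *)
have e2 : N`!%:R * rows_prob n k =
    \sum_(mu <- youngs n) f mu * \sum_(s < N) \sum_(t < N) c s * A mu s t.
  rewrite factS natrM -mulrA -sum_step_mean mulr_sumr; apply: eq_big_seq => mu /weight_youngs w.
  rewrite (@up_sum_widen _ n.+1 N) ?w// /up_sum !mulr_sumr big_mkcond.
  apply: eq_bigr => t _; case: ifPn => at_; last first.
    by rewrite big1 ?mulr0// => s _; rewrite /A (negPf at_) /= mul0r mulr0.
  transitivity (c t * (f mu * up_sum N (add_box mu t)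
      (fun s => f (add_box (add_box mu t) s)))).
    by rewrite up_dimR ?weight_add ?w//; rewrite /c; ring.
  rewrite mulrCA; congr (_ * _); rewrite -mulr_sumr; congr (_ * _).
  rewrite /up_sum big_mkcond; apply: eq_bigr => s _.
  by rewrite /A at_ /=; case: ifP; rewrite ?mul1r ?mul0r.
rewrite -(ler_pM2l (fact_gt0R R N)) e1 e2; apply: ler_sum => mu _.
rewrite ler_wpM2l ?ler0n// -subr_ge0 -sumrB.
set D := \sum_(i < N) _.
have D1 : D = \sum_(s < N) \sum_(t < N) (c s - c t) * A mu s t.
  by apply: eq_bigr => s _; rewrite -sumrB; apply: eq_bigr => t _; ring.
have D2 : D = \sum_(s < N) \sum_(t < N) (c t - c s) * A mu t s.
  by rewrite D1 exchange_big.
(* Symmetrised in s and t, a term survives only when exactly one of the two rows is at most k, and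
   then [A_le] gives its sign. *)
have : 0 <= D + D.
  rewrite {1}D1 D2 -big_split; apply: sumr_ge0 => s _.
  rewrite -big_split; apply: sumr_ge0 => t _ /=.
  have -> : (c s - c t) * A mu s t + (c t - c s) * A mu t s =
    (c s - c t) * (A mu s t - A mu t s) by ring.
  rewrite /c; case: leqP => sk; case: leqP => tk; rewrite ?subrr ?mul0r//.
    by rewrite subr0 mul1r subr_ge0 A_le// (leq_ltn_trans sk).
  by rewrite sub0r mulN1r opprB subr_ge0 A_le// (leq_ltn_trans tk).
by clearbody D; lra.
Qed.

Lemma rows_prob_anti k m n : (m <= n)%N -> rows_prob n k <= rows_prob m k.
Proof.
move=> mn; rewrite -(subnK mn); elim: (n - m)%N => // d.
by apply: le_trans; rewrite addSn rows_prob_decr.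
Qed.

Definition rowsum k (mu : young) : R := \sum_(i < k.+1) (row_length mu i)%:R.

Lemma rowsum_add k mu r : addable mu r ->
  rowsum k (add_box mu r) = rowsum k mu + (r <= k)%N%:R.
Proof.
move=> ar; rewrite /rowsum.
under eq_bigr do rewrite row_length_add// natrD.
rewrite big_split /=; congr (_ + _).
have [rk|kr] := leqP r k.
  rewrite (bigD1 (Ordinal (rk : (r < k.+1)%N)))//= eqxx big1 ?addr0// => i.
  by rewrite -val_eqE /= => /negPf ->.
rewrite big1// => i _; case: eqP => // e.
by have := ltn_ord i; rewrite e ltnS leqNgt kr.
Qed.

Lemma mean_rowsum n k : mean n (rowsum k) = \sum_(i < n) rows_prob i k.
Proof.
elim: n => [|n IH].
  rewrite big_ord0 -[RHS](mean_cst 0); apply: eq_mean => mu /eqP.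
  rewrite weight_eq0 => /eqP ->; rewrite /rowsum big1// => i _.
  by rewrite /row_length nth_nil.
rewrite big_ord_recr -IH -step_mean_add -step_mean_mu /= -step_meanD.
by apply: eq_step_mean => r mu _; apply: rowsum_add.
Qed.

(** With the previous value as predictor, the error is the indicator of a box in the rows 0, ..., k.
    Its probability is at most (k + 1) / sqrt(n + 1), while the inverse gap contributes n + 1. *)
Lemma Var_rowsum n k (e := mean n.+1 (rowsum k)) :
  mean n.+1 (fun nu => (rowsum k nu - e) ^+ 2) <= k.+1%:R * sq n.
Proof.
apply: le_trans (@Var_le _ n (fun nu => rowsum k nu - e) (fun mu => rowsum k mu - e) _) _.
  by rewrite meanD mean_cst subrr.
rewrite (_ : step_mean n _ = rows_prob n k); last first.
  apply: eq_step_mean => r mu _ ar; rewrite rowsum_add//.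
  rewrite (_ : _ - _ = (r <= k)%N%:R); last by ring.
  by case: leqP => _; rewrite ?expr1n ?expr0n.
by rewrite -{1}(sq_sqr n) expr2 -mulrA [leLHS]mulrC ler_wpM2r ?rows_prob_le// ltW ?sq_gt0.
Qed.

End Rows.

(** * Catalan lower bounds for the moments and the tail of the content *)

Section Moments.
Variable R : realType.
Local Notation f := (@dimR R).
Local Notation mean := (@mean R).
Local Notation step_mean := (@step_mean R).
Local Notation moment := (@moment R).
Local Notation sq n := (Num.sqrt (n.+1%:R : R)).
Implicit Types (x : R).

Let bterm x K i : R := (1 + (-1) ^+ i) * x ^+ (2 * K - i) *+ 'C(2 * K, i).

Lemma exprD1B1 x n : (x + 1) ^+ n + (x - 1) ^+ n =
  \sum_(i < n.+1) (1 + (-1) ^+ i) * x ^+ (n - i) *+ 'C(n, i).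
Proof.
rewrite exprDn exprBn -big_split /=; apply: eq_bigr => i _.
by rewrite expr1n -mulrnDl; congr (_ *+ _); ring.
Qed.

Lemma bterm_odd x K i : odd i -> bterm x K i = 0.
Proof. by move=> oi; rewrite /bterm -signr_odd oi expr1 subrr mul0r mul0rn. Qed.

Lemma bterm_even x K i : ~~ odd i -> bterm x K i = 2 * (x ^+ 2) ^+ (K - i./2) *+ 'C(2 * K, i).
Proof.
move=> ei; rewrite /bterm -signr_odd (negPf ei) expr0 -exprM.
congr (_ * _ ^+ _ *+ _); by rewrite -{1}[i]odd_double_half (negPf ei) -muln2; lia.
Qed.

Lemma bterm_ge0 x K i : 0 <= bterm x K i.
Proof.
have [oi|ei] := boolP (odd i); first by rewrite bterm_odd.
by rewrite bterm_even// mulrn_wge0// mulr_ge0// exprn_ge0// sqr_ge0.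
Qed.

(** In the binomial expansion i = 0 cancels against -2h and i = 2 is the leading term. Odd i vanish
    and the other even i are nonnegative, so the leading term alone is a lower bound. *)
Lemma diff2_evenE K x : diff2 (fun y => y ^+ (2 * K.+1)) x =
  2 * 'C(2 * K.+1, 2)%:R * x ^+ (2 * K) +
  \sum_(i < (2 * K.+1).+1 | (i != 0 :> nat) && (i != 2 :> nat)) bterm x K.+1 i.
Proof.
rewrite /diff2 exprD1B1 -/(bterm x K.+1 _).
have i0 : (0 < (2 * K.+1).+1)%N by [].
have i2 : (2 < (2 * K.+1).+1)%N by lia.
rewrite (bigD1 (Ordinal i0))//= (bigD1 (Ordinal i2))//=.
rewrite bin0 mulr1n subn0 expr0 sqrrN expr1n -[in X in _ - X]mulr_natl.
rewrite (_ : 2 * K.+1 - 2 = 2 * K)%N; last by lia.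
rewrite (eq_bigl (fun i : 'I_(2 * K.+1).+1 => (i != 0 :> nat) && (i != 2 :> nat)))//.
by rewrite -[X in _ + (X + _) - _]mulr_natr; ring.
Qed.

Lemma diff2_even_ge K x :
  (2 * K.+1 * (2 * K).+1)%:R * x ^+ (2 * K) <= diff2 (fun y => y ^+ (2 * K.+1)) x.
Proof.
rewrite diff2_evenE -[leLHS]addr0 lerD//; last by apply: sumr_ge0 => i _; exact: bterm_ge0.
have := mul_bin_diag (2 * K.+1) 1; rewrite bin1 => e.
by rewrite -natrM -e (_ : (2 * K.+1).-1 = (2 * K).+1)//; lia.
Qed.

Lemma expr_le_add1 x (a K : nat) : 0 <= x -> (a <= K)%N -> x ^+ a <= x ^+ K + 1.
Proof.
move=> x0 aK; have [x1|/ltW x1] := leP x 1.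
  by rewrite -[leLHS]add0r lerD ?exprn_ge0// exprn_ile1.
by rewrite -[leLHS]addr0 lerD// ler_weXn2l.
Qed.

Lemma diff2_even_le K : exists2 B : R, 0 <= B &
  forall x, diff2 (fun y => y ^+ (2 * K.+1)) x <= B * (x ^+ (2 * K) + 1).
Proof.
exists (\sum_(i < (2 * K.+1).+1) (2 * 'C(2 * K.+1, i)%:R)).
  by apply: sumr_ge0 => i _; rewrite mulr_ge0.
move=> x; rewrite /diff2 exprD1B1 -/(bterm x K.+1 _).
rewrite big_ord_recl /= bin0 mulr1n expr0 subn0 -[X in _ + _ - X]mulr_natl addrAC subrr add0r.
rewrite [X in X * _]big_ord_recl mulrDl -[leLHS]add0r lerD//.
  by rewrite !mulr_ge0// addr_ge0// exprM exprn_ge0// sqr_ge0.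
rewrite mulr_suml; apply: ler_sum => i _; set j := lift _ _.
have j0 : (0 < j)%N by [].
have xK : 0 <= x ^+ (2 * K) by rewrite exprM exprn_ge0// sqr_ge0.
rewrite -/(bterm x K.+1 j); have [oj|ej] := boolP (odd j).
  by rewrite bterm_odd// !mulr_ge0// addr_ge0.
rewrite bterm_even// -mulr_natr -mulrA [(_ ^+ _) * _]mulrC mulrA ler_wpM2l ?mulr_ge0//.
rewrite exprM; apply: expr_le_add1; first by rewrite sqr_ge0.
have := odd_double_half j; rewrite (negPf ej) -muln2; lia.
Qed.

Lemma sum_bin n K : (\sum_(i < n) 'C(i, K) = 'C(n, K.+1))%N.
Proof.
elim: n => [|n IH]; first by rewrite big_ord0.
by rewrite big_ord_recr /= IH binS.
Qed.

(* The even moments of the semicircle law on [-2, 2]. *)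
Fixpoint catalan K : R :=
  if K is K'.+1 then catalan K' * (2 * (2 * K').+1%:R / K'.+2%:R) else 1.

Lemma catalan_gt0 K : 0 < catalan K.
Proof. by elim: K => //= K IH; rewrite mulr_gt0// divr_gt0 ?mulr_gt0 ?ltr0n. Qed.

Lemma moment_cst n c : moment n (fun=> c) = c. Proof. exact: step_mean_cst. Qed.

(** Falling factorials replace powers of n because their sums over time are exact. Two summations
    divide (2K + 2)(2K + 1) by (K + 1)(K + 2), which is the ratio of consecutive Catalan numbers. *)
Lemma moment_even_ge K n : catalan K * (n ^_ K)%:R <= moment n (fun x => x ^+ (2 * K)).
Proof.
elim: K n => [|K IH] n.
  by rewrite /= ffactn0 mulr1 -[leLHS](moment_cst n); apply: le_moment => x; rewrite expr0.
have n0 : 0 < n.+1%:R :> R by rewrite ltr0n.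
rewrite -(ler_pM2l n0) momentE.
set c : R := (2 * K.+1 * (2 * K).+1)%:R.
have h (i : nat) : c * catalan K * (K`! * 'C(i, K.+1))%:R <= corner_mean i (fun x => x ^+ (2 * K.+1)).
  rewrite corner_meanE expr0n /= add0r -sum_bin big_distrr /= natr_sum mulr_sumr.
  apply: ler_sum => j _; have := IH j => IHj.
  apply: le_trans (le_moment j (diff2_even_ge K)); rewrite momentZ -mulrA ler_wpM2l ?ler0n//.
  by apply: le_trans IHj; rewrite mulnC bin_ffact.
apply: (@le_trans _ _ (\sum_(i < n.+1) c * catalan K * (K`! * 'C(i, K.+1))%:R)); last first.
  by apply: ler_sum => i _; exact: h.
rewrite -mulr_sumr -natr_sum -big_distrr /= sum_bin.
have := mul_bin_diag n.+1 K.+1; rewrite -pred_Sn => e.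
rewrite mulrCA -[n.+1%:R * _]natrM -bin_ffact mulnA e /c /=.
rewrite factS !natrM.
have K2 : K.+2%:R != 0 :> R by rewrite pnatr_eq0.
rewrite le_eqVlt; apply/orP; left; apply/eqP.
by rewrite -[2%N]/(1.+1) ; field.
Qed.

Lemma moment_even_le K : exists2 B : R, 0 <= B &
  forall n, moment n (fun x => x ^+ (2 * K)) <= B * n.+1%:R ^+ K.
Proof.
elim: K => [|K [B B0 IH]].
  exists 1 => // n; rewrite expr0 mulr1 -[leRHS](moment_cst n).
  by apply: le_moment => x; rewrite expr0.
have [C C0 hC] := diff2_even_le K.
exists (C * (B + 1)); first by rewrite mulr_ge0// addr_ge0.
move=> n; have n0 : 0 < n.+1%:R :> R by rewrite ltr0n.
have hc (i : nat) : (i <= n)%N ->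
    corner_mean i (fun x => x ^+ (2 * K.+1)) <= C * (B + 1) * n.+1%:R ^+ K.+1.
  move=> lin; rewrite corner_meanE expr0n /= add0r.
  apply: (@le_trans _ _ (\sum_(j < i) C * (B + 1) * n.+1%:R ^+ K)).
    apply: ler_sum => j _; apply: le_trans (le_moment j hC) _.
    rewrite momentZ -mulrA ler_wpM2l// momentD moment_cst mulrDl mul1r lerD//; last first.
      by rewrite exprn_ege1// ler1n.
    apply: le_trans (IH j) _; rewrite ler_wpM2l// lerXn2r ?nnegrE ?ler0n// ler_nat.
    by have := ltn_ord j; lia.
  rewrite sumr_const card_ord -[leLHS]mulr_natr exprSr mulrA ler_wpM2l ?ler_nat 1?leqW//.
  by rewrite !mulr_ge0 ?addr_ge0// exprn_ge0.
rewrite -(ler_pM2l n0) momentE.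
apply: (@le_trans _ _ (\sum_(i < n.+1) C * (B + 1) * n.+1%:R ^+ K.+1)).
  by apply: ler_sum => i _; apply: hc; rewrite -ltnS.
by rewrite sumr_const card_ord -[leLHS]mulr_natl.
Qed.

(** The relative loss K^2 / (n + 1) is crude but survives the induction. It serves for the moments
    and again for counting choices of distinct cells. *)
Lemma ffact_ge n K : (K <= n)%N ->
  n.+1%:R ^+ K * (n.+1%:R - K%:R ^+ 2) <= n.+1%:R * (n ^_ K)%:R :> R.
Proof.
elim: K => [|K IH] Kn; first by rewrite expr0 expr0n mul1r subr0 ffactn0 mulr1.
rewrite ffactnSr natrM natrB 1?ltnW//.
have {}IH := IH (ltnW Kn); rewrite mulrA.
have nK : 0 <= n%:R - K%:R :> R by rewrite subr_ge0 ler_nat ltnW.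
apply: le_trans (ler_wpM2r nK IH).
rewrite exprSr -!mulrA ler_wpM2l ?exprn_ge0 ?ler0n//.
rewrite -subr_ge0 -!natr1; set N : R := n%:R; set k : R := K%:R.
have k0 : 0 <= k by rewrite ler0n.
have N0 : 0 <= N by rewrite ler0n.
have -> : (N + 1 - k ^+ 2) * (N - k) - (N + 1) * (N + 1 - (k + 1) ^+ 2) =
  k * (N + 1) + k ^+ 2 * (k + 1) by ring.
by rewrite addr_ge0// mulr_ge0 ?exprn_ge0// addr_ge0.
Qed.

Lemma ffact_ge34 n K : (4 * K ^ 2 <= n.+1)%N -> (K <= n)%N ->
  3 / 4 * n.+1%:R ^+ K <= (n ^_ K)%:R :> R.
Proof.
move=> h Kn; have n0 : 0 < n.+1%:R :> R by rewrite ltr0n.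
rewrite -(ler_pM2l n0); apply: le_trans (ffact_ge Kn).
rewrite [leLHS](_ : _ = n.+1%:R ^+ K * (3 / 4 * n.+1%:R)); last by ring.
rewrite ler_wpM2l ?exprn_ge0 ?ler0n//.
have : (4 * K ^ 2)%:R <= n.+1%:R :> R by rewrite ler_nat.
by rewrite natrM natrX; lra.
Qed.

Lemma bernoulli (e : R) j : 0 <= e -> 1 + j%:R * e <= (1 + e) ^+ j.
Proof.
move=> e0; elim: j => [|j IH]; first by rewrite mul0r addr0.
rewrite exprSr; apply: le_trans (ler_wpM2r _ IH); last by rewrite addr_ge0.
rewrite -natr1; set J : R := j%:R; have J0 : 0 <= J by rewrite ler0n.
by have : 0 <= J * e * e; [rewrite !mulr_ge0 | nra].
Qed.

(** The ratio of consecutive Catalan numbers tends to 4 > b^2, so from [K0] on they grow at least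
    like powers of [ga], the midpoint of b^2 and 4. The factor 4 leaves room in [content_tail]. *)
Lemma catalan_large (b : R) : 0 < b -> b < 2 -> exists K, 4 * b ^+ (2 * K) < catalan K.
Proof.
move=> b0 b2; set be := b ^+ 2.
have be0 : 0 < be by rewrite exprn_gt0.
have be4 : be < 4 by rewrite /be; nra.
have beE K : b ^+ (2 * K) = be ^+ K by rewrite exprM.
clearbody be.
pose ga := (be + 4) / 2.
(* The required inequality amounts to (4 - be) K >= 2 be + 4, and be < 4. *)
pose K0 := Num.bound (12 / (4 - be)).
have hK0 (K : nat) : (K0 <= K)%N -> ga <= 2 * (2 * K).+1%:R / K.+2%:R.
  move=> K0K; have p : 12 / (4 - be) < K%:R.
    apply: lt_le_trans (archi_boundP _) _; last by rewrite ler_nat.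
    by rewrite divr_ge0// subr_ge0 ltW.
  move: p; rewrite ltr_pdivrMr ?subr_gt0// ler_pdivlMr ?ltr0n// => p.
  by rewrite -!natr1 natrM /ga; lra.
clearbody K0; pose e := ga / be - 1.
have e0 : 0 < e by rewrite subr_gt0 ltr_pdivlMr// mul1r /ga; lra.
have ga0 : 0 < ga by rewrite /ga; lra.
have hj j : catalan K0 * ga ^+ j <= catalan (K0 + j).
  elim: j => [|j IH]; first by rewrite expr0 mulr1 addn0.
  rewrite addnS /= exprSr mulrA; apply: ler_pM => //.
  - by rewrite mulr_ge0 ?exprn_ge0// ltW// catalan_gt0.
  - exact: ltW.
  - by apply: hK0; rewrite leq_addr.
have c0 := catalan_gt0 K0.
pose D := 4 * be ^+ K0 / (catalan K0 * e).
have D0 : 0 <= D by rewrite divr_ge0 ?mulr_ge0 ?exprn_ge0 ?ltW.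
exists (K0 + Num.bound D)%N; set j := Num.bound D.
apply: lt_le_trans (hj j).
have hD : D < j%:R by exact: archi_boundP.
have -> : ga = be * (1 + e) by rewrite /e; field; rewrite gt_eqF.
rewrite beE exprD exprMn mulrA [_ * (be ^+ j * _)]mulrCA [ltLHS]mulrC.
rewrite ltr_pM2l ?exprn_gt0//.
apply: lt_le_trans (ler_wpM2l (ltW c0) (bernoulli j (ltW e0))).
move: hD; rewrite /D ltr_pdivrMr ?mulr_gt0//.
by move=> h; rewrite mulrDr mulr1 mulrCA (lt_trans h)// ltrDr.
Qed.

(** One-sided Paley-Zygmund argument with Q x = x^(2K) (x + t), t = b sqrt(n + 1). Q is at most 0
    below -t and at most 2 t^(2K+1) up to t. Yet its mean is at least 3 t^(2K+1), since the odd
    moment vanishes and 3/4 of [catalan K] exceeds 3 b^(2K). The excess must come from contents at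
    least t. *)
Lemma content_tail (b : R) : 0 < b -> b < 2 -> exists2 de : R, 0 < de &
  exists n0, forall n, (n0 <= n)%N -> de <= moment n (fun x => (b * sq n <= x)%R%:R).
Proof.
move=> b0 b2; have [K hK] := catalan_large b0 b2.
have [B1 B10 hB1] := moment_even_le (2 * K).+1.
have [B2 B20 hB2] := moment_even_le (2 * K).
pose B := 2 * B1 + 2 * b ^+ 2 * B2 + 1.
have B0 : 0 < B by rewrite /B ltr_wpDl// addr_ge0// !mulr_ge0// ltW// exprn_gt0.
pose u := b ^+ (2 * K).+1; have u0 : 0 < u by rewrite exprn_gt0.
pose th := u / (2 * B); have th0 : 0 < th by rewrite divr_gt0// mulr_gt0.
exists (2 * th * u); first by rewrite mulr_gt0// mulr_gt0.
exists (4 * K ^ 2 + K)%N => n hn.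
set s := sq n; have s0 : 0 < s by exact: sq_gt0.
set t := b * s; have t0 : 0 < t by rewrite mulr_gt0.
pose v := s ^+ (2 * K).+1; have v0 : 0 < v by rewrite exprn_gt0.
pose Q x := x ^+ (2 * K) * (x + t).
set p := moment n _.
(* Beyond t, the arithmetic-geometric inequality takes the place of Cauchy-Schwarz. [th] makes the
   quadratic term cost at most t^(2K+1) / 2, so at least half of t^(2K+1) is left for the
   indicator. *)
have Qle x : Q x <= 2 * t ^+ (2 * K).+1 + (th / v * Q x ^+ 2 + v / (4 * th) * (t <= x)%R%:R).
  have T0 : 0 <= t ^+ (2 * K).+1 by rewrite exprn_ge0// ltW.
  have [tx|xt] := leP t x.
    rewrite mulr1; have : 0 <= (th / v * Q x - 1 / 2) ^+ 2 * (v / th).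
      by rewrite mulr_ge0 ?sqr_ge0// divr_ge0// ltW.
    have -> : (th / v * Q x - 1 / 2) ^+ 2 * (v / th) =
      th / v * Q x ^+ 2 + v / (4 * th) - Q x by field; rewrite !gt_eqF.
    by lra.
  rewrite mulr0 addr0; have Q20 : 0 <= th / v * Q x ^+ 2.
    by rewrite mulr_ge0 ?sqr_ge0// divr_ge0// ltW.
  have xK : 0 <= x ^+ (2 * K) by rewrite exprM exprn_ge0// sqr_ge0.
  have [xt'|xt'] := leP x (- t).
    have : Q x <= 0 by rewrite /Q mulr_ge0_le0//; lra.
    by lra.
  suff : Q x <= 2 * t ^+ (2 * K).+1 by lra.
  rewrite /Q exprS [leRHS]mulrA [leRHS]mulrC ler_pM//; [by lra| |by lra].
  by rewrite !exprM lerXn2r ?nnegrE ?sqr_ge0//; nra.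
have Q2le x : Q x ^+ 2 <= 2 * x ^+ (2 * (2 * K).+1) + 2 * t ^+ 2 * x ^+ (2 * (2 * K)).
  have -> : Q x ^+ 2 = x ^+ (2 * (2 * K)) * (x + t) ^+ 2.
    by rewrite /Q exprMn -exprM; congr (_ ^+ _ * _); clear; lia.
  have -> : x ^+ (2 * (2 * K).+1) = x ^+ (2 * (2 * K)) * x ^+ 2.
    by rewrite -exprD; congr (_ ^+ _); clear; lia.
  have : 0 <= x ^+ (2 * (2 * K)) by rewrite exprM exprn_ge0// sqr_ge0.
  move: (x ^+ (2 * (2 * K))) => y y0.
  have : 0 <= y * (x - t) ^+ 2 by rewrite mulr_ge0 ?sqr_ge0.
  by nra.
have mQ2 : moment n (fun x => Q x ^+ 2) <= B * v ^+ 2.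
  apply: le_trans (le_moment n Q2le) _; rewrite momentD !momentZ.
  have h1 := hB1 n; have h2 := hB2 n; rewrite -sq_sqr -/s in h1 h2.
  rewrite -exprM in h1; rewrite -exprM in h2.
  have -> : v ^+ 2 = s ^+ (2 * (2 * K)) * s ^+ 2.
    by rewrite -exprM -exprD; congr (_ ^+ _); clear; lia.
  have e : s ^+ (2 * (2 * K).+1) = s ^+ (2 * (2 * K)) * s ^+ 2.
    by rewrite -exprD; congr (_ ^+ _); clear; lia.
  rewrite e in h1; rewrite /t /B exprMn; have : 0 <= s ^+ (2 * (2 * K)) * s ^+ 2.
    by rewrite mulr_ge0// exprn_ge0// ltW.
  set y := s ^+ (2 * (2 * K)); set z := s ^+ 2 => yz; rewrite -/y in h2; rewrite -/y -/z in h1.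
  have bz : 0 <= b ^+ 2 * z by rewrite mulr_ge0// exprn_ge0// ltW.
  have := ler_wpM2l bz h2; lra.
have mQ : 3 * u * v <= moment n Q.
  have -> : moment n Q = t * moment n (fun x => x ^+ (2 * K)).
    rewrite -momentZ -[RHS]add0r -(@moment_odd _ n (fun x => x ^+ (2 * K).+1)).
      by rewrite -momentD; apply: eq_moment => x; rewrite /Q exprSr; ring.
    by move=> x; rewrite exprNn -signr_odd /= oddM /= expr1 mulN1r.
  have h := moment_even_ge K n.
  have h34 : 3 / 4 * n.+1%:R ^+ K <= (n ^_ K)%:R :> R.
    by apply: ffact_ge34; [rewrite leqW// |]; apply: leq_trans hn; rewrite ?leq_addl ?leq_addr.
  apply: (@le_trans _ _ (t * (catalan K * (3 / 4 * n.+1%:R ^+ K)))); last first.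
    rewrite ler_wpM2l ?(ltW t0)//; apply: le_trans h.
    by rewrite ler_wpM2l// ltW// catalan_gt0.
  rewrite -(sq_sqr R n) -/s -exprM /t /u /v !exprS.
  have S0 : 0 < s ^+ (2 * K) by rewrite exprn_gt0.
  have -> : b * s * (catalan K * (3 / 4 * s ^+ (2 * K))) =
    catalan K * (3 / 4 * (b * (s * s ^+ (2 * K)))) by ring.
  have -> : 3 * (b * b ^+ (2 * K)) * (s * s ^+ (2 * K)) =
     4 * b ^+ (2 * K) * (3 / 4 * (b * (s * s ^+ (2 * K)))) by field.
  by rewrite ler_wpM2r ?ltW// !mulr_gt0.
have := le_moment n Qle; rewrite momentD moment_cst momentD !momentZ -/p => main.
have e1 : t ^+ (2 * K).+1 = u * v by rewrite /t exprMn.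
have e2 : th / v * moment n (fun x => Q x ^+ 2) <= u / 2 * v.
  apply: (@le_trans _ _ (th / v * (B * v ^+ 2))).
    by rewrite ler_wpM2l// divr_ge0// ltW.
  rewrite le_eqVlt; apply/orP; left; apply/eqP.
  by rewrite /th; field; rewrite !gt_eqF.
have : u / 2 * v <= v / (4 * th) * p.
  rewrite -mulrA in mQ; rewrite [u / 2 * v]mulrAC in e2 *.
  have aux (X A C M : R) : M <= 2 * X + (A + C) -> A <= X / 2 -> 3 * X <= M -> X / 2 <= C.
    by clear => *; lra.
  by rewrite e1 in main; exact: aux main e2 mQ.
rewrite [v / _ * p](_ : _ = p / (4 * th) * v); last by field; rewrite gt_eqF.
rewrite ler_pM2r// ler_pdivlMr; last by rewrite mulr_gt0.
by rewrite (_ : u / 2 * (4 * th) = 2 * th * u)//; clearbody u th; field.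
Qed.

End Moments.

(** * Asymptotics of the row probabilities *)

Section Limit.
Variable R : realType.
Local Notation f := (@dimR R).
Local Notation mean := (@mean R).
Local Notation step_mean := (@step_mean R).
Local Notation moment := (@moment R).
Local Notation row_prob := (@row_prob R).
Local Notation rows_prob := (@rows_prob R).
Local Notation sq n := (Num.sqrt (n.+1%:R : R)).

Lemma sq_large (C : R) : exists n0, forall n, (n0 <= n)%N -> C < sq n.
Proof.
exists (Num.bound (C ^+ 2)) => n hn.
apply: le_lt_trans (ler_norm C) _; rewrite -sqrtr_sqr ltr_sqrt ?ltr0n//.
apply: lt_le_trans (archi_boundP (sqr_ge0 C)) _; rewrite ler_nat.
exact: leq_trans hn (leqnSn n).
Qed.

Lemma rows_prob_ge0 n k : 0 <= rows_prob n k.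
Proof. by rewrite -(step_mean_cst n 0); apply: le_step_mean => r mu _ _; rewrite ler0n. Qed.

(* By Chebyshev's inequality: a positive probability that the next box has
   content at least [b sqrt n], in a row above [k], forces the [k + 1] first rows
   to be typically that long. *)
Lemma rowsum_lower k (e : R) : 0 < e -> e < 1 -> exists n0, forall n, (n0 <= n)%N ->
  k.+1%:R * (2 - 2 * e) * sq n < mean n (rowsum R k).
Proof.
move=> e0 e1; have b0 : 0 < 2 - e by lra.
have b2 : 2 - e < 2 by lra.
have [de de0 [n1 hn1]] := content_tail b0 b2.
set b := 2 - e in b0 b2 hn1 *.
set K : R := k.+1%:R; have K0 : 0 < K by rewrite ltr0n.
(* Bounds sqrt n times the tail probability: [K] for a new box in the rows 0, ..., k, and the second
   term for Chebyshev's inequality with variance at most K s and deviation K e s, the gap between K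
   (2 - e) s and the supposed bound K (2 - 2e) s. *)
pose C := K + 1 / (e ^+ 2 * K).
have [n2 hn2] := sq_large (C / de).
exists (maxn n1 (maxn n2 1)) => -[|n]; first by lia.
rewrite geq_max => /andP[h1]; rewrite geq_max => /andP[h2 _].
set s := sq n.+1; have s0 : 0 < s by exact: sq_gt0.
rewrite ltNge; apply/negP => hle; set E := mean n.+1 _ in hle.
set c := K * e * s; have c0 : 0 < c by rewrite /c mulr_gt0// mulr_gt0.
have split_tail : moment n.+1 (fun x => (b * s <= x)%R%:R) <=
    rows_prob n.+1 k + mean n.+1 (fun mu => c ^- 2 * (rowsum R k mu - E) ^+ 2).
  rewrite -step_mean_mu -step_meanD; apply: le_step_mean => r mu _ ar.
  have cE : 0 <= c ^- 2 * (rowsum R k mu - E) ^+ 2.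
    by rewrite mulr_ge0 ?sqr_ge0// invr_ge0 exprn_ge0// ltW.
  have [rk|kr] := leqP r k; first by rewrite -[leLHS]addr0 lerD// ler_nat leq_b1.
  rewrite add0r; have [tx|//] := leP (b * s) (content R r mu).
  have hS : K * (b * s) <= rowsum R k mu.
    rewrite (_ : K * (b * s) = \sum_(i < k.+1) b * s); last first.
      by rewrite sumr_const card_ord /K mulr_natl.
    apply: ler_sum => i _.
    apply: le_trans tx _; rewrite /content.
    apply: (@le_trans _ _ (row_length mu r)%:R); first by rewrite gerBl ler0n.
    by rewrite ler_nat row_length_anti//; apply: ltnW (leq_trans (ltn_ord i) kr).
  have cS : c <= rowsum R k mu - E.
    by rewrite lerBrDr; apply: le_trans hS; rewrite /c /b; lra.
  by rewrite mulrC ler_pdivlMr ?exprn_gt0// mul1r lerXn2r// ?nnegrE ltW// (lt_le_trans c0).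
have := hn1 n.+1 h1; rewrite -/s => hde.
have V := Var_rowsum R n k; rewrite -/E -/K in V.
have ss : sq n <= s by rewrite ler_wsqrtr// ler_nat.
have p1 : s * rows_prob n.+1 k <= K by exact: rows_prob_le.
have h3 : s * moment n.+1 (fun x => (b * s <= x)%R%:R) <= C.
  apply: le_trans (ler_wpM2l (ltW s0) split_tail) _.
  rewrite mulrDr /C lerD// meanZ.
  apply: (@le_trans _ _ (s * (c ^- 2 * (K * s)))).
    rewrite ler_wpM2l ?(ltW s0)// ler_wpM2l ?invr_ge0 ?exprn_ge0 ?(ltW c0)//.
    by apply: le_trans V _; rewrite ler_wpM2l// ltW.
  rewrite le_eqVlt; apply/orP; left; apply/eqP.
  by rewrite /c; clearbody s K; field; rewrite !gt_eqF.
have := hn2 n.+1 h2; rewrite -/s ltr_pdivrMr// => h4.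
have : s * de <= s * moment n.+1 (fun x => (b * s <= x)%R%:R) by rewrite ler_wpM2l// ltW.
by move=> h5; have := lt_le_trans h4 (le_trans h5 h3); rewrite ltxx.
Qed.

Lemma sum_rows_prob_le n k : \sum_(i < n) rows_prob i k <= 2 * k.+1%:R * Num.sqrt n%:R.
Proof.
elim: n => [|n IH]; first by rewrite big_ord0 sqrtr0 mulr0.
rewrite big_ord_recr /=; apply: le_trans (lerD IH (lexx _)) _.
rewrite -lerBrDl -mulrBr; set s := sq n; set q := Num.sqrt n%:R.
have s0 : 0 < s by exact: sq_gt0.
have q0 : 0 <= q by exact: sqrtr_ge0.
have qs : q <= s by rewrite ler_sqrt ?ler_nat ?leqnSn ?ler0n.
have e1 : s ^+ 2 = q ^+ 2 + 1 by rewrite /s /q !sqr_sqrtr ?ler0n// natr1.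
rewrite -(ler_pM2l s0); apply: le_trans (rows_prob_le R n k) _.
set K : R := k.+1%:R; have K0 : 0 <= K by rewrite ler0n.
have : 1 <= 2 * s * (s - q) by nra.
by move/(ler_wpM2l K0); rewrite mulr1; lra.
Qed.

(** Tauberian step. From time n to about (1 + e)^2 n the mean of the first rows grows by at least K
    e (1 - e)(2 + e) s in e (2 + e) s^2 steps, and by monotonicity no step gains more than the
    first. One e is lost in 1 - e, the other in rounding the number of steps. *)
Lemma rows_prob_lim k (e : R) : 0 < e -> e < 1 -> exists n0, forall n, (n0 <= n)%N ->
  k.+1%:R * (1 - 2 * e) <= sq n * rows_prob n k.
Proof.
(* The increment over the window is itself of relative order e, so the mean is needed with a
   relative error of order e^2. *)
move=> e0 e1; have e20 : 0 < e ^+ 2 / 2 by rewrite divr_gt0// exprn_gt0.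
have e21 : e ^+ 2 / 2 < 1 by nra.
have [n1 hn1] := rowsum_lower k e20 e21.
have [n2 hn2] := sq_large e^-1.
exists (maxn n1 n2) => n; rewrite geq_max => /andP[h1 h2].
set s := sq n; have s0 : 0 < s by exact: sq_gt0.
have es : 1 <= e * s.
  by have := hn2 n h2; rewrite -/s => /ltW; rewrite -[e^-1]mul1r ler_pdivrMr// mulrC.
(* This is ((1 + e)^2 - 1)(n + 1): after [d] further steps the square root has grown by a factor of
   at least 1 + e. *)
pose x := (2 * e + e ^+ 2) * s ^+ 2.
have x0 : 0 <= x by rewrite /x mulr_ge0 ?sqr_ge0// addr_ge0 ?sqr_ge0//; lra.
pose d := (Num.trunc x).+1.
have /andP[d1 d2] : (Num.trunc x)%:R <= x < d%:R by rewrite Num.Theory.truncn_itv.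
have dx : d%:R <= x + 1 by rewrite /d -natr1 lerD2r.
have s2 : s ^+ 2 = n.+1%:R by exact: sq_sqr.
have sN : (1 + e) * s <= sq (n + d).
  rewrite -[leLHS]ger0_norm; last by rewrite mulr_ge0// ?ltW//; lra.
  rewrite -sqrtr_sqr ler_sqrt ?ler0n// -addSn natrD -s2; apply: le_trans (lerD (lexx _) (ltW d2)).
  by rewrite /x; lra.
have hN := hn1 (n + d)%N (leq_trans h1 (leq_addr _ _)).
set K : R := k.+1%:R in hN *; have K0 : 0 < K by rewrite ltr0n.
set a := rows_prob n k; have a0 : 0 <= a by exact: rows_prob_ge0.
have sum_le : mean (n + d) (rowsum R k) <= 2 * K * s + d%:R * a.
  rewrite mean_rowsum big_split_ord /=; apply: lerD.
    apply: le_trans (sum_rows_prob_le n k) _; rewrite ler_wpM2l ?mulr_ge0 ?ler0n//.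
    by rewrite ler_sqrt ?ler_nat ?leqnSn ?ler0n.
  rewrite mulr_natl -[leRHS](_ : \sum_(i < d) a = _); last by rewrite sumr_const card_ord.
  by apply: ler_sum => i _; apply: rows_prob_anti; rewrite leq_addr.
have as_ : s * a <= K by exact: rows_prob_le.
have lower : K * (2 - e ^+ 2) * ((1 + e) * s) < 2 * K * s + d%:R * a.
  apply: le_lt_trans (lt_le_trans hN sum_le).
  have -> : 2 - 2 * (e ^+ 2 / 2) = 2 - e ^+ 2 by field.
  by rewrite ler_wpM2l// mulr_ge0 ?ltW//; nra.
have upper : s * (d%:R * a) <= x * (s * a) + K.
  rewrite mulrCA; apply: le_trans (ler_wpM2r _ dx) _; first by rewrite mulr_ge0// ltW.
  by rewrite mulrDl mul1r lerD2l.
have c0 : 0 < e * (2 + e) by rewrite mulr_gt0//; lra.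
have s20 : 0 < s ^+ 2 by rewrite exprn_gt0.
have main : K * (e * (1 - e) * (2 + e)) * s ^+ 2 <= e * (2 + e) * s ^+ 2 * (s * a) + K.
  have := ltr_pM2l s0 (K * (2 - e ^+ 2) * ((1 + e) * s)) (2 * K * s + d%:R * a).
  rewrite lower => /ltW h; have aux (K' e' s' D z : R) :
      s' * (K' * (2 - e' ^+ 2) * ((1 + e') * s')) <= s' * (2 * K' * s' + D) ->
      s' * D <= (2 * e' + e' ^+ 2) * s' ^+ 2 * z + K' ->
      K' * (e' * (1 - e') * (2 + e')) * s' ^+ 2 <= e' * (2 + e') * s' ^+ 2 * z + K'.
    by clear => *; lra.
  exact: aux h upper.
have Kb : K <= e * (2 + e) * s ^+ 2 * (K * e).
  have -> : e * (2 + e) * s ^+ 2 * (K * e) = K * ((2 + e) * (e * s) ^+ 2) by ring.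
  by rewrite ler_peMr ?(ltW K0)//; nra.
have c1 : 0 < e * (2 + e) * s ^+ 2 by rewrite mulr_gt0.
rewrite -(ler_pM2l c1); move: main Kb; move: (s * a) => z; lra.
Qed.

(** The limiting lower bound for the rows 0, ..., k minus the upper bound for the rows below k,
    which holds at every time. *)
Lemma row_prob_lim k (e : R) : 0 < e -> exists n0, forall n, (n0 <= n)%N ->
  1 - e <= sq n * row_prob n k.
Proof.
move=> e0; set K : R := k.+1%:R; have K1 : 1 <= K by rewrite ler1n.
pose x := e / (2 * K + e).
have D0 : 0 < 2 * K + e by lra.
have x0 : 0 < x by rewrite divr_gt0.
have x1 : x < 1 by rewrite ltr_pdivrMr// mul1r; lra.
have [n0 hn0] := rows_prob_lim k x0 x1; exists n0 => n /hn0.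
have xe : 2 * K * x <= e.
  by rewrite /x mulrA ler_pdivrMr//; nra.
case: k @K K1 x D0 x0 x1 hn0 xe => [|k] K K1 x D0 x0 x1 hn0 xe.
  by rewrite pc0 /K; move: xe; rewrite /K; lra.
have := rows_prob_le R n k; rewrite rows_probS mulrDr.
by move: xe; rewrite /K -[k.+2%:R]natr1; move: (k.+1%:R : R) => y; lra.
Qed.

Lemma back_ratio_lim k (e : R) : 0 < e -> exists n0, forall n, (n0 <= n)%N ->
  mean n.+1 (fun nu => `|back_ratio R n k nu - 1|) <= e.
Proof.
move=> e0; have e20 : 0 < e ^+ 2 / 2 by rewrite divr_gt0// exprn_gt0.
have [n0 hn0] := row_prob_lim k e20; exists n0 => n /hn0 h.
apply: le_trans (mean_abs_back_ratio R n k) _.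
rewrite -[leRHS]ger0_norm ?(ltW e0)// -sqrtr_sqr ler_sqrt ?sqr_ge0//; lra.
Qed.

End Limit.

(** * One-step comparison with the product law *)

Section RowWords.
Variables (R : realType) (k : nat).
Local Notation f := (@dimR R).
Local Notation mean := (@mean R).
Local Notation sq n := (Num.sqrt (n.+1%:R : R)).
Local Notation rt := (truncated_row k).

Definition row_type (t : nat) : rt := insub t.

Definition row_of (mu nu : young) : rt :=
  [pick r : 'I_k.+1 | `[< adds_box_in_row mu nu r >]].

Lemma row_of_add mu t : addable mu t -> row_of mu (add_box mu t) = row_type t.
Proof.
move=> at_; rewrite /row_of /row_type; case: pickP => [r /asboolP h|h].
  by rewrite (adds_box_inj (adds_box_add at_) h) valK.
case: insubP => // r _ rt; have := h r.
by rewrite rt => /asboolP []; exact: adds_box_add.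
Qed.

Fixpoint row_words (l : nat) : seq (seq rt) :=
  if l is l'.+1 then [seq rcons rs s | rs <- row_words l', s <- enum {: option 'I_k.+1}]
  else [:: [::]].

Definition down_type (s : rt) (F : young -> R) (nu : young) : R :=
  down_sum (weight nu) nu (fun t => if row_type t == s then F (rem_box nu t) else 0).

(** Number of paths from the empty diagram to a given one whose last steps have the types [rs], the
    latest step last; f counts the unconstrained beginnings. *)
Definition path_count (rs : seq rt) : young -> R := foldl (fun F s => down_type s F) f rs.

Lemma path_count_rcons rs s : path_count (rcons rs s) = down_type s (path_count rs).
Proof. exact: foldl_rcons. Qed.

Lemma big_row_wordsS (V : nmodType) l (F : seq rt -> V) :
  \sum_(rs <- row_words l.+1) F rs =
  \sum_(rs <- row_words l) \sum_(s : option 'I_k.+1) F (rcons rs s).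
Proof.
rewrite [row_words _.+1]/row_words -/row_words big_flatten big_map.
by apply: eq_bigr => rs _; rewrite big_map big_enum.
Qed.

Lemma sum_down_type (F : young -> R) (G : rt -> R) nu :
  \sum_(s : option 'I_k.+1) down_type s F nu * G s =
  down_sum (weight nu) nu (fun t => F (rem_box nu t) * G (row_type t)).
Proof.
rewrite /down_type /down_sum; under eq_bigr do rewrite mulr_suml.
rewrite exchange_big /=; apply: eq_bigr => t _.
rewrite (bigD1 (row_type t : option 'I_k.+1))//= eqxx big1 ?addr0// => s.
by rewrite eq_sym => /negPf ->; rewrite mul0r.
Qed.

Definition path_rows m l (p : seq young) : seq rt :=
  [seq row_of (nth young0 p (m + i)) (nth young0 p (m + i).+1) | i <- iota 0 l].

Lemma path_rows_rcons m l p nu : size p = (m + l).+1 ->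
  path_rows m l.+1 (rcons p nu) = rcons (path_rows m l p) (row_of (last young0 p) nu).
Proof.
move=> sp; rewrite /path_rows -addn1 iotaD map_cat [iota (0 + _) 1]/= [map _ [:: _]]/= cats1.
congr rcons.
  apply/eq_in_map => i; rewrite mem_iota add0n => /andP[_ il].
  by rewrite !nth_rcons sp !ltnS ltn_add2l il leq_add2l ltnW.
by rewrite !nth_rcons sp add0n ltnn eqxx ltnSn (last_nth young0) sp.
Qed.

Lemma sum_paths_rows m l (G : seq rt -> young -> R) :
  \sum_(p <- paths (m + l)) G (path_rows m l p) (last young0 p) =
  \sum_(rs <- row_words l) \sum_(nu <- youngs (m + l)) path_count rs nu * G rs nu.
Proof.
elim: l G => [|l IH] G.
  rewrite addn0 big_seq1 /path_count /= (sum_paths_last m (G [::])).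
  by apply: eq_bigr => nu _; rewrite /dimR mulr_natl.
rewrite addnS sum_pathsS.
pose G' rs mu := up_sum (m + l).+1 mu (fun t => G (rcons rs (row_type t)) (add_box mu t)).
transitivity (\sum_(p <- paths (m + l)) G' (path_rows m l p) (last young0 p)).
  apply: eq_big_seq => p /paths_size sp; apply: eq_up_sum => t at_.
  by rewrite path_rows_rcons// last_rcons row_of_add.
rewrite IH big_row_wordsS; apply: eq_bigr => rs _.
transitivity (\sum_(mu <- youngs (m + l)) up_sum (m + l).+1 mu
    (fun t => path_count rs mu * G (rcons rs (row_type t)) (add_box mu t))).
  by apply: eq_bigr => mu _; rewrite /G' /up_sum mulr_sumr.
rewrite -(up_down_adjoint (m + l).+1 (m + l)
  (fun t mu nu => path_count rs mu * G (rcons rs (row_type t)) nu)).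
rewrite exchange_big; apply: eq_big_seq => nu /weight_youngs w.
under [RHS]eq_bigr do rewrite path_count_rcons.
by rewrite (sum_down_type (path_count rs) (fun s => G (rcons rs s) nu)) w.
Qed.

Variable rho : R.
Hypotheses (rho0 : 0 <= rho) (rho1 : k.+1%:R * rho <= 1).

Definition row_law (s : rt) : R := if s is Some _ then rho else 1 - k.+1%:R * rho.

Definition row_words_law (rs : seq rt) : R := \prod_(s <- rs) row_law s.

Lemma row_law_ge0 s : 0 <= row_law s.
Proof. by case: s => //=; rewrite subr_ge0. Qed.

Lemma row_words_law_ge0 rs : 0 <= row_words_law rs.
Proof. by apply: prodr_ge0 => s _; exact: row_law_ge0. Qed.

Lemma sum_option (F : option 'I_k.+1 -> R) :
  \sum_s F s = F None + \sum_(r < k.+1) F (Some r).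
Proof.
rewrite (bigD1 None)//=; congr (_ + _).
rewrite (reindex_omap (fun r : 'I_k.+1 => Some r) id) //=; last by case.
by apply: eq_bigl => r; rewrite eqxx.
Qed.

Lemma sum_row_law : \sum_(s : option 'I_k.+1) row_law s = 1.
Proof. by rewrite sum_option /= sumr_const card_ord mulr_natl subrK. Qed.

Lemma sum_row_words_law l : \sum_(rs <- row_words l) row_words_law rs = 1.
Proof.
elim: l => [|l IH]; first by rewrite big_seq1 /row_words_law big_nil.
rewrite big_row_wordsS -IH; apply: eq_bigr => rs _; rewrite /row_words_law.
transitivity (\sum_(s : option 'I_k.+1) (\prod_(s <- rs) row_law s) * row_law s).
  by apply: eq_bigr => s _; rewrite big_rcons.
by rewrite -mulr_sumr sum_row_law mulr1.
Qed.

(** L1 distance between the law of the rows and final diagram, of mass [path_count rs nu] f(nu) / (m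
    + l)!, and the product law. [step_dist] is the case of one step. *)
Definition path_dist m l : R := (\sum_(rs <- row_words l) \sum_(nu <- youngs (m + l))
  `|path_count rs nu - row_words_law rs * f nu| * f nu) / (m + l)`!%:R.

Definition step_dist n : R := (\sum_(s : option 'I_k.+1) \sum_(nu <- youngs n.+1)
  `|down_type s f nu - row_law s * f nu| * f nu) / n.+1`!%:R.

Lemma down_type_linear s c F G nu :
  down_type s (fun mu => F mu - c * G mu) nu = down_type s F nu - c * down_type s G nu.
Proof.
rewrite /down_type /down_sum mulr_sumr -sumrB; apply: eq_bigr => t _.
by case: ifP; rewrite ?mulr0 ?subr0.
Qed.

Lemma down_type_norm s F nu : `|down_type s F nu| <= down_type s (fun mu => `|F mu|) nu.
Proof.
apply: le_trans (ler_norm_sum _ _ _) _; apply: ler_sum => t _.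
by case: ifP; rewrite ?normr0.
Qed.

(** The old error is transported without growth: summed over the type of the new box, removal is D,
    and moving D onto f as U produces the factor absorbed by the factorials. The new error is
    multiplied by the product law of the earlier letters, of mass 1. *)
Lemma path_distS m l : path_dist m l.+1 <= path_dist m l + step_dist (m + l).
Proof.
rewrite /path_dist addnS; set N := (m + l)%N.
have N0 := fact_gt0R R N.+1.
rewrite ler_pdivrMr// mulrDl /step_dist divfK ?gt_eqF//.
rewrite [(N.+1)`!%N]factS natrM [N.+1%:R * _]mulrC mulrA divfK ?gt_eqF ?fact_gt0R//.
rewrite big_row_wordsS.
pose D rs mu := path_count rs mu - row_words_law rs * f mu.
apply: (@le_trans _ _ (\sum_(rs <- row_words l) (\sum_(s : option 'I_k.+1) \sum_(nu <- youngs N.+1)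
   (down_type s (fun mu => `|D rs mu|) nu * f nu +
    row_words_law rs * (`|down_type s f nu - row_law s * f nu| * f nu))))).
  apply: ler_sum => rs _; apply: ler_sum => s _; apply: ler_sum => nu _.
  rewrite mulrA -mulrDl ler_wpM2r ?ler0n// path_count_rcons /row_words_law big_rcons /= -/(row_words_law rs).
  have -> : down_type s (path_count rs) nu - row_words_law rs * row_law s * f nu =
    down_type s (D rs) nu + row_words_law rs * (down_type s f nu - row_law s * f nu).
    by rewrite /D down_type_linear; ring.
  apply: le_trans (ler_normD _ _) _; rewrite lerD ?down_type_norm//.
  by rewrite normrM (ger0_norm (row_words_law_ge0 _)).
under eq_bigr do under eq_bigr do rewrite big_split /= -mulr_sumr.
under eq_bigr do rewrite big_split /= -mulr_sumr.
rewrite big_split /= -mulr_suml sum_row_words_law mul1r lerD2r.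
rewrite mulr_suml le_eqVlt; apply/orP; left; apply/eqP; apply: eq_bigr => rs _.
rewrite exchange_big /=.
transitivity (\sum_(nu <- youngs N.+1) f nu * downop (fun mu => `|D rs mu|) nu).
  apply: eq_bigr => nu _; rewrite -mulr_suml mulrC; congr (_ * _).
  transitivity (\sum_(s : option 'I_k.+1) down_type s (fun mu => `|D rs mu|) nu * 1).
    by apply: eq_bigr => s _; rewrite mulr1.
  rewrite (sum_down_type _ (fun=> 1)) /downop; apply: eq_down_sum => t _.
  by rewrite mulr1.
rewrite adjoint_op mulr_suml; apply: eq_big_seq => mu /weight_youngs w.
by rewrite /upop up_dimR// w; rewrite /D; ring.
Qed.

Lemma path_dist_le m l : path_dist m l <= \sum_(i < l) step_dist (m + i).
Proof.
elim: l => [|l IH].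
  rewrite big_ord0 /path_dist big_seq1 big1 ?mul0r// => nu _.
  by rewrite /path_count /row_words_law /= big_nil mul1r subrr normr0 mul0r.
by rewrite big_ord_recr /=; apply: le_trans (path_distS m l) _; rewrite lerD2r.
Qed.

Lemma down_typeE (r : 'I_k.+1) F nu : down_type (Some r) F nu = down_row r F nu.
Proof.
rewrite /down_type (@down_sum_widen _ _ (maxn (weight nu) r).+1) ?leqW ?leq_maxl//.
rewrite /down_row -(@down_sum_pred1 _ (maxn (weight nu) r).+1 nu r (fun t => F (rem_box nu t)))
  ?ltnS ?leq_maxr//.
apply: eq_down_sum => t _; rewrite /row_type; case: insubP => [u _ ut|].
  rewrite -ut (_ : (Some u == Some r) = (val u == val r :> nat))//.
  by case: eqP; rewrite ?mulr1 ?mulr0.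
rewrite -leqNgt (_ : (None == Some r) = false)// => kt.
rewrite (_ : (t == r) = false) ?mulr0//; apply/eqP => e.
by have := ltn_ord r; rewrite -e ltnNge kt.
Qed.

Lemma step_dist_le n : step_dist n <= 2 * \sum_(r < k.+1)
  ((sq n)^-1 * mean n.+1 (fun nu => `|back_ratio R n r nu - 1|) + `|(sq n)^-1 - rho|).
Proof.
pose e (r : 'I_k.+1) nu := `|down_row r f nu - rho * f nu|.
(* For each [nu] both families of weights sum to f(nu), so the error at the letter oo is at most the
   sum of the others; hence the factor 2. *)
have h1 (nu : young) : weight nu = n.+1 ->
    `|down_type None f nu - row_law None * f nu| <= \sum_(r < k.+1) e r nu.
  move=> w; have := sum_down_type f (fun=> 1) nu.
  under eq_bigr do rewrite mulr1.
  under [in RHS]eq_down_sum do rewrite mulr1.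
  rewrite w down_dimR ?w ?leqnn// sum_option => h.
  have -> : down_type None f nu - row_law None * f nu =
      \sum_(r < k.+1) (rho * f nu - down_row r f nu).
    rewrite sumrB sumr_const card_ord -[_ *+ _]mulr_natl.
    move: h; under eq_bigr do rewrite down_typeE; rewrite /row_law.
    move: (\sum_(i < _) _) => X h; have -> : down_type None f nu = f nu - X by rewrite -h addrK.
    by ring.
  apply: le_trans (ler_norm_sum _ _ _) _; apply: ler_sum => r _.
  by rewrite distrC.
have h2 (r : 'I_k.+1) : (\sum_(nu <- youngs n.+1) e r nu * f nu) / n.+1`!%:R <=
    (sq n)^-1 * mean n.+1 (fun nu => `|back_ratio R n r nu - 1|) + `|(sq n)^-1 - rho|.
  rewrite -meanZ -[X in _ + X](mean_cst n.+1) -meanD ler_pM2r ?invr_gt0 ?fact_gt0R//.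
  apply: ler_sum => nu _; rewrite expr2 -mulrA [leRHS]mulrC ler_wpM2r ?ler0n//.
  have s0 := sq_gt0 R n.
  have -> : e r nu = f nu * `|(sq n)^-1 * (back_ratio R n r nu - 1) + ((sq n)^-1 - rho)|.
    rewrite -{1}(ger0_norm (ltW (dimR_gt0 R nu))) -normrM /e; congr (`|_|).
    by rewrite /back_ratio; field; rewrite dimR_neq0 gt_eqF.
  rewrite ler_wpM2l ?ler0n//; apply: le_trans (ler_normD _ _) _.
  by rewrite lerD2r normrM ger0_norm// invr_ge0 ltW.
apply: (@le_trans _ _ (2 * \sum_(r < k.+1) (\sum_(nu <- youngs n.+1) e r nu * f nu) / n.+1`!%:R)).
  rewrite -mulr_suml mulrA ler_pM2r ?invr_gt0 ?fact_gt0R// sum_option.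
  rewrite mulr_natl mulr2n lerD//; last first.
    by apply: ler_sum => r _; apply: ler_sum => nu _; rewrite down_typeE.
  rewrite exchange_big /= big_seq [leRHS]big_seq; apply: ler_sum => nu /weight_youngs w.
  by rewrite -mulr_suml ler_wpM2r ?ler0n// h1.
by rewrite ler_wpM2l//; apply: ler_sum => r _; exact: h2.
Qed.

End RowWords.

(** * The law of the growth process *)

Section Probability.
Variable R : realType.

Definition cell (N j : nat) : set R := [set` `[j%:R / N%:R, j.+1%:R / N%:R[].

Lemma uniform_cell N j : (j < N)%N ->
  uniform_prob (@ltr01 R) (cell N j) = (N%:R^-1)%:E.
Proof.
move=> jN; have N0 : 0 < N%:R :> R by rewrite ltr0n; lia.
rewrite /uniform_prob (eq_integral (fun=> 1%:E)); last first.
  move=> x; rewrite inE /cell /= in_itv /= => /andP[x0 x1].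
  rewrite /uniform_pdf subr0 invr1 ifT//; apply/andP; split.
    by apply: le_trans x0; rewrite divr_ge0// ler0n.
  apply: le_trans (ltW x1) _; rewrite ler_pdivrMr// mul1r ler_nat//.
rewrite integral_cst; last by rewrite /cell; exact: measurable_itv.
rewrite mul1e; apply: etrans (lebesgue_measure_itv _) _; rewrite /= lte_fin.
rewrite ltr_pM2r ?invr_gt0// ltr_nat ltnSn -EFinB -mulrBl -natr1.
by rewrite addrAC subrr add0r mul1r.
Qed.

Lemma cell_disj N i j x : (0 < N)%N -> cell N i x -> cell N j x -> i = j.
Proof.
move=> N0 ; rewrite /cell /= !in_itv /= => /andP[i1 i2] /andP[j1 j2].
have N0' : 0 < N%:R :> R by rewrite ltr0n.
have := le_lt_trans i1 j2; have := le_lt_trans j1 i2.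
rewrite !ltr_pM2r ?invr_gt0// !ltr_nat; lia.
Qed.

Lemma cell_lt N i j x y : (0 < N)%N -> cell N i x -> cell N j y -> (i < j)%N -> x < y.
Proof.
move=> N0 ; rewrite /cell /= !in_itv /= => /andP[i1 i2] /andP[j1 j2] ij.
have N0' : 0 < N%:R :> R by rewrite ltr0n.
apply: lt_le_trans i2 (le_trans _ j1); rewrite ler_pM2r ?invr_gt0// ler_nat//.
Qed.

Lemma measure_bigsetU_seq d (T : measurableType d) (mu : {measure set T -> \bar R})
    (I : choiceType) (s : seq I) (F : I -> set T) :
  uniq s -> (forall i, i \in s -> measurable (F i)) ->
  (forall i j w, i \in s -> j \in s -> F i w -> F j w -> i = j) ->
  mu (\big[setU/set0]_(i <- s) F i) = (\sum_(i <- s) mu (F i))%E.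
Proof.
elim: s => [|i s IH]; first by rewrite !big_nil measure0.
move=> /= /andP[is_ us] mF dF; rewrite !big_cons measureU.
- congr (_ + _)%E; apply: IH => // [j js|j k w js ks]; [apply: mF|apply: dF];
    by rewrite inE ?js ?ks orbT.
- by apply: mF; rewrite inE eqxx.
- rewrite big_seq; apply: bigsetU_measurable => j js; apply: mF.
  by rewrite inE js orbT.
- rewrite -subset0 => w [Fi]; rewrite -bigcup_seq => -[j /= js Fj].
  have e := dF i j w (mem_head _ _) _ Fi Fj.
  by move: is_; rewrite e ?js// inE js orbT.
Qed.

(** * From i.i.d. uniform letters to uniform permutations *)

Section IID.
Context d (T : measurableType d) (P : probability T R) (xi : nat -> {RV P >-> R}).
Hypothesis iid : iid_uniform01 xi.

Definition cells n N (c : nat -> nat) : set T :=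
  \bigcap_(i in [set i | (i < n)%N]) (xi i @^-1` cell N (c i)).

Lemma measurable_cells n N c : measurable (cells n N c).
Proof.
apply: fin_bigcap_measurable; first exact: finite_II.
by move=> i _; rewrite -[X in measurable X]setTI; apply: measurable_funP => //;
   exact: measurable_itv.
Qed.

Lemma prob_cells n N (c : nat -> nat) : (forall i, (i < n)%N -> (c i < N)%N) ->
  P (cells n N c) = (N%:R^-1 ^+ n)%:E.
Proof.
move=> cN; have [ind unif] := iid.
pose J : {fset nat} := [fset x in iota 0 n]%fset.
have -> : cells n N c = \bigcap_(i in [set` J]) (xi i @^-1` cell N (c i)).
  rewrite /cells; congr (\bigcap_(i in _) _); apply/seteqP; split => i /=.
    by move=> il; rewrite inE mem_iota.
  by rewrite inE mem_iota.
rewrite (ind J (fun i => xi i @^-1` cell N (c i))); last first.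
  by move=> i _; exists (cell N (c i)); [exact: measurable_itv | rewrite setTI].
have pJ : perm_eq (enum_fset J) (iota 0 n).
  apply: uniq_perm; [exact: fset_uniq | exact: iota_uniq |].
  by move=> i; rewrite -[LHS]/(i \in J) inE.
rewrite (perm_big _ pJ) /= big_seq (eq_bigr (fun=> (N%:R^-1)%:E)); last first.
  move=> i; rewrite mem_iota add0n => il.
  have := unif i (cell N (c i)); rewrite uniform_cell ?cN// => <-//.
  exact: measurable_itv.
rewrite -big_seq prodEFin; congr (_%:E).
by rewrite big_const_seq count_predT size_iota iter_mulr_1.
Qed.

Definition xpath n (w : T) : seq young := rsk_path [seq xi j w | j <- iota 0 n].

Lemma rsk_path_sim n d1 d2 (T1 : orderType d1) (T2 : orderType d2)
    (x : nat -> T1) (x' : nat -> T2) :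
  (forall i j, (i < n)%N -> (j < n)%N -> (x i < x j)%O = (x' i < x' j)%O) ->
  rsk_path [seq x i | i <- iota 0 n] = rsk_path [seq x' i | i <- iota 0 n].
Proof.
move=> xx'; rewrite /rsk_path !size_map; apply: eq_map => i.
rewrite -!map_take; apply: (@RSK_sim _ _ _ _ _ x x' (fun i => i < n)%N) => //.
by apply/allP => j /mem_take; rewrite mem_iota.
Qed.

(** The path depends on the sample only through the finite table of comparisons of letters, so the
    event is a finite union of comparison events. *)
Lemma measurable_xpath n (B : set (seq young)) : measurable [set w | B (xpath n w)].
Proof.
pose cm (w : T) := [ffun p : 'I_n * 'I_n => (xi p.1 w < xi p.2 w)%R].
have cmP w w' : cm w = cm w' -> xpath n w = xpath n w'.
  move=> e; apply: rsk_path_sim => i j il jl.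
  by have := congr1 (fun M : {ffun _} => M (Ordinal il, Ordinal jl)) e; rewrite !ffunE.
have -> : [set w | B (xpath n w)] =
   \bigcup_(M in [set M | exists2 w, cm w = M & B (xpath n w)])
     \bigcap_(p in [set: 'I_n * 'I_n])
       ((fun w => (xi p.1 w < xi p.2 w)%R) @^-1` [set M p]).
  apply/seteqP; split => w /=.
    by move=> Bw; exists (cm w); [exists w | move=> p _ /=; rewrite ffunE].
  move=> [M [w' <-] Bw' h]; rewrite (cmP w w')//; apply/ffunP => p.
  by have /= e := h p I; rewrite [LHS]ffunE e.
apply: fin_bigcup_measurable; first exact: finite_finset.
move=> M _; apply: fin_bigcap_measurable; first exact: finite_finset.
move=> p _; rewrite -[X in measurable X]setTI.
have mf : measurable_fun setT (fun w => (xi p.1 w < xi p.2 w)%R).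
  by apply: measurable_realfun.measurable_fun_ltr; exact: measurable_funP.
exact: mf.
Qed.

(** A word of [n] distinct cells is coded by its increasing rearrangement and the permutation giving
    the relative order of its letters. *)
Definition order_word n N (q : 'S_n * n.-tuple 'I_N) (i : nat) : nat :=
  nth 0%N [seq (tnth q.2 (q.1 j) : nat) | j <- enum 'I_n] i.

Definition inc_tuples n N : {set n.-tuple 'I_N} :=
  finset (fun t : n.-tuple 'I_N => sorted ltn [seq val i | i <- t]).

Lemma order_wordE n N (q : 'S_n * n.-tuple 'I_N) (i : 'I_n) :
  order_word q i = tnth q.2 (q.1 i) :> nat.
Proof.
rewrite /order_word (nth_map i) ?size_enum_ord// nth_ord_enum//.
Qed.

Lemma inc_tnth n N (t : n.-tuple 'I_N) (i j : 'I_n) : t \in inc_tuples n N ->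
  (tnth t i < tnth t j)%N = (i < j)%N.
Proof.
rewrite inE => st.
have mono (i' j' : 'I_n) : (i' < j')%N -> (tnth t i' < tnth t j')%N.
  move=> ij; have h := sorted_ltn_nth ltn_trans 0%N st.
  have e (l : 'I_n) : nth 0%N [seq val i | i <- t] l = tnth t l.
    by rewrite (nth_map (tnth t l)) ?size_tuple// -tnth_nth.
  have := h i' j'; rewrite !inE size_map size_tuple !ltn_ord => /(_ isT isT ij).
  by rewrite !e.
apply/idP/idP; last exact: mono.
by case: (ltngtP i j) => // [/mono|/val_inj ->]; [lia | rewrite ltnn].
Qed.

Lemma inc_tnth_inj n N (t : n.-tuple 'I_N) (i j : 'I_n) : t \in inc_tuples n N ->
  tnth t i = tnth t j -> i = j.
Proof.
move=> tP e; apply/val_inj; case: (ltngtP i j) => // h.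
  by have := inc_tnth i j tP; rewrite h e ltnn.
by have := inc_tnth j i tP; rewrite h e ltnn.
Qed.

Lemma order_word_inj n N (q q' : 'S_n * n.-tuple 'I_N) :
  q.2 \in inc_tuples n N -> q'.2 \in inc_tuples n N ->
  (forall i, (i < n)%N -> order_word q i = order_word q' i) -> q = q'.
Proof.
case: q q' => [s t] [s' t'] /= tP tP' h.
have e (i : 'I_n) : tnth t (s i) = tnth t' (s' i).
  by apply: val_inj; have := h i (ltn_ord i); rewrite !order_wordE.
have ts : [seq val i | i <- t] = [seq val i | i <- t'].
  move: tP tP'; rewrite !inE => st st'.
  apply: (@irr_sorted_eq _ ltn) => //; [exact: ltn_trans|exact: ltnn|].
  move=> x; apply/mapP/mapP => -[y /tnthP[i ->] ->].
    by exists (tnth t' (s' ((s^-1)%g i))); rewrite ?mem_tnth// -e permKV.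
  by exists (tnth t (s ((s'^-1)%g i))); rewrite ?mem_tnth// e permKV.
have tt : t = t' by apply: val_inj; exact: (inj_map val_inj ts).
congr (_, _) => //; apply/permP => i; have := e i; rewrite -tt => ei.
exact: inc_tnth_inj tP ei.
Qed.

Lemma nth_perm_word n (s : 'S_n) (i : 'I_n) : nth 0%N (perm_word s) i = (s i).+1.
Proof. by rewrite /perm_word (nth_map i) ?size_enum_ord// nth_ord_enum. Qed.

Lemma xpath_cells n N (q : 'S_n * n.-tuple 'I_N) w : (0 < N)%N -> q.2 \in inc_tuples n N ->
  cells n N (order_word q) w -> xpath n w = rsk_path (perm_word q.1).
Proof.
move=> N0 qP cw.
have -> : perm_word q.1 = [seq nth 0%N (perm_word q.1) i | i <- iota 0 n].
  by rewrite -[LHS](mkseq_nth 0%N) size_perm_word.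
apply: rsk_path_sim => i j il jl.
have := cw i il; have := cw j jl.
rewrite -[i]/(val (Ordinal il)) -[j]/(val (Ordinal jl)) !order_wordE.
rewrite !nth_perm_word ltEnat /= ltnS.
rewrite -(inc_tnth _ _ qP); set b := tnth _ _; set a := tnth _ _ => /= hb ha.
case: (ltngtP a b) => [ab|ba|ab].
- by rewrite (cell_lt N0 ha hb ab).
- by apply/negbTE; rewrite -leNgt ltW// (cell_lt N0 hb ha ba).
have /perm_inj[ij] : q.1 (Ordinal il) = q.1 (Ordinal jl).
  by apply: (inc_tnth_inj qP); apply: val_inj.
by rewrite ij ltxx.
Qed.

(** Samples with two letters in one cell are discarded. The other cell words are disjoint events of
    probability N^(-n) on which the path is that of the permutation, and each permutation occurs
    with C(N, n) sets of cells. *)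
Lemma xpath_ge n N (B : set (seq young)) : (0 < N)%N ->
  (((#|[pred s : 'S_n | `[< B (rsk_path (perm_word s)) >] ]| * 'C(N, n))%:R *
     N%:R^-1 ^+ n)%:E <= P [set w | B (xpath n w)])%E.
Proof.
move=> N0; pose s := enum [pred q : 'S_n * n.-tuple 'I_N |
  `[< B (rsk_path (perm_word q.1)) >] && (q.2 \in inc_tuples n N)].
have sP q : q \in s -> B (rsk_path (perm_word q.1)) /\ q.2 \in inc_tuples n N.
  by rewrite mem_enum => /andP[/asboolP].
have sub : \big[setU/set0]_(q <- s) cells n N (order_word q) `<=` [set w | B (xpath n w)].
  move=> w; rewrite -bigcup_seq => -[q /= /sP[Bq qP] cw].
  by rewrite /= (xpath_cells N0 qP cw).
have mU : measurable (\big[setU/set0]_(q <- s) cells n N (order_word q)).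
  by apply: bigsetU_measurable => q _; exact: measurable_cells.
have lP : (P (\big[setU/set0]_(q <- s) cells n N (order_word q)) <=
    P [set w | B (xpath n w)])%E.
  by apply: le_measure; rewrite ?inE//; exact: measurable_xpath.
apply: le_trans lP.
have -> : P (\big[setU/set0]_(q <- s) cells n N (order_word q)) =
    (\sum_(q <- s) P (cells n N (order_word q)))%E.
  apply: measure_bigsetU_seq; first exact: enum_uniq.
    by move=> q _; exact: measurable_cells.
  move=> q q' w /sP[_ qP] /sP[_ qP'] cq cq'; apply: order_word_inj => // i il.
  exact: cell_disj (cq i il) (cq' i il).
have cN (q : 'S_n * n.-tuple 'I_N) i : (i < n)%N -> (order_word q i < N)%N.
  by move=> il; rewrite -[i]/(val (Ordinal il)) order_wordE.
rewrite (eq_bigr (fun=> (N%:R^-1 ^+ n)%:E)); last by move=> q _; rewrite prob_cells// => i; apply: cN.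
rewrite sumEFin lee_fin big_const_seq count_predT iter_addr_0 -[leRHS]mulr_natl.
rewrite ler_wpM2r ?exprn_ge0 ?invr_ge0 ?ler0n// ler_nat -cardE.
rewrite -card_ltn_sorted_tuples -cardX; apply: eq_leq; apply: eq_card => q.
by rewrite !inE.
Qed.

Lemma xpath_geR n (B : set (seq young)) :
  (((#|[pred s : 'S_n | `[< B (rsk_path (perm_word s)) >] ]|)%:R / n`!%:R)%:E <=
  P [set w | B (xpath n w)])%E.
Proof.
set a : R := #|_|%:R; have mB := measurable_xpath n B.
have Pfin : P [set w | B (xpath n w)] \is a fin_num by exact: fin_num_measure.
rewrite -[leRHS]fineK//; set p := fine _; rewrite lee_fin leNgt; apply/negP => lt.
have n0 := fact_gt0R R n.
pose q := a / n`!%:R; have q0 : 0 <= q by rewrite divr_ge0// ler0n.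
have qp : 0 < q - p by rewrite subr_gt0.
(* With N + 1 cells the bound is at least q (1 - n^2 / (N + 1)); this [N] makes the loss smaller
   than the supposed gap q - p. *)
pose N := maxn n (Num.bound (q * n%:R ^+ 2 / (q - p))).
have N0 : 0 < N.+1%:R :> R by rewrite ltr0n.
have hN : q * n%:R ^+ 2 < (q - p) * N.+1%:R.
  rewrite [ltRHS]mulrC -ltr_pdivrMr//; apply: lt_trans (archi_boundP _) _.
    by rewrite divr_ge0 ?(ltW qp)// mulr_ge0 ?exprn_ge0 ?ler0n.
  by rewrite ltr_nat ltnS leq_maxr.
have := @xpath_ge n N.+1 B (ltn0Sn _); rewrite -[leRHS]fineK// lee_fin -/p natrM -/a.
have h1 : 'C(N, n)%:R <= 'C(N.+1, n)%:R :> R by rewrite ler_nat leq_bin2l.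
have h2 := @ffact_ge R N n (leq_maxl _ _).
have Nn : 0 < N.+1%:R ^+ n :> R by rewrite exprn_gt0.
have h3 : q * (N.+1%:R - n%:R ^+ 2) / N.+1%:R <= a * 'C(N.+1, n)%:R * N.+1%:R^-1 ^+ n.
  rewrite ler_pdivrMr// exprVn [leRHS]mulrAC ler_pdivlMr//.
  apply: (@le_trans _ _ (a * 'C(N, n)%:R * N.+1%:R)); last first.
    by rewrite ler_wpM2r ?ler0n// ler_wpM2l// ler0n.
  have -> : a = q * n`!%:R by rewrite /q divfK// gt_eqF.
  rewrite [leLHS](_ : _ = q * (N.+1%:R ^+ n * (N.+1%:R - n%:R ^+ 2))); last by ring.
  rewrite [leRHS](_ : _ = q * (N.+1%:R * (N ^_ n)%:R)) ?ler_wpM2l//.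
  by rewrite -bin_ffact natrM; ring.
move=> /(le_trans h3); rewrite ler_pdivrMr//; move: hN.
by rewrite mulrBl mulrBr; lra.
Qed.

(* The words with letters in distinct cells of width [1 / N] give a lower bound as
   [N] grows; it is an equality, by passing to the complement of [B]. *)
Lemma prob_xpath n (B : set (seq young)) :
  P [set w | B (xpath n w)] =
  ((#|[pred s : 'S_n | `[< B (rsk_path (perm_word s)) >] ]|)%:R / n`!%:R)%:E.
Proof.
apply/eqP; rewrite eq_le xpath_geR andbT.
have mB := measurable_xpath n B.
have Pfin : P [set w | B (xpath n w)] \is a fin_num by exact: fin_num_measure.
have := xpath_geR n (~` B).
have -> : [set w | (~` B) (xpath n w)] = ~` [set w | B (xpath n w)] by [].
rewrite probability_setC// -(fineK Pfin); set p := fine _.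
rewrite -EFinB !lee_fin => h.
have n0 := fact_gt0R R n.
rewrite lerBrDr -lerBrDl in h; apply: le_trans h _.
rewrite lerBlDr -mulrDl ler_pdivlMr// mul1r -natrD ler_nat -card_Sn.
rewrite -(cardC [pred s : 'S_n | `[< B (rsk_path (perm_word s)) >] ]) leq_add2l.
apply: subset_leq_card; apply/fintype.subsetP => s; rewrite !inE => /asboolPn h.
exact: h.
Qed.

Lemma prob_xpath_paths n (B : set (seq young)) : P [set w | B (xpath n w)] =
  (\sum_(p <- paths n) `[< B p >]%:R * dimR R (last young0 p) / n`!%:R)%:E.
Proof.
rewrite prob_xpath; congr (_%:E); rewrite -mulr_suml; congr (_ / _).
transitivity (\sum_(s : 'S_n) `[< B (rsk_path (perm_word s)) >]%:R : R).
  rewrite -sum1_card natr_sum big_mkcond; apply: eq_bigr => s _ /=.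
  by rewrite inE; case: asboolP.
rewrite (sum_perm_path n (fun p => `[< B p >]%:R)); apply: eq_bigr => p _.
by rewrite mulr_natr.
Qed.

End IID.

Lemma growth_path d (T : measurableType d) (P : probability T R)
    (la : nat -> {RV P >-> young}) n (B : set (seq young)) :
  plancherel_growth_process la ->
  P [set w | B [seq la i w | i <- iota 0 n.+1]] =
  (\sum_(p <- paths n) `[< B p >]%:R * dimR R (last young0 p) / n`!%:R)%:E.
Proof.
move=> [_ [_ [d0 [T0 [P0 [xi [iid h]]]]]]].
have val_tuple (g : nat -> young) :
    val [tuple g i | i < n.+1] = [seq g i | i <- iota 0 n.+1].
  by rewrite -[in RHS]val_enum_ord -map_comp.
rewrite -(prob_xpath_paths iid).
have := h n [set t : n.+1.-tuple young | B (val t)].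
have -> : [set w | [set t : n.+1.-tuple young | B (val t)] [tuple la i w | i < n.+1]] =
    [set w | B [seq la i w | i <- iota 0 n.+1]].
  by apply/seteqP; split => w; rewrite /mkset (val_tuple (fun i => la i w)).
move=> ->; congr (P0 _); apply/seteqP; split => w; rewrite /mkset.
  rewrite (val_tuple (fun i => RSK [seq xi j w | j <- iota 0 i])).
  rewrite /xpath /rsk_path size_map size_iota => Bw; move: Bw; congr B.
  apply/eq_in_map => i; rewrite mem_iota add0n ltnS => /= il.
  by rewrite -map_take take_iota (minn_idPl il).
rewrite (val_tuple (fun i => RSK [seq xi j w | j <- iota 0 i])).
rewrite /xpath /rsk_path size_map size_iota => Bw; move: Bw; congr B.
apply/eq_in_map => i; rewrite mem_iota add0n ltnS => /= il.
by rewrite -map_take take_iota (minn_idPl il).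
Qed.

End Probability.

(** * Total variation distance *)

Section TotalVariation.
Variable R : realType.

(** The listed points carry the whole mass, so the lower bounds for [A] and for its complement add
    up to 1 and are both equalities. *)
Lemma prob_points d (T : measurableType d) (P : probability T R) (S : choiceType)
    (X : T -> S) (s : seq S) (g : S -> R) (A : set S) :
  uniq s -> (forall x, x \in s -> measurable (X @^-1` [set x])) ->
  (forall x, x \in s -> P (X @^-1` [set x]) = (g x)%:E) -> \sum_(x <- s) g x = 1 ->
  measurable (X @^-1` A) ->
  P (X @^-1` A) = (\sum_(x <- s) `[< A x >]%:R * g x)%:E.
Proof.
move=> us mX gX g1 mA.
have Pfin B : measurable B -> P B \is a fin_num by move=> ?; exact: fin_num_measure.
have lower B : measurable (X @^-1` B) ->
    ((\sum_(x <- s) `[< B x >]%:R * g x)%:E <= P (X @^-1` B))%E.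
  move=> mB; pose s' := [seq x <- s | `[< B x >]].
  have s's x : x \in s' -> x \in s by rewrite mem_filter => /andP[].
  have mU : measurable (\big[setU/set0]_(x <- s') X @^-1` [set x]).
    by rewrite big_seq; apply: bigsetU_measurable => x /s's; apply: mX.
  have lP : (P (\big[setU/set0]_(x <- s') X @^-1` [set x]) <= P (X @^-1` B))%E.
    apply: le_measure; rewrite ?inE// => w; rewrite -bigcup_seq => -[x /=].
    by rewrite mem_filter => /andP[/asboolP Bx _] ->.
  apply: le_trans lP.
  have -> : P (\big[setU/set0]_(x <- s') X @^-1` [set x]) =
      (\sum_(x <- s') P (X @^-1` [set x]))%E.
    apply: measure_bigsetU_seq; first by rewrite filter_uniq.
      by move=> x /s's; apply: mX.
    by move=> x y w _ _ <- <-.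
  rewrite (eq_big_seq (fun x => (g x)%:E)); last by move=> x /s's; apply: gX.
  rewrite sumEFin lee_fin big_filter [leRHS]big_mkcond; apply: ler_sum => x _.
  by case: asboolP => _; rewrite ?mul1r ?mul0r.
apply/eqP; rewrite eq_le lower// andbT.
have := lower (~` A); rewrite preimage_setC => /(_ (measurableC mA)).
rewrite probability_setC// -(fineK (Pfin _ mA)) -EFinB !lee_fin => h.
rewrite lerBrDr -lerBrDl in h; apply: le_trans h _.
rewrite -[X in X - _]g1 -sumrB; apply: ler_sum => x _.
case: asboolP => hA; case: asboolP => hC; rewrite ?mul1r ?mul0r ?subrr ?subr0//.
Qed.

Lemma row_words_uniq k l : uniq (row_words k l).
Proof.
elim: l => // l IH; rewrite [row_words _ _]/row_words -/row_words.
apply: allpairs_uniq => //; first exact: enum_uniq.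
by move=> [a b] [c d'] _ _ /= /rcons_inj.
Qed.

Lemma mem_row_words k l rs : (rs \in row_words k l) = (size rs == l).
Proof.
elim: l rs => [|l IH] rs; first by rewrite inE size_eq0.
rewrite [row_words _ _]/row_words -/row_words; apply/allpairsP/idP => [[[a b] /= [ha _ ->]]|].
  by rewrite size_rcons eqSS -IH.
case/lastP: rs => // rs s; rewrite size_rcons eqSS => h; exists (rs, s).
by rewrite /= IH h mem_enum.
Qed.

Section Independent.
Variables (k m l : nat) (d : measure_display) (T : measurableType d) (P : probability T R).
Variables (Rb : 'I_l -> {RV P >-> truncated_row k}) (lb : {RV P >-> young}).
Local Notation rho := ((Num.sqrt m%:R)^-1 : R).
Hypothesis ind : mutually_independent P (fun o : option 'I_l =>
  match o with Some i => generated_by (Rb i) | None => generated_by lb end).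
Hypothesis hR : forall (i : 'I_l) (r : 'I_k.+1), P (Rb i @^-1` [set Some r]) = rho%:E.
Hypothesis hR_oo : forall i : 'I_l,
  P (Rb i @^-1` [set None]) = (1 - (k + 1)%:R / Num.sqrt m%:R)%:E.
Hypothesis hl : forall mu, P (lb @^-1` [set mu]) = (plancherel R (m + l) mu)%:E.
Hypothesis km : ((k + 1) ^ 2 <= m)%N.

Let m0 : (0 < m)%N. Proof. by apply: leq_trans km; rewrite addn1. Qed.

Lemma rho_gt0 : 0 < rho. Proof. by rewrite invr_gt0 sqrtr_gt0 ltr0n. Qed.

Lemma rho_le : k.+1%:R * rho <= 1.
Proof.
have s0 : 0 < Num.sqrt m%:R :> R by rewrite sqrtr_gt0 ltr0n.
rewrite ler_pdivrMr// mul1r -[leLHS]ger0_norm// -sqrtr_sqr ler_wsqrtr//.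
by rewrite -natrX ler_nat -addn1.
Qed.

Let X (w : T) : seq (truncated_row k) * young := ([seq Rb i w | i <- enum 'I_l], lb w).

Let measurable_row i (B : set (truncated_row k)) : measurable (Rb i @^-1` B).
Proof. by rewrite -[X in measurable X]setTI; apply: measurable_funP. Qed.

Let measurable_lb (B : set young) : measurable (lb @^-1` B).
Proof. by rewrite -[X in measurable X]setTI; apply: measurable_funP. Qed.

Let measurable_X A : measurable (X @^-1` A).
Proof.
have -> : X @^-1` A = \bigcup_(t in [set: l.-tuple (option 'I_k.+1)])
   (\bigcap_(i in [set: 'I_l]) (Rb i @^-1` [set tnth t i]) `&`
     lb @^-1` [set nu | A (val t, nu)]).
  apply/seteqP; split => w /=.
    move=> Aw; exists [tuple Rb i w | i < l] => //; split; last exact: Aw.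
    by move=> i _ /=; rewrite tnth_mktuple.
  move=> [t _ [h]]; rewrite /X /=; congr (A (_, _)).
  rewrite -[val t]/(tval t) (_ : tval t = [seq tnth t i | i <- enum 'I_l]).
    by apply: eq_map => i; rewrite (h i I).
  by rewrite map_tnth_enum.
apply: fin_bigcup_measurable; first exact: finite_finset.
move=> t _; apply: measurableI; last exact: measurable_lb.
apply: fin_bigcap_measurable; first exact: finite_finset.
by move=> i _; exact: measurable_row.
Qed.

Let prob_row i (s : truncated_row k) : P (Rb i @^-1` [set s]) = (row_law rho s)%:E.
Proof. by case: s => [r|]; rewrite ?hR// hR_oo addn1. Qed.

Let prob_X rs nu : size rs = l ->
  P (X @^-1` [set (rs, nu)]) = (row_words_law rho rs * plancherel R (m + l) nu)%:E.
Proof.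
move=> /eqP srs; pose t := Tuple srs.
pose E (o : option 'I_l) : set T := match o with
  | Some i => Rb i @^-1` [set tnth t i] | None => lb @^-1` [set nu] end.
pose J : {fset option 'I_l} := [fset o in enum {: option 'I_l}]%fset.
have -> : X @^-1` [set (rs, nu)] = \bigcap_(o in [set` J]) E o.
  apply/seteqP; split => w /=.
    move=> [ers enu] [i|] _ //=; rewrite (tnth_nth None) /= -ers.
    by rewrite (nth_map i) ?size_enum_ord// nth_ord_enum.
  move=> h; congr (_, _); last by apply: (h None); rewrite /= inE mem_enum.
  rewrite -[rs]/(tval t) -[in RHS](map_tnth_enum t); apply: eq_map => i.
  by apply: (h (Some i)); rewrite /= inE mem_enum.
rewrite ind; last first.
  move=> [i|] _ /=; first by exists [set tnth t i] => //; rewrite setTI.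
  by exists [set nu] => //; rewrite setTI.
have pJ : perm_eq (enum_fset J) (enum {: option 'I_l}).
  apply: uniq_perm; [exact: fset_uniq | exact: enum_uniq |].
  by move=> o; rewrite -[LHS]/(o \in J) inE.
pose g (o : option 'I_l) : R := match o with
  | Some i => row_law rho (tnth t i) | None => plancherel R (m + l) nu end.
rewrite (perm_big _ pJ) /= (eq_bigr (fun o => (g o)%:E)); last first.
  by move=> [i|] _ /=; [exact: prob_row | exact: hl].
rewrite prodEFin big_enum /=; congr (_%:E).
rewrite (bigD1 None)//= mulrC; congr (_ * _).
rewrite (reindex_omap (fun i : 'I_l => Some i) id) //=; last by case.
rewrite /row_words_law -[rs]/(tval t) -[in RHS](map_tnth_enum t) big_map big_enum /=.
by apply: eq_bigl => i; rewrite eqxx.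
Qed.

Lemma prob_independent (A : set (seq (truncated_row k) * young)) :
  P [set w | A ([seq Rb i w | i <- enum 'I_l], lb w)] =
  (\sum_(rs <- row_words k l) \sum_(nu <- youngs (m + l)) `[< A (rs, nu) >]%:R *
     (row_words_law rho rs * dimR R nu * dimR R nu / (m + l)`!%:R))%:E.
Proof.
pose s := [seq (rs, nu) | rs <- row_words k l, nu <- youngs (m + l)].
pose g (x : seq (truncated_row k) * young) : R :=
  row_words_law rho x.1 * plancherel R (m + l) x.2.
have sP x : x \in s -> size x.1 = l /\ weight x.2 = (m + l)%N.
  by case/allpairsP => -[a b] /= [+ + ->]; rewrite mem_row_words mem_youngs => /eqP -> /eqP ->.
have gE rs nu : nu \in youngs (m + l) -> g (rs, nu) =
    row_words_law rho rs * dimR R nu * dimR R nu / (m + l)`!%:R.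
  move=> /weight_youngs w; rewrite /g /= plancherelE// expr2 /dimR.
  by rewrite !mulrA.
rewrite -/(X @^-1` A) (@prob_points _ _ P _ X s g A).
- congr (_%:E); rewrite big_allpairs_dep; apply: eq_bigr => rs _.
  by apply: eq_big_seq => nu h; rewrite gE.
- by apply: allpairs_uniq; [exact: row_words_uniq | exact: youngs_uniq | move=> [? ?] [? ?]].
- by move=> x _; exact: measurable_X.
- by move=> [rs nu] /sP[/= h _]; rewrite prob_X.
- rewrite big_allpairs_dep -(@sum_row_words_law R k rho l); apply: eq_bigr => rs _.
  rewrite /g /= -mulr_sumr -[RHS]mulr1; congr (_ * _).
  rewrite -(mean_cst (m + l) (1 : R)) /mean mulr_suml; apply: eq_big_seq => nu /weight_youngs w.
  by rewrite plancherelE// mulr1.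
- exact: measurable_X.
Qed.

Lemma tv_dist_le d' (T' : measurableType d') (P' : probability T' R)
    (la : nat -> {RV P' >-> young}) : plancherel_growth_process la ->
  let V (w : T') := ([tuple new_row k la (m + i.+1) w | i < l], la (m + l)%N w) in
  let Vb (w : T) := ([tuple Rb i w | i < l], lb w) in
  0 <= tv_dist P' P V Vb /\ tv_dist P' P V Vb <= path_dist k rho m l.
Proof.
move=> hla V Vb.
(* The laws were computed for sequences; an event on tuples is transported along the injection
   [val]. *)
pose A' (A : set (l.-tuple (truncated_row k) * young)) :=
  [set y : seq (truncated_row k) * young | exists2 x, A x & (val x.1, x.2) = y].
have A'P A x : A' A (val x.1, x.2) = A x.
  apply/propext; split => [[[t mu] Ax]|Ax]; last by exists x.
  by case: x => [t' mu'] /= [/val_inj <- <-].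
have hb (A : set (l.-tuple (truncated_row k) * young)) :
    `|fine (P' (V @^-1` A)) - fine (P (Vb @^-1` A))| <= path_dist k rho m l.
  have -> : Vb @^-1` A = [set w | A' A ([seq Rb i w | i <- enum 'I_l], lb w)].
    by apply/funext => w; exact: (esym (A'P A (Vb w))).
  rewrite prob_independent /=.
  have -> : V @^-1` A = [set w | [set p | A' A (path_rows k m l p, last young0 p)]
      [seq la i w | i <- iota 0 (m + l).+1]].
    have e w : (path_rows k m l [seq la i w | i <- iota 0 (m + l).+1],
        last young0 [seq la i w | i <- iota 0 (m + l).+1]) = (val (V w).1, (V w).2).
      congr (_, _); last first.
        by rewrite -addn1 iotaD map_cat /= last_cat.
      transitivity [seq new_row k la (m + (i : 'I_l).+1) w | i <- enum 'I_l]; last by [].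
      have nthE j : (j <= m + l)%N ->
          nth young0 [seq la i w | i <- iota 0 (m + l).+1] j = la j w.
        by move=> jl; rewrite (nth_map 0%N) ?size_iota// nth_iota.
      rewrite /path_rows -(val_enum_ord l) -map_comp; apply: eq_map => i.
      have il := ltn_ord i.
      have im : (m + i < m + l)%N by rewrite ltn_add2l.
      rewrite /comp (nthE (m + i)%N (ltnW im)) (nthE (m + i).+1 im).
      by rewrite /row_of /new_row /row_event addnS.
    apply/funext => w; transitivity (A' A (val (V w).1, (V w).2)).
      exact: (esym (A'P A (V w))).
    by rewrite -e.
  rewrite (growth_path (m + l) _ hla) /=.
  pose G rs nu := `[< A' A (rs, nu) >]%:R * dimR R nu / (m + l)`!%:R.
  rewrite (sum_paths_rows m l G) /path_dist mulr_suml -sumrB.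
  apply: le_trans (ler_norm_sum _ _ _) _; apply: ler_sum => rs _.
  rewrite mulr_suml -sumrB; apply: le_trans (ler_norm_sum _ _ _) _; apply: ler_sum => nu _.
  rewrite /G (_ : _ - _ = `[< A' A (rs, nu) >]%:R * ((path_count R rs nu - row_words_law rho rs * dimR R nu) *
    dimR R nu / (m + l)`!%:R)); last by ring.
  rewrite normrM; apply: le_trans (ler_piMl (normr_ge0 _) _) _.
    by rewrite ger0_norm ?ler0n// lern1 leq_b1.
  rewrite (normrM _ (_^-1)) (normrM _ (dimR R nu)) (ger0_norm (_ : 0 <= dimR R nu)) ?ler0n//.
  by rewrite (ger0_norm (_ : 0 <= _^-1)) ?invr_ge0 ?ler0n.
rewrite /tv_dist.
(* The empty event attains 0, which gives both nonemptiness and, with the upper bound, nonnegativity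
   of the supremum. *)
have Sne : [set `|fine (P' (V @^-1` A)) - fine (P (Vb @^-1` A))| | A in [set: set _]] 0.
  by exists set0 => //; rewrite !preimage_set0 !measure0 /= subrr normr0.
split.
  apply: ub_le_sup => //; exists (path_dist k rho m l) => _ [A _ <-]; exact: hb.
apply: ge_sup; first by exists 0.
by move=> _ [A _ <-]; exact: hb.
Qed.

End Independent.
End TotalVariation.

(** * Summation of the one-step errors *)

Lemma inv_sqrt_close (R : realType) (C : R) (m i l : nat) : (0 < m)%N -> (i < l)%N ->
  l%:R <= C * Num.sqrt m%:R ->
  `|(Num.sqrt (m + i).+1%:R)^-1 - (Num.sqrt m%:R)^-1| <= (Num.sqrt m%:R)^-1 * (C / Num.sqrt m%:R).
Proof.
move=> m0 il; set x := Num.sqrt m%:R; set y := Num.sqrt _ => lC.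
have x0 : 0 < x by rewrite sqrtr_gt0 ltr0n.
have xy : x <= y by rewrite ler_wsqrtr// ler_nat -addnS leq_addr.
have y0 : 0 < y := lt_le_trans x0 xy.
(* This is where l = O(sqrt m) enters: within l steps the square root moves by at most [C], so a
   single rate 1 / sqrt m serves for all of them. *)
have yx : (y - x) * (y + x) <= C * x.
  rewrite -subr_sqr !sqr_sqrtr ?ler0n// -addnS natrD addrAC subrr add0r.
  by apply: le_trans lC; rewrite ler_nat.
have {}yx : y - x <= C.
  rewrite -(ler_pM2r x0); apply: le_trans yx; rewrite ler_wpM2l ?subr_ge0//.
  by rewrite lerDr ltW.
have C0 : 0 <= C by apply: le_trans yx; rewrite subr_ge0.
rewrite distrC ger0_norm ?subr_ge0 ?lef_pV2 ?posrE//.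
rewrite -ler_pdivrMl ?invr_gt0// invrK.
rewrite (_ : x * _ = (y - x) / y); last by field; rewrite !gt_eqF.
by rewrite ler_pdivrMr// mulrAC ler_pdivlMr//; apply: ler_pM; rewrite ?subr_ge0// ltW.
Qed.

Lemma sum_step_dist_small (R : realType) (k : nat) (C e : R) : 0 < e ->
  exists m0, forall m l, (m0 <= m)%N -> l%:R <= C * Num.sqrt m%:R ->
    \sum_(i < l) step_dist k (Num.sqrt m%:R)^-1 (m + i) <= e * (l%:R / Num.sqrt m%:R).
Proof.
(* The 4 (k + 1) collects the factor 2 of [step_dist_le], the k + 1 rows, and the two errors per
   row: the backward ratio and the change of rate. *)
move=> e0; pose eta := e / (4 * k.+1%:R).
have eta0 : 0 < eta by rewrite divr_gt0// mulr_gt0// ltr0n.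
have /choice[N hN] := fun r : 'I_k.+1 => @back_ratio_lim R r eta eta0.
have [n1 hn1] := @sq_large R (C / eta).
exists (maxn (\max_r N r) n1).+1 => -[//|m] l; rewrite ltnS geq_max => /andP[Nm nm] lC.
set rho := (Num.sqrt _)^-1; have rho0 : 0 < rho by rewrite invr_gt0 sqrtr_gt0 ltr0n.
rewrite (_ : e * _ = \sum_(i < l) (rho * e)); last first.
  by rewrite sumr_const card_ord -mulr_natl; ring.
apply: ler_sum => i _; apply: le_trans (step_dist_le _ _ _) _.
rewrite (_ : rho * e = 2 * \sum_(r < k.+1) (rho * eta + rho * eta)); last first.
  have K0 : k.+1%:R != 0 :> R by rewrite pnatr_eq0.
  by rewrite sumr_const card_ord -[X in 2 * X]mulr_natl /eta; move: (k.+1%:R) K0 => K K0; field.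
rewrite ler_pM2l//; apply: ler_sum => r _; apply: lerD.
  apply: le_trans (_ : (Num.sqrt (m.+1 + i).+1%:R)^-1 * eta <= _).
    rewrite ler_wpM2l ?invr_ge0 ?sqrtr_ge0//; apply: hN.
    by apply: leq_trans (leq_bigmax r) _; rewrite (leq_trans Nm)// addSn leqW// leq_addr.
  rewrite ler_pM2r// lef_pV2 ?posrE ?sqrtr_gt0 ?ltr0n// ler_wsqrtr// ler_nat.
  by rewrite leqW// leq_addr.
apply: le_trans (inv_sqrt_close (ltn0Sn m) (ltn_ord i) lC) _.
rewrite ler_pM2l// ler_pdivrMr ?sqrtr_gt0 ?ltr0n// mulrC -ler_pdivrMr//.
by apply: ltW; apply: hn1.
Qed.

Theorem theorem2p2 (R : realType) (k : nat) (ell : nat -> nat)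
  (hell : (fun m => (ell m)%:R : R^o) =O_\oo (fun m => Num.sqrt m%:R : R^o))
  (d : measure_display) (T : measurableType d) (P : probability T R)
  (la : nat -> {RV P >-> young}) (hla : plancherel_growth_process la)
  (d' : nat -> measure_display) (T' : forall m, measurableType (d' m))
  (P' : forall m, probability (T' m) R)
  (Rbar : forall m, 'I_(ell m) -> {RV (P' m) >-> truncated_row k})
  (labar : forall m, {RV (P' m) >-> young})
  (hind : forall m, ((k + 1) ^ 2 <= m)%N ->
     mutually_independent (P' m) (fun o : option 'I_(ell m) =>
       match o with
       | Some i => generated_by (Rbar m i)
       | None => generated_by (labar m)
       end))
  (hRbar : forall m, ((k + 1) ^ 2 <= m)%N -> forall (i : 'I_(ell m)) (r : 'I_k.+1),
     P' m (Rbar m i @^-1` [set Some r]) = ((Num.sqrt m%:R)^-1)%:E)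
  (hRbar_oo : forall m, ((k + 1) ^ 2 <= m)%N -> forall i : 'I_(ell m),
     P' m (Rbar m i @^-1` [set None]) = (1 - (k + 1)%:R / Num.sqrt m%:R)%:E)
  (hlabar : forall m, ((k + 1) ^ 2 <= m)%N -> forall mu : young,
     P' m (labar m @^-1` [set mu]) = (plancherel R (m + ell m) mu)%:E) :
  let V m (w : T) :=
    ([tuple new_row k la (m + i.+1) w | i < ell m], la (m + ell m)%N w) in
  let Vbar m (w : T' m) := ([tuple Rbar m i w | i < ell m], labar m w) in
  let delta m := tv_dist P (P' m) (V m) (Vbar m) in
  delta m @[m --> \oo] --> (0 : R) /\
  (fun m => delta m : R^o) =o_\oo (fun m => (ell m)%:R / Num.sqrt m%:R : R^o).
Proof.
move=> V Vbar delta.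
have h m : ((k + 1) ^ 2 <= m)%N -> 0 <= delta m /\
    delta m <= \sum_(i < ell m) step_dist k (Num.sqrt m%:R)^-1 (m + i).
  move=> km; have [h0 h1] := tv_dist_le (hind m km) (hRbar m km) (hRbar_oo m km) (hlabar m km) hla.
  split=> //; apply: le_trans h1 _; apply: path_dist_le; last exact: rho_le.
  by rewrite ltW// (rho_gt0 _ km).
have [C [C0 hC]] : exists C : R, 0 < C /\
    \forall m \near \oo, (ell m)%:R <= C * Num.sqrt m%:R :> R.
  have /eqOP[M [_ hM]] := hell; exists (`|M| + 1); split; first by rewrite ltr_wpDl.
  have /hM : M < `|M| + 1 by rewrite (le_lt_trans (ler_norm M))// ltrDl.
  apply: filterS => m; rewrite [X in X <= _]ger0_norm ?ler0n//.
  by rewrite [X in _ * X]ger0_norm ?sqrtr_ge0.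
have small e : 0 < e -> \forall m \near \oo, `|delta m| <= e * ((ell m)%:R / Num.sqrt m%:R).
  move=> e0; have [m0 hm0] := sum_step_dist_small k C e0.
  near=> m; have km : ((k + 1) ^ 2 <= m)%N by near: m; exists ((k + 1) ^ 2)%N.
  have [d0 d1] := h m km; rewrite ger0_norm//; apply: le_trans d1 _; apply: hm0.
    by near: m; exists m0.
  by near: m.
split.
  apply/cvgr0Pnorm_le => e e0.
  have eC : 0 < e / C by rewrite divr_gt0.
  near=> m; have m0 : (0 < m)%N by near: m; exists 1%N.
  apply: le_trans (_ : e / C * ((ell m)%:R / Num.sqrt m%:R) <= _).
    by near: m; exact: small.
  rewrite mulrAC ler_pdivrMr// ler_pM2l// ler_pdivrMr ?sqrtr_gt0 ?ltr0n//.
  by near: m.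
apply/eqoP => e e0; near=> m; rewrite [X in _ * X]ger0_norm.
  by near: m; exact: small.
by rewrite divr_ge0 ?ler0n ?sqrtr_ge0.
Unshelve. all: by end_near.
Qed.
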